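(* (Bubnov-Galerkin method.) Let $\Omega\subseteq\mathbb{R}^2$ be a bounded simply connected domain with analytic boundary and regular analytic parametrization $\gamma$, and let $S_0$ be the modified Symm integral operator on $L^2(0,2\pi)$ associated with $\gamma$. Let $r\ge0$. There exists $c>0$ such that the following holds. Let $g\in H^{r+1}(0,2\pi)$, let $\Psi^\dagger\in H^r(0,2\pi)$ be the unique solution of $S_0\Psi^\dagger=g$, let $\delta\ge0$, let $g^\delta\in L^2(0,2\pi)$ satisfy $\|g^\delta-g\|_{L^2}\le\delta$, and let $n\ge1$ and $X_n=\mathrm{span}\{e^{ikt}\}_{k=-n}^{n}$. Let $\Psi_n^\delta\in X_n$ be the Bubnov-Galerkin solution, that is, the (unique) solution in $X_n$ of $$(S_0\Psi_n^\delta,\psi_n)=(g^\delta,\psi_n)\quad\text{for all }\psi_n\in X_n.$$ Then $$\|\Psi^\dagger-\Psi_n^\delta\|_{L^2}\le c\Big(n\delta+\frac{1}{n^r}\|\Psi^\dagger\|_{H^r}\Big).$$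
   Context: The boundary has a regular analytic parametrization $\partial\Omega=\{\gamma(t):t\in[0,2\pi)\}$, where $\gamma:\mathbb{R}\to\mathbb{R}^2$ is real-analytic, $2\pi$-periodic, injective on $[0,2\pi)$, and $|\gamma'(t)|>0$ for all $t$. $|\partial\Omega|$ denotes the length of $\partial\Omega$. The modified Symm integral operator is $$(S_0\Psi)(t)=\int_0^{2\pi}G(t,s)\Psi(s)\,ds,\quad t\in[0,2\pi),$$ $$G(t,s)=-\frac{1}{2\pi}\ln|\gamma(t)-\gamma(s)|+\frac{1}{2\pi}\frac{1}{|\partial\Omega|}\int_0^{2\pi}\ln|\gamma(t)-\gamma(\sigma)|\,|\gamma'(\sigma)|\,d\sigma+\frac{1}{|\partial\Omega|}.$$ $H^r(0,2\pi)$ is the $2\pi$-periodic (complex-valued) Sobolev space of order $r$, with norm $\|x\|_{H^r}^2=\sum_{k\in\mathbb{Z}}(1+k^2)^r|a_k|^2$ in terms of the Fourier coefficients $a_k$ of $x$; $(\cdot,\cdot)$ is the inner product of $L^2(0,2\pi)$. The estimate concerns those $n$ for which ''the Bubnov-Galerkin solution'' is meaningful, i.e. for which the finite-dimensional linear system is uniquely solvable. *)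

(* Defs.v *)
From HB Require Import structures.
From mathcomp Require Import all_boot all_order all_algebra.
From mathcomp Require Import complex.
From mathcomp Require Import all_classical all_reals all_analysis.

Set Implicit Arguments.
Unset Strict Implicit.
Unset Printing Implicit Defensive.

Import Order.TTheory GRing.Theory Num.Theory.
Import numFieldNormedType.Exports.

Local Open Scope classical_set_scope.
Local Open Scope ring_scope.
Local Open Scope complex_scope.

Section Geometry.
Context {R : realType}.
Implicit Types (gamma : R -> R * R) (Omega : set (R * R)).

(* The Euclidean norm; the norm `|v| of the library on R * R is the maximum
   norm, which would change the logarithmic kernel. *)
Definition enorm (v : R * R) : R := Num.sqrt (v.1 ^+ 2 + v.2 ^+ 2).

Definition real_analytic (f : R -> R) : Prop :=
  forall t0 : R, exists a : R^nat,
    \forall t \near t0, pseries a (t - t0) @ \oo --> f t.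

Definition null_homotopic_in Omega (l : R -> R * R) : Prop :=
  exists H : R * R -> R * R,
    [/\ {within `[0, 1] `*` `[0, 1], continuous H},
        H @` (`[0, 1] `*` `[0, 1]) `<=` Omega,
        forall t, t \in `[0, 1] -> H (0, t) = l t,
        forall t, t \in `[0, 1] -> H (1, t) = l 0 &
        forall s, s \in `[0, 1] -> H (s, 0) = l 0 /\ H (s, 1) = l 0].

(* Path-connectedness is not required here: it is automatic for the open
   connected sets to which this is applied. *)
Definition loops_contractible Omega : Prop :=
  forall l : R -> R * R,
    {within `[0, 1], continuous l} -> l @` `[0, 1] `<=` Omega -> l 0 = l 1 ->
    null_homotopic_in Omega l.

Definition bounded_simply_connected_domain Omega : Prop :=
  [/\ Omega !=set0, open Omega, connected Omega, bounded_set Omega &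
      loops_contractible Omega].

Definition topological_boundary Omega : set (R * R) :=
  closure Omega `\` interior Omega.

Definition velocity gamma (t : R) : R * R :=
  (derive1 (fst \o gamma) t, derive1 (snd \o gamma) t).

Definition regular_analytic_parametrization Omega gamma : Prop :=
  [/\ real_analytic (fst \o gamma) /\ real_analytic (snd \o gamma),
      forall t, gamma (t + 2 * pi) = gamma t,
      {in `[0, 2 * pi[ &, injective gamma},
      forall t, 0 < enorm (velocity gamma t) &
      topological_boundary Omega = gamma @` `[0, 2 * pi[].

End Geometry.

(* Elements of L^2(0,2pi) and of the Sobolev spaces are represented by
   functions R -> R[i], of which only the values on (0,2pi) matter, and only
   up to null sets. *)
Section FunctionSpaces.
Context {R : realType}.
Implicit Types f g : R -> R[i].

Definition period : set R := `]0, 2 * pi[.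

Definition cintegral f : R[i] :=
  (\int[lebesgue_measure]_(t in period) complex.Re (f t))
  +i* (\int[lebesgue_measure]_(t in period) complex.Im (f t)).

Definition eq_ae f g : Prop :=
  {ae lebesgue_measure, forall t : R, period t -> f t = g t}.

Definition cmod2 (z : R[i]) : R := complex.Re z ^+ 2 + complex.Im z ^+ 2.

Definition in_L2 f : Prop :=
  [/\ measurable_fun period (fun t => complex.Re (f t)),
      measurable_fun period (fun t => complex.Im (f t)) &
      (\int[lebesgue_measure]_(t in period) (cmod2 (f t))%:E < +oo)%E].

Definition L2norm f : R :=
  Num.sqrt (\int[lebesgue_measure]_(t in period) cmod2 (f t)).

Definition L2inner f g : R[i] := cintegral (fun t => f t * conjc (g t)).

Definition expi (x : R) : R[i] := cos x +i* sin x.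

Definition fourier_coef f (k : int) : R[i] :=
  ((2 * pi)^-1)%:C * cintegral (fun t => f t * expi (- (k%:~R * t))).

Definition sobolev_sum (r : R) f : \bar R :=
  \esum_(k in [set: int])
    (((1 + k%:~R ^+ 2) `^ r) * cmod2 (fourier_coef f k))%:E.

(* The periodic space H^r(0,2pi) for r >= 0, the only range in which it is a
   subspace of L^2(0,2pi). *)
Definition in_sobolev (r : R) f : Prop :=
  in_L2 f /\ (sobolev_sum r f < +oo)%E.

Definition sobolev_norm (r : R) f : R := Num.sqrt (fine (sobolev_sum r f)).

(* X_n = span {e^{ikt} : -n <= k <= n}; the index j stands for k = j - n. *)
Definition trig_space (n : nat) f : Prop :=
  exists a : 'I_(n.*2.+1) -> R[i],
    f = fun t => \sum_(j < n.*2.+1) a j * expi ((j%:R - n%:R) * t).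

End FunctionSpaces.

Section Symm.
Context {R : realType}.
Variable gamma : R -> R * R.
Implicit Types Psi g : R -> R[i].

Definition curve_length : R :=
  \int[lebesgue_measure]_(s in period) enorm (velocity gamma s).

(* The value of the kernel on the diagonal, where the library has ln 0 = 0,
   is irrelevant: it only concerns null sets. *)
Definition symm_kernel (t s : R) : R :=
  - (2 * pi)^-1 * ln (enorm (gamma t - gamma s))
  + (2 * pi)^-1 * curve_length^-1
    * (\int[lebesgue_measure]_(u in period)
         (ln (enorm (gamma t - gamma u)) * enorm (velocity gamma u)))
  + curve_length^-1.

Definition symm_operator Psi (t : R) : R[i] :=
  cintegral (fun s => (symm_kernel t s)%:C * Psi s).

Definition solves_galerkin g (n : nat) Psi : Prop :=
  trig_space n Psi /\
  forall psi, trig_space n psi ->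
    L2inner (symm_operator Psi) psi = L2inner g psi.

Definition galerkin_solution g (n : nat) Psi : Prop :=
  solves_galerkin g n Psi /\
  forall Phi, solves_galerkin g n Phi -> Phi = Psi.

End Symm.

(* Main.v *)
Require Import Defs.
From HB Require Import structures.
From mathcomp Require Import all_boot all_order all_algebra.
From mathcomp Require Import complex.
From mathcomp Require Import all_classical all_reals all_analysis.
From mathcomp Require Import measurable_realfun.
From mathcomp Require Import ring lra zify.
Import Order.TTheory GRing.Theory Num.Theory.
Import numFieldNormedType.Exports.
Import HBNNSimple.
Local Open Scope classical_set_scope.
Local Open Scope ring_scope.

Set Implicit Arguments.
Unset Strict Implicit.
Unset Printing Implicit Defensive.


(** The logarithmic kernel of an analytic closed curve is the kernel of the circle
   plus a remainder. In the real trigonometric system [trig] the kernel of the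
   circle is diagonal with entries [symbol j] of the size [1 / j]
   ([adjoint_circle_kernel]). The remainder is Lipschitz continuous because the
   singularities cancel, so that Bessel's inequality, applied to differences of
   translates, makes it a Hilbert-Schmidt operator even after division by the
   symbol ([curve_kernel_diagonal]). Dividing the [j]-th Galerkin equation by
   [symbol j] therefore gives a truncated equation of the second kind: the [j]-th
   coefficient plus a compact functional ([modified_form_e]). The division
   multiplies the data error by at most [2 n], while the error of best
   approximation of the solution enters with a constant factor only. The estimate
   follows if these truncated equations are stable uniformly in [n]
   ([galerkin_quasi_optimal]).

   For large [n] stability is a compactness argument ([stability_large]). Consider
   trigonometric polynomials of norm one for which the equations tend to zero.
   Corrected by multiples of the speed they have mean zero, and their logarithmic
   energy tends to zero. This energy is definite: inverse stereographic projection
   turns the squared distance of two points of the curve into [1 - c], where [c] is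
   an inner product of features of the points, up to factors that depend on one
   point only, and the expansion of [- ln (1 - c)] in powers of [c] is a sum of
   squares of moments against the monomials in the features ([energy_ge]). These
   monomials span a dense subspace since the features separate the points of the
   curve ([dense_separating_algebra]). Hence the sequence tends weakly to zero, its
   compact part tends to zero in norm, and the equations force the coefficients to
   zero as well, which contradicts the norm one. For each of the finitely many
   remaining [n] the uniqueness of the discrete solution is the invertibility of
   the matrix ([stability_fixed]).

   The kernel being real, complex functions split into their real and imaginary
   parts, and the error of best approximation is a tail of the Fourier series,
   which the Sobolev norm controls ([sobolev_tail]). *)

(** * Square-integrable functions on a finite measure space *)

Lemma ae_impl d (T : measurableType d) (R : realType) (mu : set T -> \bar R)
    (P Q : T -> Prop) : (forall t, P t -> Q t) ->
  {ae mu, forall t, P t} -> {ae mu, forall t, Q t}.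
Proof.
move=> PQ [N [mN N0 hN]]; exists N; split=> // t /= hQ; apply: hN => /= hP.
exact: hQ (PQ t hP).
Qed.

Section Summable.
Context d (T : measurableType d) (R : realType).
Variable mu : {measure set T -> \bar R}.
Implicit Types (f g h : T -> R) (c : R).

Definition summable1 f : Prop := mu.-integrable setT (EFin \o f).
Definition total f : R := \int[mu]_x f x.
Lemma summable1_measurable f : summable1 f -> measurable_fun setT f.
Proof. by move=> /measurable_int/measurable_EFinP. Qed.

Lemma summable1D f g : summable1 f -> summable1 g ->
  summable1 (fun x => f x + g x).
Proof. by move=> hf hg; have := integrableD measurableT hf hg. Qed.

Lemma summable1Z c f : summable1 f -> summable1 (fun x => c * f x).
Proof. by move=> hf; have := integrableZl measurableT c hf. Qed.

Lemma summable1N f : summable1 f -> summable1 (fun x => - f x).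
Proof.
by move=> hf; have := summable1Z (-1) hf; under eq_fun do rewrite mulN1r.
Qed.

Lemma summable1B f g : summable1 f -> summable1 g ->
  summable1 (fun x => f x - g x).
Proof. by move=> hf hg; apply: summable1D => //; exact: summable1N. Qed.

Lemma summable1_norm f : summable1 f -> summable1 (fun x => `|f x|).
Proof. by move=> /integrable_abse. Qed.

Lemma le_summable1 f g : measurable_fun setT f -> summable1 g ->
  (forall x, `|f x| <= g x) -> summable1 f.
Proof.
move=> mf hg fg; apply: (le_integrable measurableT _ _ hg).
  exact/measurable_EFinP.
by move=> x _ /=; rewrite lee_fin (le_trans (fg x))// ler_norm.
Qed.

Lemma summable1_sum (I : Type) (s : seq I) (F : I -> T -> R) :
  (forall i, summable1 (F i)) -> summable1 (fun x => \sum_(i <- s) F i x).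
Proof.
move=> hF; elim: s => [|i s IHs].
  by under eq_fun do rewrite big_nil; exact: integrable0.
by under eq_fun do rewrite big_cons; apply: summable1D.
Qed.

Lemma totalD f g : summable1 f -> summable1 g ->
  total (fun x => f x + g x) = total f + total g.
Proof. by move=> hf hg; rewrite /total RintegralD. Qed.

Lemma totalZ c f : summable1 f -> total (fun x => c * f x) = c * total f.
Proof. by move=> hf; rewrite /total RintegralZl. Qed.

Lemma totalN f : summable1 f -> total (fun x => - f x) = - total f.
Proof.
by move=> hf; rewrite -mulN1r -totalZ//; congr total; apply/funext => x;
  rewrite mulN1r.
Qed.

Lemma totalB f g : summable1 f -> summable1 g ->
  total (fun x => f x - g x) = total f - total g.
Proof. by move=> hf hg; rewrite totalD ?totalN//; exact: summable1N. Qed.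

Lemma total0 : total (fun=> 0) = 0.
Proof. by rewrite /total /Rintegral integral0. Qed.

Lemma total_sum (I : Type) (s : seq I) (F : I -> T -> R) :
  (forall i, summable1 (F i)) ->
  total (fun x => \sum_(i <- s) F i x) = \sum_(i <- s) total (F i).
Proof.
move=> hF; elim: s => [|i s IHs].
  by under eq_fun do rewrite big_nil; rewrite total0 big_nil.
under eq_fun do rewrite big_cons.
by rewrite totalD ?big_cons ?IHs//; exact: summable1_sum.
Qed.

Lemma total_ge0 f : (forall x, 0 <= f x) -> 0 <= total f.
Proof. by move=> f0; apply: Rintegral_ge0. Qed.

Lemma le_total f g : summable1 f -> summable1 g ->
  (forall x, f x <= g x) -> total f <= total g.
Proof. by move=> hf hg fg; apply: le_Rintegral. Qed.

Lemma normr_total f : summable1 f -> `|total f| <= total (fun x => `|f x|).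
Proof. by move=> hf; apply: le_normr_Rintegral. Qed.

End Summable.

Section SquareIntegrable.
Context d (T : measurableType d) (R : realType).
Variable mu : {finite_measure set T -> \bar R}.
Implicit Types (f g h : T -> R) (c : R).
Local Notation summable1 := (summable1 mu).
Local Notation total := (total mu).

Definition inner f g : R := total (fun x => f x * g x).
Definition square_summable f : Prop :=
  measurable_fun setT f /\ summable1 (fun x => f x ^+ 2).
Definition bounded_mfun f : Prop :=
  measurable_fun setT f /\ exists M, forall x, `|f x| <= M.

Lemma bounded_mfun_summable1 f : bounded_mfun f -> summable1 f.
Proof.
move=> [mf [M fM]]; apply: (@le_summable1 _ _ _ mu _ (cst M)) => //.
exact: finite_measure_integrable_cst.
Qed.

Lemma measurable_sqr f : measurable_fun setT f ->
  measurable_fun setT (fun x => f x ^+ 2).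
Proof. by move=> mf; apply: measurable_funX. Qed.

Lemma summable1_mul f g : square_summable f -> square_summable g ->
  summable1 (fun x => f x * g x).
Proof.
move=> [mf f2] [mg g2].
apply: (@le_summable1 _ _ _ mu _ (fun x => f x ^+ 2 + g x ^+ 2)).
- exact: measurable_funM.
- exact: summable1D.
- move=> x; rewrite ler_norml; apply/andP; split.
    by have := sqr_ge0 (f x + g x); have := sqr_ge0 (f x); have := sqr_ge0 (g x); nra.
  by have := sqr_ge0 (f x - g x); have := sqr_ge0 (f x); have := sqr_ge0 (g x); nra.
Qed.

Lemma square_summableD f g : square_summable f -> square_summable g ->
  square_summable (fun x => f x + g x).
Proof.
move=> hf hg; split; first exact: measurable_funD hf.1 hg.1.
apply: (@le_summable1 _ _ _ mu _ (fun x => 2 * (f x ^+ 2) + 2 * (g x ^+ 2))).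
- by apply/measurable_sqr/measurable_funD; [case: hf|case: hg].
- by apply: summable1D; apply: summable1Z; [case: hf|case: hg].
- move=> x; rewrite ger0_norm ?sqr_ge0//.
  by have := sqr_ge0 (f x - g x); nra.
Qed.

Lemma square_summableZ c f : square_summable f ->
  square_summable (fun x => c * f x).
Proof.
move=> hf; split; first exact: measurable_funM (measurable_cst _) hf.1.
by under eq_fun do rewrite exprMn; apply: summable1Z; case: hf.
Qed.

Lemma square_summableB f g : square_summable f -> square_summable g ->
  square_summable (fun x => f x - g x).
Proof.
move=> hf hg; have := square_summableD hf (square_summableZ (-1) hg).
by under eq_fun do rewrite mulN1r.
Qed.

Lemma bounded_mfun_cst c : bounded_mfun (fun=> c).
Proof. by split => //; exists `|c|. Qed.

Lemma bounded_mfunM f g : bounded_mfun f -> bounded_mfun g ->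
  bounded_mfun (fun x => f x * g x).
Proof.
move=> [mf [M fM]] [mg [N gN]]; split; first exact: measurable_funM.
by exists (M * N) => x; rewrite normrM ler_pM.
Qed.

Lemma bounded_mfunD f g : bounded_mfun f -> bounded_mfun g ->
  bounded_mfun (fun x => f x + g x).
Proof.
move=> [mf [M fM]] [mg [N gN]]; split; first exact: measurable_funD.
by exists (M + N) => x; rewrite (le_trans (ler_normD _ _))// lerD.
Qed.

Lemma bounded_mfunZ c f : bounded_mfun f -> bounded_mfun (fun x => c * f x).
Proof. by move=> hf; apply: bounded_mfunM => //; exact: bounded_mfun_cst. Qed.

Lemma bounded_mfunB f g : bounded_mfun f -> bounded_mfun g ->
  bounded_mfun (fun x => f x - g x).
Proof.
move=> hf hg; have := bounded_mfunD hf (bounded_mfunZ (-1) hg).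
by under eq_fun do rewrite mulN1r.
Qed.

Lemma bounded_mfun_sum (I : Type) (s : seq I) (F : I -> T -> R) :
  (forall i, bounded_mfun (F i)) -> bounded_mfun (fun x => \sum_(i <- s) F i x).
Proof.
move=> hF; elim: s => [|i s IHs].
  by under eq_fun do rewrite big_nil; exact: bounded_mfun_cst.
by under eq_fun do rewrite big_cons; apply: bounded_mfunD.
Qed.

Lemma bounded_mfun_square_summable f : bounded_mfun f -> square_summable f.
Proof.
move=> hf; split; first by case: hf.
by apply: bounded_mfun_summable1; apply: bounded_mfunM.
Qed.

Lemma square_summable_summable1 f : square_summable f -> summable1 f.
Proof.
move=> hf; have := summable1_mul hf (bounded_mfun_square_summable (bounded_mfun_cst 1)).
by under eq_fun do rewrite mulr1.
Qed.

Lemma square_summableMb f g : square_summable f -> bounded_mfun g ->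
  square_summable (fun x => f x * g x).
Proof.
move=> [mf f2] [mg [M gM]]; split; first exact: measurable_funM.
apply: (@le_summable1 _ _ _ mu _ (fun x => M ^+ 2 * f x ^+ 2)).
- exact/measurable_sqr/measurable_funM.
- exact: summable1Z.
- move=> x; rewrite ger0_norm ?sqr_ge0// exprMn mulrC ler_wpM2r ?sqr_ge0//.
  by rewrite -(real_normK (num_real (g x))) lerXn2r// nnegrE (le_trans _ (gM x)).
Qed.

Lemma innerC f g : inner f g = inner g f.
Proof. by congr total; apply/funext => x; rewrite mulrC. Qed.

Lemma inner0l h : inner (fun=> 0) h = 0.
Proof. by rewrite /inner -[RHS](total0 mu); congr total; apply/funext => x; rewrite mul0r. Qed.

Lemma innerDl f g h : square_summable f -> square_summable g ->
  square_summable h ->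
  inner (fun x => f x + g x) h = inner f h + inner g h.
Proof.
move=> hf hg hh; rewrite /inner -totalD; try exact: summable1_mul.
by congr total; apply/funext => x; rewrite mulrDl.
Qed.

Lemma innerZl c f h : square_summable f -> square_summable h ->
  inner (fun x => c * f x) h = c * inner f h.
Proof.
move=> hf hh; rewrite /inner -totalZ; last exact: summable1_mul.
by congr total; apply/funext => x; rewrite mulrA.
Qed.

Lemma innerBl f g h : square_summable f -> square_summable g ->
  square_summable h ->
  inner (fun x => f x - g x) h = inner f h - inner g h.
Proof.
move=> hf hg hh; rewrite /inner -totalB; try exact: summable1_mul.
by congr total; apply/funext => x; rewrite mulrBl.
Qed.

Lemma innerDr f g h : square_summable f -> square_summable g ->
  square_summable h ->
  inner h (fun x => f x + g x) = inner h f + inner h g.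
Proof. by move=> *; rewrite innerC innerDl// ![inner _ h]innerC. Qed.

Lemma innerBr f g h : square_summable f -> square_summable g ->
  square_summable h ->
  inner h (fun x => f x - g x) = inner h f - inner h g.
Proof. by move=> *; rewrite innerC innerBl// ![inner _ h]innerC. Qed.

Lemma innerZr c f h : square_summable f -> square_summable h ->
  inner h (fun x => c * f x) = c * inner h f.
Proof. by move=> *; rewrite innerC innerZl// ![inner _ h]innerC. Qed.

Lemma inner_suml (I : Type) (s : seq I) (F : I -> T -> R) h :
  (forall i, square_summable (F i)) -> square_summable h ->
  inner (fun x => \sum_(i <- s) F i x) h = \sum_(i <- s) inner (F i) h.
Proof.
move=> hF hh; rewrite /inner -total_sum; last by move=> i; exact: summable1_mul.
by congr total; apply/funext => x; rewrite mulr_suml.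
Qed.

Lemma inner_ge0 f : 0 <= inner f f.
Proof. by apply: total_ge0 => x; rewrite -expr2 sqr_ge0. Qed.

(** The discriminant of the nonnegative quadratic [t |-> ||g - t f||^2]. *)
Lemma CauchySchwarz f g : square_summable f -> square_summable g ->
  inner f g ^+ 2 <= inner f f * inner g g.
Proof.
move=> hf hg.
have q t : 0 <= inner g g - t * (2 * inner f g) + t ^+ 2 * inner f f.
  have := inner_ge0 (fun x => g x - t * f x).
  have htf := square_summableZ t hf.
  have hd := square_summableB hg htf.
  rewrite innerBl// innerZl// !innerBr// !innerZr// (innerC g f).
  by congr (_ <= _); ring.
have f0 := inner_ge0 f; have g0 := inner_ge0 g.
have [fE|fN0] := eqVneq (inner f f) 0.
  rewrite fE mul0r; have := q (((inner g g) + 1) / inner f g).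
  rewrite fE mulr0 addr0.
  have [->|n0] := eqVneq (inner f g) 0; first by rewrite expr0n.
  by rewrite mulrCA mulfVK// => ?; exfalso; nra.
have := q (inner f g / inner f f).
have fp : 0 < inner f f by rewrite lt_def fN0.
rewrite -(pmulr_rge0 _ fp).
have -> : inner f f * (inner g g - inner f g / inner f f * (2 * inner f g) +
   (inner f g / inner f f) ^+ 2 * inner f f) =
   inner f f * inner g g - inner f g ^+ 2 by field.
by rewrite subr_ge0.
Qed.

Lemma sqr_normD f g : square_summable f -> square_summable g ->
  inner (fun x => f x + g x) (fun x => f x + g x) =
  inner f f + 2 * inner f g + inner g g.
Proof.
move=> hf hg; rewrite innerDl ?innerDr//; last exact: square_summableD.
by rewrite (innerC g f); ring.
Qed.

Lemma sqr_normD_le f g : square_summable f -> square_summable g ->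
  inner (fun x => f x + g x) (fun x => f x + g x) <=
  2 * inner f f + 2 * inner g g.
Proof.
move=> hf hg; rewrite sqr_normD//.
have := inner_ge0 (fun x => f x - g x).
rewrite innerBl ?innerBr//; last exact: square_summableB.
by rewrite (innerC g f); lra.
Qed.

End SquareIntegrable.


(** * Bilinear forms of kernels satisfying the Schur test *)

Section SchurKernel.
Context d (T : measurableType d) (R : realType).
Variable mu : {finite_measure set T -> \bar R}.
Implicit Types (K : T * T -> R) (f g h : T -> R) (C c : R).
Local Notation mu2 := (mu \x mu)%E.

(** The hypothesis of the Schur test, with one constant for both variables. *)
Definition schur C K : Prop :=
  [/\ measurable_fun setT K,
      forall x, (\int[mu]_y `|K (x, y)|%:E <= C%:E)%E &
      forall y, (\int[mu]_x `|K (x, y)|%:E <= C%:E)%E].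

Let integral_normD (f g : T -> R) : measurable_fun setT f -> measurable_fun setT g ->
  (\int[mu]_u `|f u + g u|%:E <= \int[mu]_u `|f u|%:E + \int[mu]_u `|g u|%:E)%E.
Proof.
move=> mf mg.
have m (h : T -> R) : measurable_fun setT h -> measurable_fun setT (fun u => `|h u|%:E).
  by move=> mh; apply/measurable_EFinP; exact: measurableT_comp.
rewrite -ge0_integralD//; try exact: m.
apply: ge0_le_integral => //.
- exact: m (measurable_funD mf mg).
- by apply: emeasurable_funD; exact: m.
- by move=> u _; rewrite -EFinD lee_fin ler_normD.
Qed.

Lemma schurD C K C' K' : schur C K -> schur C' K' ->
  schur (C + C') (fun z => K z + K' z).
Proof.
move=> [mK K1 K2] [mK' K1' K2']; split; first exact: measurable_funD.
- move=> u; rewrite EFinD; apply: le_trans (leeD (K1 u) (K1' u)).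
  by apply: integral_normD; exact: measurableT_comp.
- move=> v; rewrite EFinD; apply: le_trans (leeD (K2 v) (K2' v)).
  by apply: integral_normD; [exact: measurableT_comp mK _|exact: measurableT_comp mK' _].
Qed.

(** The pairing with [f] of the integral operator applied to [h]. As an integral
   over the product it avoids the null set on which the operator is undefined. *)
Definition form K h f : R := total mu2 (fun z => K z * (h z.2 * f z.1)).

Lemma measurable_fst_comp f : measurable_fun setT f ->
  measurable_fun setT (fun z : T * T => f z.1).
Proof. by move=> mf; apply: measurableT_comp. Qed.

Lemma measurable_snd_comp f : measurable_fun setT f ->
  measurable_fun setT (fun z : T * T => f z.2).
Proof. by move=> mf; apply: measurableT_comp. Qed.

Let schur_bound_fst C K f : schur C K -> square_summable mu f ->
  summable1 mu2 (fun z => `|K z| * f z.1 ^+ 2) /\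
  total mu2 (fun z => `|K z| * f z.1 ^+ 2) <= C * inner mu f f.
Proof.
move=> [mK K1 _] [mf f2].
have mF : measurable_fun setT (fun z : T * T => (`|K z| * f z.1 ^+ 2)%:E).
  apply/measurable_EFinP/measurable_funM; first exact: measurableT_comp.
  by apply: measurable_funX; exact: measurable_fst_comp.
have F0 z : (0 <= (`|K z| * f z.1 ^+ 2)%:E)%E by rewrite lee_fin mulr_ge0// sqr_ge0.
have bnd : (\int[mu2]_z (`|K z| * f z.1 ^+ 2)%:E <= C%:E * (\int[mu]_x (f x ^+ 2)%:E))%E.
  rewrite (fubini_tonelli1 (fun z => (`|K z| * f z.1 ^+ 2)%:E))//=.
  have C0 : 0 <= C.
    rewrite -lee_fin (le_trans _ (K1 point))//.
    by apply: integral_ge0 => y _; rewrite lee_fin.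
  have mf2 : measurable_fun setT (fun x => (f x ^+ 2)%:E).
    exact/measurable_EFinP/measurable_funX.
  rewrite -ge0_integralZl//; last by move=> x _; rewrite lee_fin sqr_ge0.
  apply: ge0_le_integral => //=.
  - by move=> x _; apply: integral_ge0 => y _; exact: F0.
  - exact: measurable_fun_fubini_tonelli_F.
  - by apply: measurable_funeM.
  - move=> x _; rewrite /fubini_F/=.
    under eq_integral do rewrite mulrC EFinM.
    have mKx : measurable_fun setT (fun y => `|K (x, y)|%:E).
      by apply/measurable_EFinP; apply: measurableT_comp => //; exact: measurableT_comp.
    rewrite ge0_integralZl//; last by rewrite lee_fin sqr_ge0.
    by rewrite muleC lee_wpmul2r// lee_fin sqr_ge0.
have fin : (\int[mu]_x (f x ^+ 2)%:E)%E = (inner mu f f)%:E.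
  rewrite /inner /total /Rintegral fineK; last exact: integrable_fin_num.
  by apply: eq_integral => x _; rewrite expr2.
rewrite fin -EFinM in bnd.
have sF : summable1 mu2 (fun z => `|K z| * f z.1 ^+ 2).
  apply/integrableP; split; first exact: mF.
  apply: le_lt_trans (le_lt_trans bnd (ltry _)); rewrite le_eqVlt; apply/orP.
  by left; apply/eqP; apply: eq_integral => z _; exact: gee0_abs (F0 z).
split => //; rewrite /total /Rintegral -lee_fin fineK//.
exact: integrable_fin_num.
Qed.


Lemma inner_sqrE f : square_summable mu f ->
  (\int[mu]_x (f x ^+ 2)%:E)%E = (inner mu f f)%:E.
Proof.
move=> [mf f2].
rewrite /inner /total /Rintegral fineK; last first.
  by under eq_integral do rewrite -expr2; exact: integrable_fin_num.
by apply: eq_integral => x _; rewrite expr2.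
Qed.

Let schur_bound_snd C K f : schur C K -> square_summable mu f ->
  summable1 mu2 (fun z => `|K z| * f z.2 ^+ 2) /\
  total mu2 (fun z => `|K z| * f z.2 ^+ 2) <= C * inner mu f f.
Proof.
move=> [mK _ K1] sf; have [mf f2] := sf.
have mF : measurable_fun setT (fun z : T * T => (`|K z| * f z.2 ^+ 2)%:E).
  apply/measurable_EFinP/measurable_funM; first exact: measurableT_comp.
  by apply: measurable_funX; exact: measurable_snd_comp.
have F0 z : (0 <= (`|K z| * f z.2 ^+ 2)%:E)%E by rewrite lee_fin mulr_ge0// sqr_ge0.
have bnd : (\int[mu2]_z (`|K z| * f z.2 ^+ 2)%:E <= C%:E * (\int[mu]_x (f x ^+ 2)%:E))%E.
  rewrite (fubini_tonelli2 (fun z => (`|K z| * f z.2 ^+ 2)%:E))//=.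
  have C0 : 0 <= C.
    rewrite -lee_fin (le_trans _ (K1 point))//.
    by apply: integral_ge0 => y _; rewrite lee_fin.
  have mf2 : measurable_fun setT (fun x => (f x ^+ 2)%:E).
    exact/measurable_EFinP/measurable_funX.
  rewrite -ge0_integralZl//; last by move=> x _; rewrite lee_fin sqr_ge0.
  apply: ge0_le_integral => //=.
  - by move=> x _; apply: integral_ge0 => y _; exact: F0.
  - exact: measurable_fun_fubini_tonelli_G.
  - by apply: measurable_funeM.
  - move=> x _; rewrite /fubini_G/=.
    under eq_integral do rewrite mulrC EFinM.
    have mKx : measurable_fun setT (fun y => `|K (y, x)|%:E).
      by apply/measurable_EFinP; apply: measurableT_comp => //; exact: measurableT_comp.
    rewrite ge0_integralZl//; last by rewrite lee_fin sqr_ge0.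
    by rewrite muleC lee_wpmul2r// lee_fin sqr_ge0.
rewrite inner_sqrE// -EFinM in bnd.
have sF : summable1 mu2 (fun z => `|K z| * f z.2 ^+ 2).
  apply/integrableP; split; first exact: mF.
  apply: le_lt_trans (le_lt_trans bnd (ltry _)); rewrite le_eqVlt; apply/orP.
  by left; apply/eqP; apply: eq_integral => z _; exact: gee0_abs (F0 z).
split => //; rewrite /total /Rintegral -lee_fin fineK//.
exact: integrable_fin_num.
Qed.

Lemma schur_summable1 C K h f : schur C K ->
  square_summable mu h -> square_summable mu f ->
  summable1 mu2 (fun z => K z * (h z.2 * f z.1)).
Proof.
move=> sK hh hf; have [s1 _] := schur_bound_fst sK hf.
have [s2 _] := schur_bound_snd sK hh.
apply: (le_summable1 _ (summable1D s1 s2)).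
  apply: measurable_funM; first by case: sK.
  by apply: measurable_funM; [apply: measurable_snd_comp; case: hh|
    apply: measurable_fst_comp; case: hf].
move=> z; rewrite normrM -mulrDr ler_wpM2l// ler_norml; apply/andP; split.
  by have := sqr_ge0 (h z.2 + f z.1); have := sqr_ge0 (h z.2);
    have := sqr_ge0 (f z.1); nra.
by have := sqr_ge0 (h z.2 - f z.1); have := sqr_ge0 (h z.2);
  have := sqr_ge0 (f z.1); nra.
Qed.

(** The Schur test, in the additive form given by [2 |h f| <= h^2 + f^2]. *)
Lemma form_bound C K h f : schur C K ->
  square_summable mu h -> square_summable mu f ->
  `|form K h f| <= C / 2 * (inner mu h h + inner mu f f).
Proof.
move=> sK hh hf; have [s1 b1] := schur_bound_fst sK hf.
have [s2 b2] := schur_bound_snd sK hh.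
apply: (le_trans (normr_total (schur_summable1 sK hh hf))).
apply: (@le_trans _ _ (total mu2 (fun z => 2^-1 * (`|K z| * f z.1 ^+ 2 + `|K z| * h z.2 ^+ 2)))).
  apply: le_total.
  - exact: integrable_norm (schur_summable1 sK hh hf).
  - exact/summable1Z/summable1D.
  - move=> z; rewrite normrM -mulrDr mulrCA ler_wpM2l// ler_norml; apply/andP; split.
      by have := sqr_ge0 (h z.2 + f z.1); nra.
    by have := sqr_ge0 (h z.2 - f z.1); nra.
rewrite totalZ; last exact: summable1D.
by rewrite totalD//; lra.
Qed.

Lemma formDl C K h1 h2 f : schur C K -> square_summable mu h1 ->
  square_summable mu h2 -> square_summable mu f ->
  form K (fun x => h1 x + h2 x) f = form K h1 f + form K h2 f.
Proof.
move=> sK *; rewrite /form -totalD; try exact: (schur_summable1 sK).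
by congr total; apply/funext => z; ring.
Qed.

Lemma formDr C K h f1 f2 : schur C K -> square_summable mu h ->
  square_summable mu f1 -> square_summable mu f2 ->
  form K h (fun x => f1 x + f2 x) = form K h f1 + form K h f2.
Proof.
move=> sK *; rewrite /form -totalD; try exact: (schur_summable1 sK).
by congr total; apply/funext => z; ring.
Qed.

Lemma formZl C K c h f : schur C K -> square_summable mu h ->
  square_summable mu f -> form K (fun x => c * h x) f = c * form K h f.
Proof.
move=> sK *; rewrite /form -totalZ; try exact: (schur_summable1 sK).
by congr total; apply/funext => z; ring.
Qed.

Lemma formZr C K c h f : schur C K -> square_summable mu h ->
  square_summable mu f -> form K h (fun x => c * f x) = c * form K h f.
Proof.
move=> sK *; rewrite /form -totalZ; try exact: (schur_summable1 sK).
by congr total; apply/funext => z; ring.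
Qed.

Definition adjoint_at K f (y : T) : R := total mu (fun x => K (x, y) * f x).

Lemma schur_section_fst C K x : schur C K -> summable1 mu (fun y => K (x, y)).
Proof.
move=> [mK K1 _]; apply/integrableP; split.
  by apply/measurable_EFinP; exact: measurableT_comp.
by rewrite (le_lt_trans (K1 x))// ltry.
Qed.

Lemma schur_section_snd C K y : schur C K -> summable1 mu (fun x => K (x, y)).
Proof.
move=> [mK _ K2]; apply/integrableP; split.
  by apply/measurable_EFinP; exact: measurableT_comp.
by rewrite (le_lt_trans (K2 y))// ltry.
Qed.

(** On bounded functions the adjoint is defined and bounded at every point, whereas
   on square-summable ones an operator is defined almost everywhere only. *)
Lemma adjoint_bounded C K f : schur C K -> bounded_mfun f ->
  bounded_mfun (adjoint_at K f).
Proof.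
move=> sK bf; have [mf [M fM]] := bf; have [mK K1 K2] := sK.
have M0 : 0 <= M by rewrite (le_trans _ (fM point)).
have bf2 := bounded_mfun_square_summable mu bf.
have s1 := bounded_mfun_square_summable mu (@bounded_mfun_cst _ T R 1).
split.
  have := schur_summable1 sK s1 bf2 => /measurable_fubini_G mG.
  rewrite [X in measurable_fun _ X](_ : _ =
    fine \o fubini_G mu (EFin \o (fun z : T * T => K z * (1 * f z.1)))).
    exact: measurableT_comp.
  apply/funext => y; rewrite /adjoint_at /total /Rintegral /fubini_G/=.
  by congr fine; apply: eq_integral => x _; rewrite mul1r.
exists (M * C) => y.
have sKf : summable1 mu (fun x => M * `|K (x, y)|).
  exact/summable1Z/integrable_norm/(schur_section_snd y sK).
have sKm : summable1 mu (fun x => K (x, y) * f x).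
  apply: (le_summable1 _ sKf).
    by apply: measurable_funM => //; exact: measurableT_comp.
  by move=> x; rewrite normrM mulrC ler_wpM2r.
apply: (le_trans (normr_total sKm)).
apply: (@le_trans _ _ (total mu (fun x => M * `|K (x, y)|))).
  apply: le_total => //; first exact: integrable_norm.
  by move=> x; rewrite normrM mulrC ler_wpM2r.
rewrite totalZ; last exact/integrable_norm/(schur_section_snd y sK).
rewrite ler_wpM2l// -lee_fin /total /Rintegral fineK ?K2//.
exact/integrable_fin_num/integrable_norm/(schur_section_snd y sK).
Qed.

Lemma form_adjoint C K h f : schur C K -> square_summable mu h ->
  bounded_mfun f -> form K h f = inner mu h (adjoint_at K f).
Proof.
move=> sK hh bf; have hf := bounded_mfun_square_summable mu bf.
have := schur_summable1 sK hh hf => sKhf.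
rewrite /form /total /Rintegral -(integral21_prod_meas1 sKhf).
congr fine; apply: eq_integral => y _.
have [mf [M fM]] := bf; have [mK _ _] := sK.
have sKm : summable1 mu (fun x => K (x, y) * f x).
  apply: (le_summable1 _ (summable1Z M (integrable_norm (schur_section_snd y sK)))).
    by apply: measurable_funM => //; exact: measurableT_comp.
  by move=> x /=; rewrite normrM mulrC ler_wpM2r.
rewrite /adjoint_at -totalZ// /total /Rintegral fineK.
  by rewrite /fubini_G/=; apply: eq_integral => x _; rewrite mulrCA.
exact/integrable_fin_num/(summable1Z _ sKm).
Qed.

Definition apply_at K h (x : T) : R := total mu (fun y => K (x, y) * h y).

Lemma schur_ae_summable1 C K h : schur C K -> square_summable mu h ->
  {ae mu, forall x, summable1 mu (fun y => K (x, y) * h y)}.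
Proof.
move=> sK hh.
have s1 := bounded_mfun_square_summable mu (@bounded_mfun_cst _ T R 1).
have := ae_integrable1 (schur_summable1 sK hh s1).
apply: filterS => x.
by apply: eq_integrable => // y _ /=; rewrite mulr1.
Qed.

Lemma measurable_apply_at C K h : schur C K -> square_summable mu h ->
  measurable_fun setT (apply_at K h).
Proof.
move=> sK hh.
have s1 := bounded_mfun_square_summable mu (@bounded_mfun_cst _ T R 1).
have := measurable_fubini_F (schur_summable1 sK hh s1) => mF.
rewrite [X in measurable_fun _ X](_ : _ =
  fine \o fubini_F mu (EFin \o (fun z : T * T => K z * (h z.2 * 1)))).
  exact: measurableT_comp.
apply/funext => y; rewrite /apply_at /total /Rintegral /fubini_F/=.
by congr fine; apply: eq_integral => x _; rewrite mulr1.
Qed.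

Lemma form_apply C K h f : schur C K -> square_summable mu h ->
  square_summable mu f -> form K h f = inner mu (apply_at K h) f.
Proof.
move=> sK hh hf; have := schur_summable1 sK hh hf => sKhf.
rewrite /form /total /Rintegral -(integral12_prod_meas1 sKhf).
congr fine; apply: ae_eq_integral => //.
- exact: measurable_fubini_F sKhf.
- apply/measurable_EFinP/measurable_funM; last by case: hf.
  exact: measurable_apply_at sK hh.
- have := schur_ae_summable1 sK hh; apply: filterS => x sx _.
  rewrite /apply_at mulrC -totalZ// /total /Rintegral fineK.
    by rewrite /fubini_F/=; apply: eq_integral => y _; rewrite mulrA mulrC.
  exact/integrable_fin_num/(summable1Z _ sx).
Qed.

(** The inner integral of a function that is integrable over the product is
   integrable. *)
Lemma apply_at_summable1 C K h f : schur C K -> square_summable mu h ->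
  square_summable mu f -> summable1 mu (fun x => apply_at K h x * f x).
Proof.
move=> sK hh hf; have := schur_summable1 sK hh hf => sKhf.
have iF := integrable_fubini_F sKhf.
have mA : measurable_fun setT (fun x => apply_at K h x * f x).
  by apply: measurable_funM; [exact: measurable_apply_at sK hh|case: hf].
apply/integrableP; split; first exact/measurable_EFinP.
have /integrableP[mF] := iF; apply: le_lt_trans; rewrite le_eqVlt; apply/orP; left; apply/eqP.
apply: ae_eq_integral => //.
- by apply: measurableT_comp => //; exact/measurable_EFinP.
- exact: measurableT_comp.
- have := schur_ae_summable1 sK hh; apply: filterS => x sx _.
  congr (`| _ |)%E; rewrite /= /apply_at mulrC -totalZ// /total /Rintegral fineK.
    by rewrite /fubini_F/=; apply: eq_integral => y _; congr EFin => /=; ring.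
  exact/integrable_fin_num/(summable1Z _ sx).
Qed.

End SchurKernel.

(** * Orthonormal systems and the stability of Galerkin projections *)

Section Orthonormal.
Context d (T : measurableType d) (R : realType).
Variable mu : {finite_measure set T -> \bar R}.
Variable e : nat -> T -> R.
Hypothesis e_bounded : forall j, bounded_mfun (e j).
Hypothesis e_orthonormal : forall i j, inner mu (e i) (e j) = (i == j)%:R.
Implicit Types (h f : T -> R) (a b : nat -> R) (N : nat).
Local Notation inner := (inner mu).
Local Notation square_summable := (square_summable mu).

Definition comb a N (x : T) : R := \sum_(j < N) a j * e j x.
Definition proj N h : T -> R := comb (fun j => inner h (e j)) N.

Lemma e_square_summable j : square_summable (e j).
Proof. exact: bounded_mfun_square_summable. Qed.

Lemma bounded_comb a N : bounded_mfun (comb a N).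
Proof. by apply: bounded_mfun_sum => j; exact: bounded_mfunZ. Qed.

Lemma comb_square_summable a N : square_summable (comb a N).
Proof. exact/bounded_mfun_square_summable/bounded_comb. Qed.

Lemma inner_comb a N h : square_summable h ->
  inner (comb a N) h = \sum_(j < N) a j * inner (e j) h.
Proof.
move=> hh; have ej := e_square_summable.
rewrite /comb inner_suml//; last by move=> i; exact: square_summableZ.
by apply: eq_bigr => j _; rewrite innerZl.
Qed.

Lemma inner_comb_e a N j : (j < N)%N -> inner (comb a N) (e j) = a j.
Proof.
move=> jN; rewrite inner_comb; last exact: e_square_summable.
rewrite (bigD1 (Ordinal jN))//= e_orthonormal eqxx mulr1 big1 ?addr0// => i.
by rewrite -val_eqE/= e_orthonormal => /negbTE ->; rewrite mulr0.
Qed.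

Lemma sqr_norm_comb a N : inner (comb a N) (comb a N) = \sum_(j < N) a j ^+ 2.
Proof.
rewrite inner_comb; last exact: comb_square_summable.
by apply: eq_bigr => j _; rewrite innerC inner_comb_e// expr2.
Qed.

Lemma residual_square_summable N h : square_summable h ->
  square_summable (fun x => h x - proj N h x).
Proof. by move=> hh; apply: square_summableB => //; exact: comb_square_summable. Qed.

Lemma inner_residual_e N h j : square_summable h -> (j < N)%N ->
  inner (fun x => h x - proj N h x) (e j) = 0.
Proof.
move=> hh jN; rewrite innerBl ?inner_comb_e ?subrr//.
- exact: comb_square_summable.
- exact: e_square_summable.
Qed.

Lemma inner_residual_comb N h a : square_summable h ->
  inner (fun x => h x - proj N h x) (comb a N) = 0.
Proof.
move=> hh; rewrite innerC inner_comb; last exact: residual_square_summable.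
by rewrite big1// => j _; rewrite innerC inner_residual_e// mulr0.
Qed.

Lemma sqr_norm_residual N h : square_summable h ->
  inner (fun x => h x - proj N h x) (fun x => h x - proj N h x) =
  inner h h - \sum_(j < N) inner h (e j) ^+ 2.
Proof.
move=> hh; have sp : square_summable (proj N h) by exact: comb_square_summable.
rewrite innerBr//; last exact: residual_square_summable.
rewrite inner_residual_comb// subr0 innerBl//.
rewrite [in X in _ - X]/proj inner_comb//; congr (_ - _).
by apply: eq_bigr => j _; rewrite (innerC _ (e j) h) expr2.
Qed.

Lemma bessel N h : square_summable h ->
  \sum_(j < N) inner h (e j) ^+ 2 <= inner h h.
Proof.
by move=> hh; rewrite -subr_ge0 -sqr_norm_residual//; exact: inner_ge0.
Qed.

(** The orthogonal projection is the best approximation. *)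
Lemma residual_le_comb N h a : square_summable h ->
  inner (fun x => h x - proj N h x) (fun x => h x - proj N h x) <=
  inner (fun x => h x - comb a N x) (fun x => h x - comb a N x).
Proof.
move=> hh; pose b j := inner h (e j) - a j.
have -> : (fun x => h x - comb a N x) =
    (fun x => (h x - proj N h x) + comb b N x).
  apply/funext => x; rewrite -addrA; congr (_ + _).
  rewrite /proj /comb -!sumrN -big_split/=; apply: eq_bigr => j _.
  by rewrite /b; ring.
rewrite (@sqr_normD _ _ _ mu (fun x => h x - proj N h x) (comb b N)) ?inner_residual_comb//.
- by rewrite mulr0 addr0 lerDl; exact: inner_ge0.
- exact: residual_square_summable.
- exact: comb_square_summable.
Qed.

Lemma residual_nonincreasing N M h : square_summable h -> (N <= M)%N ->
  inner (fun x => h x - proj M h x) (fun x => h x - proj M h x) <=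
  inner (fun x => h x - proj N h x) (fun x => h x - proj N h x).
Proof.
move=> hh NM; rewrite !sqr_norm_residual// lerB//.
rewrite (big_ord_widen M (fun j => inner h (e j) ^+ 2) NM).
rewrite [leRHS](bigID (fun j : 'I_M => (j < N)%N))/= lerDl sumr_ge0// => j _.
exact: sqr_ge0.
Qed.

End Orthonormal.

(** * A discrete stability argument *)

Section Stability.
Context d (T : measurableType d) (R : realType).
Variable mu : {finite_measure set T -> \bar R}.
Local Notation inner := (inner mu).
Local Notation square_summable := (square_summable mu).
Variable e : nat -> T -> R.
Hypothesis e_bounded : forall j, bounded_mfun (e j).
Hypothesis e_orthonormal : forall i j, inner (e i) (e j) = (i == j)%:R.
Hypothesis e_complete : forall h, square_summable h -> forall eps, 0 < eps ->
  exists N, inner (fun x => h x - proj mu e N h x)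
                  (fun x => h x - proj mu e N h x) < eps.
Variables (V : T * T -> R) (C : R).
Hypothesis V_schur : schur mu C V.
Variable v : T -> R.
Hypothesis v_bounded : bounded_mfun v.
Hypothesis v_gt0 : 0 < total mu v.
Local Notation L := (total mu v).

(** The pairing with [f] of [V (h - m v) + m], where [m = total h / L] is chosen
   such that [h - m v] has mean zero. *)
Definition modified_form h f : R :=
  form mu V h f - total mu h / L * form mu V v f
  + total mu h / L * total mu f.

Variables (A : nat -> R) (cA : R).
Hypothesis A_gt0 : forall j, 0 < A j.
Hypothesis A_le : forall j, A j <= cA.
Hypothesis total_e : forall j, (0 < j)%N -> total mu (e j) = 0.
Variable M : R.
(* Up to an operator of Hilbert-Schmidt type, [V] is diagonal. *)
Hypothesis V_diagonal : forall J, \sum_(j < J)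
  inner (fun x => (A j)^-1 * adjoint_at mu V (e j) x - e j x)
        (fun x => (A j)^-1 * adjoint_at mu V (e j) x - e j x) <= M.
(* Definiteness of [V] on the densities of mean zero, in the form that survives
   the passage to the limit along a sequence. *)
Hypothesis V_weak : forall f : nat -> T -> R,
  (forall m, bounded_mfun (f m)) -> (forall m, total mu (f m) = 0) ->
  (exists B, forall m, inner (f m) (f m) <= B) ->
  form mu V (f m) (f m) @[m --> \oo] --> 0 ->
  forall phi, square_summable phi -> inner (f m) phi @[m --> \oo] --> 0.

Let one_bounded : bounded_mfun (fun _ : T => 1 : R).
Proof. exact: bounded_mfun_cst. Qed.

Let bss h : bounded_mfun h -> square_summable h.
Proof. exact: bounded_mfun_square_summable. Qed.

Let mass : R := inner (fun=> 1) (fun=> 1).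

Let totalE h : total mu h = inner h (fun=> 1).
Proof. by congr total; apply/funext => x; rewrite mulr1. Qed.

Let total_bound h : square_summable h -> total mu h ^+ 2 <= inner h h * mass.
Proof. by move=> hh; rewrite totalE; apply: CauchySchwarz => //; exact: bss. Qed.

Let mass_gt0 : 0 < mass.
Proof.
have := total_bound (bss v_bounded).
have : 0 < L ^+ 2 by rewrite exprn_gt0.
have := inner_ge0 mu v; have := inner_ge0 mu (fun=> 1); rewrite -/mass.
by rewrite le_eqVlt => /predU1P[<-|//]; rewrite mulr0; lra.
Qed.

Lemma modified_formDl h1 h2 f : square_summable h1 -> square_summable h2 ->
  square_summable f ->
  modified_form (fun x => h1 x + h2 x) f =
  modified_form h1 f + modified_form h2 f.
Proof.
move=> s1 s2 sf; rewrite /modified_form (formDl V_schur)// totalD.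
- by ring.
- exact: square_summable_summable1.
- exact: square_summable_summable1.
Qed.

Lemma modified_formZl c h f : square_summable h -> square_summable f ->
  modified_form (fun x => c * h x) f = c * modified_form h f.
Proof.
move=> sh sf; rewrite /modified_form (formZl _ V_schur)// totalZ.
  by ring.
exact: square_summable_summable1.
Qed.

Lemma modified_formDr h f1 f2 : square_summable h -> square_summable f1 ->
  square_summable f2 ->
  modified_form h (fun x => f1 x + f2 x) =
  modified_form h f1 + modified_form h f2.
Proof.
move=> sh s1 s2; rewrite /modified_form !(formDr V_schur)//; last exact: bss.
by rewrite totalD; [ring|exact: square_summable_summable1..].
Qed.

Lemma modified_formZr c h f : square_summable h -> square_summable f ->
  modified_form h (fun x => c * f x) = c * modified_form h f.
Proof.
move=> sh sf; rewrite /modified_form !(formZr _ V_schur)//; last exact: bss.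
by rewrite totalZ; [ring|exact: square_summable_summable1].
Qed.

Lemma discriminant_le0 (a b c : R) : 0 <= c ->
  (forall t, 0 <= a + t * b + t ^+ 2 * c) -> b ^+ 2 <= 4 * a * c.
Proof.
move=> c0 q; have [cE|cN0] := eqVneq c 0.
  have [->|b0] := eqVneq b 0; first by rewrite cE expr0n mulr0.
  have := q (- (a + 1) / b); rewrite cE mulr0 addr0 divfK//.
  by move=> ?; exfalso; lra.
have cp : 0 < c by rewrite lt_def cN0.
have := q (- b / (2 * c)); rewrite -(pmulr_rge0 _ (_ : 0 < 4 * c)); last lra.
have -> : 4 * c * (a + - b / (2 * c) * b + (- b / (2 * c)) ^+ 2 * c) =
  4 * a * c - b ^+ 2 by field.
by rewrite subr_ge0.
Qed.

Lemma form_sqr_bound h f : square_summable h -> square_summable f ->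
  form mu V h f ^+ 2 <= C ^+ 2 * (inner h h * inner f f).
Proof.
move=> sh sf.
have C0 : 0 <= C.
  case: V_schur => _ K1 _; rewrite -lee_fin (le_trans _ (K1 point))//.
  by apply: integral_ge0 => y _; rewrite lee_fin.
have : form mu V h f ^+ 2 <= 4 * (C / 2 * inner h h) * (C / 2 * inner f f).
  apply: discriminant_le0; first by rewrite mulr_ge0 ?divr_ge0 ?inner_ge0.
  move=> t; have := form_bound V_schur sh (square_summableZ t sf).
  rewrite (formZr _ V_schur)// innerZl ?innerZr//; last exact: square_summableZ.
  rewrite ler_norml => /andP[+ _].
  by rewrite !mulrDr; lra.
by move=> /le_trans; apply; rewrite le_eqVlt; apply/orP; left; apply/eqP; field.
Qed.

Lemma modified_form_bound : exists2 K, 0 <= K & forall h f,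
  square_summable h -> square_summable f ->
  modified_form h f ^+ 2 <= K * (inner h h * inner f f).
Proof.
exists (3 * (C ^+ 2 + mass / L ^+ 2 * (C ^+ 2 * inner v v) +
   mass / L ^+ 2 * mass)) => [|h f sh sf].
  have := inner_ge0 mu v; have := ltW mass_gt0 => m0 v0.
  have l0 : 0 <= mass / L ^+ 2 by rewrite divr_ge0 ?sqr_ge0.
  have c0 := sqr_ge0 C; apply: mulr_ge0 => //; apply: addr_ge0; last exact: mulr_ge0.
  by apply: addr_ge0 => //; apply: mulr_ge0 => //; exact: mulr_ge0.
set X := form mu V h f; set Y := total mu h / L * form mu V v f.
set Z := total mu h / L * total mu f.
have -> : modified_form h f = X - Y + Z by [].
have h0 := inner_ge0 mu h; have f0 := inner_ge0 mu f.
have hX : X ^+ 2 <= C ^+ 2 * (inner h h * inner f f) by exact: form_sqr_bound.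
have th := total_bound sh.
have hY : Y ^+ 2 <= (inner h h * mass / L ^+ 2) * (C ^+ 2 * (inner v v * inner f f)).
  rewrite exprMn ler_pM ?sqr_ge0//.
    by rewrite exprMn exprVn ler_wpM2r// invr_ge0 sqr_ge0.
  by apply: form_sqr_bound => //; exact: bss.
have hZ : Z ^+ 2 <= (inner h h * mass / L ^+ 2) * (inner f f * mass).
  rewrite exprMn ler_pM ?sqr_ge0//.
    by rewrite exprMn exprVn ler_wpM2r// invr_ge0 sqr_ge0.
  exact: total_bound.
have : (X - Y + Z) ^+ 2 <= 3 * (X ^+ 2 + Y ^+ 2 + Z ^+ 2).
  have := sqr_ge0 (X + Y); have := sqr_ge0 (X - Z); have := sqr_ge0 (Y + Z).
  by nra.
move=> /le_trans; apply; rewrite -[leRHS]mulrA ler_wpM2l//.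
by rewrite !mulrDl !lerD//; [move: hY|move: hZ] => /le_trans; apply;
  rewrite le_eqVlt; apply/orP; left; apply/eqP; ring.
Qed.

(** The compact part of the operator: testing against [e j] multiplies the
   [j]-th coefficient by [A j], up to the functional [inner (tau j)]. *)
Definition tau j (x : T) : R :=
  ((A j)^-1 * adjoint_at mu V (e j) x - e j x)
  + (total mu (e j) - inner (adjoint_at mu V (e j)) v) / (L * A j).

Let adj_bounded j : bounded_mfun (adjoint_at mu V (e j)).
Proof. exact: adjoint_bounded V_schur _. Qed.

Let kappa j (x : T) := (A j)^-1 * adjoint_at mu V (e j) x - e j x.

Let kappa_bounded j : bounded_mfun (kappa j).
Proof. by apply: bounded_mfunB => //; exact: bounded_mfunZ. Qed.

Lemma tau_bounded j : bounded_mfun (tau j).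
Proof.
by apply: bounded_mfunD; [exact: kappa_bounded|exact: bounded_mfun_cst].
Qed.

Let inner_cst h c : square_summable h -> inner h (fun=> c) = total mu h * c.
Proof.
by move=> hh; rewrite mulrC -totalZ; [congr total; apply/funext => x; rewrite mulrC|
  exact: square_summable_summable1].
Qed.

Lemma modified_form_e h j : square_summable h ->
  modified_form h (e j) = A j * (inner h (e j) + inner (tau j) h).
Proof.
move=> sh; have A0 := lt0r_neq0 (A_gt0 j); have L0 := lt0r_neq0 v_gt0.
rewrite /modified_form !(form_adjoint V_schur)//; last exact: bss.
rewrite (innerC _ (tau j)) innerDr//; last 2 first.
- exact/bss/kappa_bounded.
- exact/bss/bounded_mfun_cst.
rewrite innerBr//; last 2 first.
- exact/bss/bounded_mfunZ.
- exact: bss.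
rewrite (innerZr _ (bss (adj_bounded j)) sh) inner_cst// (innerC _ (adjoint_at mu V (e j)) v).
by field; rewrite A0 L0.
Qed.

Lemma tau_summable : exists M', forall J,
  \sum_(j < J) inner (tau j) (tau j) <= M'.
Proof.
have L0 := lt0r_neq0 v_gt0.
pose c j := (total mu (e j) - inner (adjoint_at mu V (e j)) v) / (L * A j).
have cE j : c j = total mu (e j) / (L * A j)
    - L^-1 * inner (kappa j) v - L^-1 * inner (e j) v.
  rewrite /c /kappa innerBl; try exact: bss.
    rewrite innerZl; try exact: bss.
    by have := lt0r_neq0 (A_gt0 j) => ?; field; rewrite L0.
  exact/bss/bounded_mfunZ.
pose t0 := total mu (e 0%N) / (L * A 0%N).
have tE J : \sum_(j < J) (total mu (e j) / (L * A j)) ^+ 2 <= t0 ^+ 2.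
  case: J => [|J]; first by rewrite big_ord0 sqr_ge0.
  rewrite big_ord_recl big1 ?addr0// => i _.
  by rewrite total_e// mul0r expr0n.
pose l := L ^- 2.
have l0 : 0 <= l by rewrite invr_ge0 sqr_ge0.
exists (2 * M + 2 * mass * (3 * t0 ^+ 2 + 3 * l * (M * inner v v) + 3 * l * inner v v)).
move=> J.
have tauj j : inner (tau j) (tau j) <= 2 * inner (kappa j) (kappa j) +
   2 * mass * (3 * (total mu (e j) / (L * A j)) ^+ 2 +
    3 * l * (inner (kappa j) (kappa j) * inner v v) + 3 * l * inner v (e j) ^+ 2).
  have := sqr_normD_le (bss (kappa_bounded j)) (bss (bounded_mfun_cst T (c j))).
  move=> /le_trans; apply.
  rewrite lerD2l -[X in _ <= X]mulrA ler_wpM2l//.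
  have -> : inner (fun=> c j) (fun=> c j) = mass * (c j * c j).
    rewrite inner_cst; last exact/bss/bounded_mfun_cst.
    rewrite totalE (_ : (fun=> c j) = (fun x : T => c j * 1)).
      by rewrite innerZl; [rewrite -/mass; ring|exact: bss..].
    by apply/funext => x; rewrite mulr1.
  rewrite ler_wpM2l ?(ltW mass_gt0)//.
  have kv := CauchySchwarz (bss (kappa_bounded j)) (bss v_bounded).
  rewrite cE (innerC _ (e j)) -!mulrA -!mulrDr.
  move: (total _ _ / _) (inner (kappa j) v) (inner v (e j)) kv => X Y Z kv.
  apply: (@le_trans _ _ (3 * (X ^+ 2 + (L^-1 * Y) ^+ 2 + (L^-1 * Z) ^+ 2))).
    rewrite -expr2.
    have := sqr_ge0 (X + L^-1 * Y); have := sqr_ge0 (X + L^-1 * Z).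
    have := sqr_ge0 (L^-1 * Y - L^-1 * Z); nra.
  rewrite ler_wpM2l// !exprMn exprVn -/l lerD2r lerD2l ler_wpM2l//.
have /le_trans := ler_sum (index_enum _) (fun (j : 'I_J) (_ : xpredT j) => tauj j).
apply.
rewrite big_split/= -!mulr_sumr lerD//.
  by rewrite ler_wpM2l//; exact: V_diagonal.
rewrite ler_wpM2l ?mulr_ge0 ?(ltW mass_gt0)// !big_split/= -!mulr_sumr.
rewrite !lerD//.
- by rewrite ler_wpM2l ?tE.
- rewrite ler_wpM2l ?mulr_ge0// -mulr_suml ler_wpM2r ?inner_ge0//.
  exact: V_diagonal.
- rewrite ler_wpM2l ?mulr_ge0//; apply: bessel => //; exact: bss.
Qed.

(** The left-hand side of the [j]-th discrete equation divided by [A j]. *)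
Definition rho a N j : R := a j + inner (tau j) (comb e a N).

Lemma modified_form_comb_e a N j : (j < N)%N ->
  modified_form (comb e a N) (e j) = A j * rho a N j.
Proof.
by move=> jN; rewrite modified_form_e ?inner_comb_e//; exact/bss/bounded_comb.
Qed.

Lemma modified_form_combr h b N : square_summable h ->
  modified_form h (comb e b N) = \sum_(j < N) b j * modified_form h (e j).
Proof.
move=> sh; elim: N => [|n IHn].
  rewrite big_ord0 (_ : comb e b 0 = fun x => 0 * comb e b 0 x).
    by rewrite modified_formZr ?mul0r//; exact/bss/bounded_comb.
  by apply/funext => x; rewrite mul0r /comb big_ord0.
rewrite big_ord_recr/= -IHn -modified_formZr//; last exact: bss.
rewrite -modified_formDr//; last 2 first.
- exact/bss/bounded_comb.
- exact/bss/bounded_mfunZ.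
by congr modified_form; apply/funext => x; rewrite /comb big_ord_recr.
Qed.

Lemma modified_form_comb a b N :
  modified_form (comb e a N) (comb e b N) = \sum_(j < N) b j * (A j * rho a N j).
Proof.
rewrite modified_form_combr; last exact/bss/bounded_comb.
by apply: eq_bigr => j _; rewrite modified_form_comb_e.
Qed.

Lemma sum_CauchySchwarz N (a b : nat -> R) :
  (\sum_(j < N) a j * b j) ^+ 2 <=
  (\sum_(j < N) a j ^+ 2) * (\sum_(j < N) b j ^+ 2).
Proof.
rewrite -!(sqr_norm_comb e_bounded e_orthonormal).
have -> : \sum_(j < N) a j * b j = inner (comb e a N) (comb e b N).
  rewrite inner_comb//; last exact/bss/bounded_comb.
  by apply: eq_bigr => j _; rewrite innerC inner_comb_e.
by apply: CauchySchwarz; exact/bss/bounded_comb.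
Qed.

Lemma modified_form_comb_bound a b N :
  modified_form (comb e a N) (comb e b N) ^+ 2 <=
  cA ^+ 2 * (\sum_(j < N) b j ^+ 2) * (\sum_(j < N) rho a N j ^+ 2).
Proof.
rewrite modified_form_comb; under eq_bigr do rewrite mulrA.
have /le_trans := sum_CauchySchwarz N (fun j => b j * A j) (rho a N).
apply.
rewrite ler_wpM2r ?sumr_ge0// => [j _|]; first exact: sqr_ge0.
rewrite mulr_sumr; apply: ler_sum => j _.
rewrite exprMn mulrC ler_wpM2r ?sqr_ge0// lerXn2r// nnegrE ltW//.
exact: lt_le_trans (A_le j).
Qed.

Lemma tail_small (u : nat -> R) (B : R) : (forall j, 0 <= u j) ->
  (forall J, \sum_(j < J) u j <= B) -> forall eps, 0 < eps ->
  exists J, forall N, \sum_(j < N | (J <= j)%N) u j <= eps.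
Proof.
move=> u0 uB eps eps0.
pose E := [set \sum_(j < J) u j | J in [set: nat]].
have hE : has_sup E.
  split; first by exists (\sum_(j < 0) u j), 0%N.
  by exists B => _ [J _ <-].
have [_ [J _ <-] hJ] := sup_adherent eps0 hE.
exists J => N.
have [NJ|JN] := leqP N J.
  rewrite big_pred0 ?ltW// => j; apply/negbTE; rewrite -ltnNge.
  exact: leq_trans (ltn_ord j) NJ.
have : \sum_(j < N) u j <= sup E by apply: sup_ubound; [case: hE|exists N].
rewrite (bigID (fun j : 'I_N => (j < J)%N))/= -(big_ord_widen N u (ltnW JN)).
under [X in _ + X]eq_bigl do rewrite -leqNgt.
by lra.
Qed.

(** For large [N] the truncated systems are uniformly well conditioned. A
   violating sequence of unit vectors tends weakly to [0] because its energy
   tends to [0], and the compact part then tends to [0] in norm. *)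
Lemma stability_large : exists (N0 : nat) (c : R), 0 < c /\
  forall (N : nat) (a : nat -> R), (N0 <= N)%N ->
  \sum_(j < N) a j ^+ 2 <= c * \sum_(j < N) rho a N j ^+ 2.
Proof.
apply: contrapT => H.
have key (m : nat) : exists Na : nat * (nat -> R), [/\ (m <= Na.1)%N,
    \sum_(j < Na.1) Na.2 j ^+ 2 = 1 &
    \sum_(j < Na.1) rho Na.2 Na.1 j ^+ 2 <= m.+1%:R^-1].
  apply: contrapT => H'; apply: H; exists m, m.+1%:R; split; first by rewrite ltr0n.
  move=> N a mN; rewrite leNgt; apply/negP => ha; apply: H'.
  set s := \sum_(j < N) a j ^+ 2 in ha.
  have r0 : 0 <= \sum_(j < N) rho a N j ^+ 2 by apply: sumr_ge0 => j _; exact: sqr_ge0.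
  have s0 : 0 < s by apply: le_lt_trans ha; rewrite mulr_ge0.
  have ss : Num.sqrt s ^+ 2 = s by rewrite sqr_sqrtr// ltW.
  have sN0 : Num.sqrt s != 0 by rewrite sqrtr_eq0 -ltNge.
  exists (N, fun j => (Num.sqrt s)^-1 * a j); split => //=.
    under eq_bigr do rewrite exprMn.
    by rewrite -mulr_sumr -/s exprVn ss mulVf// gt_eqF.
  have rE j : rho (fun j => (Num.sqrt s)^-1 * a j) N j = (Num.sqrt s)^-1 * rho a N j.
    rewrite /rho mulrDr; congr (_ + _).
    rewrite -innerZr; [|exact/bss/bounded_comb|exact/bss/tau_bounded].
    congr inner; apply/funext => x; rewrite /comb mulr_sumr.
    by apply: eq_bigr => i _; rewrite mulrA.
  under eq_bigr do rewrite rE exprMn.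
  rewrite -mulr_sumr exprVn ss mulrC ler_pdivrMr// mulrC ler_pdivlMr ?ltr0n//.
  by rewrite mulrC ltW.
have {}[Na hNa] := choice key.
pose N m := (Na m).1; pose a m := (Na m).2; pose E m := comb e (a m) (N m).
have mN m : (m <= N m)%N by have [] := hNa m.
have Eb m : bounded_mfun (E m) by exact: bounded_comb.
have E1 m : inner (E m) (E m) = 1.
  by rewrite sqr_norm_comb//; have [] := hNa m.
have rm m : \sum_(j < N m) rho (a m) (N m) j ^+ 2 <= m.+1%:R^-1 by have [] := hNa m.
have sqr_cvg0 (w : nat -> R) (c : R) : (forall m, w m ^+ 2 <= c * m.+1%:R^-1) ->
    w m @[m --> \oo] --> 0.
  move=> hw; apply/cvgr0Pnorm_lt => eps eps0.
  have hc : c * m.+1%:R^-1 @[m --> \oo] --> (0 : R).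
    rewrite -[X in _ --> X](mulr0 c); apply: cvgMr; exact: cvg_harmonic.
  have /cvgr0Pnorm_lt/(_ _ (exprn_gt0 2 eps0)) := hc.
  apply: filterS => m /ltr_normlW hm.
  rewrite -(ltr_pXn2r (_ : 0 < 2)%N) ?nnegrE ?(ltW eps0)//.
  by rewrite real_normK ?num_real//; exact: le_lt_trans (hw m) hm.
have [K K0 hK] := modified_form_bound.
have EE0 : modified_form (E m) (E m) @[m --> \oo] --> 0.
  apply: (sqr_cvg0 _ (cA ^+ 2)) => m.
  apply: (le_trans (modified_form_comb_bound _ _ _)).
  have [_ -> _] := hNa m; rewrite mulr1 ler_wpM2l ?sqr_ge0//; exact: rm.
(* A fixed test function is replaced by its projection, to which the discrete
   equations apply. *)
have Ephi0 phi : square_summable phi -> modified_form (E m) phi @[m --> \oo] --> 0.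
  move=> sp.
  have ssp m : square_summable (fun x => phi x - proj mu e (N m) phi x).
    exact: residual_square_summable.
  have -> : (fun m => modified_form (E m) phi) = (fun m =>
      modified_form (E m) (proj mu e (N m) phi) +
      modified_form (E m) (fun x => phi x - proj mu e (N m) phi x)).
    apply/funext => m; rewrite -modified_formDr//; last 2 first.
    - exact/bss/Eb.
    - exact/bss/bounded_comb.
    by congr modified_form; apply/funext => x; rewrite addrC subrK.
  rewrite -[X in _ --> X](addr0 0); apply: cvgD.
    apply: (sqr_cvg0 _ (cA ^+ 2 * inner phi phi)) => m.
    apply: (le_trans (modified_form_comb_bound _ _ _)).
    apply: ler_pM => //.
    + by rewrite mulr_ge0 ?sqr_ge0// sumr_ge0// => j _; exact: sqr_ge0.
    + by rewrite sumr_ge0// => j _; exact: sqr_ge0.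
    + by rewrite ler_wpM2l ?sqr_ge0//; exact: bessel.
  apply/cvgr0Pnorm_lt => eps eps0.
  have K1 : 0 < K + 1 by rewrite ltr_wpDl.
  have [N1 hN1] := e_complete sp (divr_gt0 (exprn_gt0 2 eps0) K1).
  exists N1 => // m /= N1m.
  rewrite -(ltr_pXn2r (_ : 0 < 2)%N) ?nnegrE ?(ltW eps0)// real_normK ?num_real//.
  apply: (le_lt_trans (hK _ _ (bss (Eb m)) (ssp m))); rewrite E1 mul1r.
  apply: (@le_lt_trans _ _ ((K + 1) * inner (fun x => phi x - proj mu e N1 phi x)
     (fun x => phi x - proj mu e N1 phi x))).
    apply: ler_pM => //; [exact: inner_ge0|by rewrite lerDl|].
    by apply: residual_nonincreasing => //; exact: leq_trans N1m (mN m).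
  by rewrite mulrC -ltr_pdivlMr.
(* The energy controls densities of mean zero only, hence the correction by a
   multiple of [v]. *)
pose abar m := total mu (E m) / L.
pose F m (x : T) := E m x - abar m * v x.
have sv := bss v_bounded.
have tv : summable1 mu v by exact: square_summable_summable1.
have L0 := lt0r_neq0 v_gt0.
have Fb m : bounded_mfun (F m) by apply: bounded_mfunB => //; exact: bounded_mfunZ.
have tF m : total mu (F m) = 0.
  rewrite totalB ?totalZ//; last 2 first.
  - exact/square_summable_summable1/bss.
  - exact: summable1Z.
  by rewrite divfK// subrr.
have abar_bound m : abar m ^+ 2 <= mass / L ^+ 2.
  rewrite exprMn exprVn ler_wpM2r ?invr_ge0 ?sqr_ge0//.
  by apply: (le_trans (total_bound (bss (Eb m)))); rewrite E1 mul1r.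
have bounded_cvg0 (u w : nat -> R) (c : R) : (forall m, u m ^+ 2 <= c) ->
    w m @[m --> \oo] --> 0 -> u m * w m @[m --> \oo] --> 0.
  move=> uc w0; apply/cvgr0Pnorm_lt => eps eps0.
  have c0 : 0 <= c by exact: le_trans (sqr_ge0 _) (uc 0%N).
  have d0 : 0 < eps / (c + 1) by rewrite divr_gt0// ltr_wpDl.
  have /cvgr0Pnorm_lt/(_ _ d0) := w0.
  apply: filterS => m; rewrite ltr_pdivlMr ?ltr_wpDl// => hm.
  apply: le_lt_trans hm; rewrite normrM mulrC ler_wpM2l//.
  have := uc m; rewrite -(real_normK (num_real (u m))) => h1.
  have := sqr_ge0 (`|u m| - 1); nra.
have formF m : form mu V (F m) (F m) =
    modified_form (E m) (E m) - abar m * modified_form (E m) v.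
  have -> : form mu V (F m) (F m) = modified_form (E m) (F m).
    rewrite /modified_form tF mulr0 addr0 {1}/F.
    have := formDl V_schur (bss (Eb m)) (square_summableZ (- abar m) sv) (bss (Fb m)).
    rewrite (formZl _ V_schur sv (bss (Fb m))) mulNr => <-.
    by congr form; apply/funext => x; rewrite mulNr.
  have := modified_formDr (bss (Eb m)) (bss (Eb m)) (square_summableZ (- abar m) sv).
  rewrite (modified_formZr _ (bss (Eb m)) sv) mulNr => <-.
  by congr modified_form; apply/funext => x; rewrite mulNr.
have F0 : form mu V (F m) (F m) @[m --> \oo] --> 0.
  have -> : (fun m => form mu V (F m) (F m)) =
      (fun m => modified_form (E m) (E m) - abar m * modified_form (E m) v).
    by apply/funext => m; exact: formF.
  rewrite -[X in _ --> X](subr0 0); apply: cvgB; first exact: EE0.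
  by apply: bounded_cvg0 abar_bound _; exact: Ephi0.
have Fw phi : square_summable phi -> inner (F m) phi @[m --> \oo] --> 0.
  move=> sp; apply: V_weak => //.
  exists (2 * 1 + 2 * (mass / L ^+ 2 * inner v v)) => m.
  have := sqr_normD_le (bss (Eb m)) (square_summableZ (- abar m) sv).
  have -> : (fun x => E m x + - abar m * v x) = F m.
    by apply/funext => x; rewrite mulNr.
  move=> /le_trans; apply; rewrite E1 lerD2l ler_wpM2l//.
  rewrite innerZl// ?innerZr//; last exact: square_summableZ.
  by rewrite mulrA mulrNN -expr2 ler_wpM2r ?inner_ge0.
(* Testing with [1] recovers the means from the weak convergence of [F]. *)
have abar0 : abar m @[m --> \oo] --> 0.
  have -> : abar = fun m => (modified_form (E m) (fun=> 1) -
      inner (F m) (adjoint_at mu V (fun=> 1))) / mass.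
    apply/funext => m; rewrite -(form_adjoint V_schur)//; last exact: bss.
    have := formDl V_schur (bss (Eb m)) (square_summableZ (- abar m) sv) (bss one_bounded).
    rewrite (formZl _ V_schur sv (bss one_bounded)) mulNr.
    have -> : (fun x => E m x + - abar m * v x) = F m.
      by apply/funext => x; rewrite mulNr.
    move=> ->; rewrite /modified_form -/(abar m) totalE -/mass.
    by field; exact: lt0r_neq0.
  rewrite -[X in _ --> X](mul0r mass^-1); apply: cvgMl.
  rewrite -[X in _ --> X](subr0 0); apply: cvgB; first exact/Ephi0/bss.
  by apply: Fw; exact/bss/(adjoint_bounded V_schur).
have Ew phi : square_summable phi -> inner (E m) phi @[m --> \oo] --> 0.
  move=> sp.
  have -> : (fun m => inner (E m) phi) = fun m => inner (F m) phi + abar m * inner v phi.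
    apply/funext => m; rewrite /F innerBl//; last 2 first.
    - exact: bss.
    - exact: square_summableZ.
    by rewrite innerZl// subrK.
  rewrite -[X in _ --> X](addr0 0); apply: cvgD; first exact: Fw.
  by rewrite -[X in _ --> X](mul0r (inner v phi)); apply: cvgMl.
have [M' hM'] := tau_summable.
(* With [1/8] for the equations, for the head and for the tail of the compact
   part, the squared norm is at most [2/8 + 2 (1/8 + 1/8) < 1]. *)
have e8 : 0 < 8^-1 :> R by rewrite invr_gt0.
have [J hJ] := tail_small (fun j => inner_ge0 mu (tau j)) hM' e8.
have sum0 : \sum_(j < J) inner (E m) (tau j) ^+ 2 @[m --> \oo] --> 0.
  elim: (J) => [|n IHn].
    rewrite (_ : (fun m => _) = fun=> 0); first exact: cvg_cst.
    by apply/funext => m; rewrite big_ord0.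
  rewrite (_ : (fun m => _) = (fun m => \sum_(j < n) inner (E m) (tau j) ^+ 2 +
      inner (E m) (tau n) * inner (E m) (tau n))).
    rewrite -[X in _ --> X](addr0 0); apply: cvgD => //.
    by rewrite -[X in _ --> X](mul0r 0); apply: cvgM; apply: Ew; exact/bss/tau_bounded.
  by apply/funext => m; rewrite big_ord_recr.
have /cvgr0Pnorm_lt/(_ _ e8) h8 := sum0.
have hh : \forall m \near \oo, m.+1%:R^-1 < 8^-1 :> R.
  near=> m; rewrite ltf_pV2 ?posrE ?ltr0n// ltr_nat.
  by rewrite ltnS; near: m; exact: nbhs_infty_ge.
have [m [hm1 hm2]] : exists m, `|\sum_(j < J) inner (E m) (tau j) ^+ 2| < 8^-1 /\
   m.+1%:R^-1 < 8^-1 :> R.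
  by have [m _ hm] := filterI h8 hh; exists m; apply: hm => /=.
have : \sum_(j < N m) a m j ^+ 2 = 1 by have [] := hNa m.
have : \sum_(j < N m) a m j ^+ 2 <= 2 * \sum_(j < N m) rho (a m) (N m) j ^+ 2 +
    2 * \sum_(j < N m) inner (tau j) (E m) ^+ 2.
  rewrite !mulr_sumr -big_split/=; apply: ler_sum => j _.
  rewrite /rho -/(E m).
  have := sqr_ge0 (a m j + 2 * inner (tau j) (E m)); nra.
have : \sum_(j < N m) inner (tau j) (E m) ^+ 2 <=
   \sum_(j < J) inner (E m) (tau j) ^+ 2 + 8^-1.
  rewrite (bigID (fun j : 'I_(N m) => (j < J)%N))/= lerD//.
    under eq_bigr do rewrite innerC.
    have [NJ|JN] := leqP (N m) J.
      rewrite [leRHS](bigID (fun j : 'I_J => (j < N m)%N))/=.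
      rewrite -(big_ord_widen J (fun j => inner (E m) (tau j) ^+ 2) NJ).
      rewrite [leLHS](eq_bigl xpredT) => [|j]; last first.
        by rewrite (leq_trans (ltn_ord j) NJ).
      by rewrite lerDl sumr_ge0// => j _; exact: sqr_ge0.
    by rewrite -(big_ord_widen (N m) (fun j => inner (E m) (tau j) ^+ 2) (ltnW JN)).
  apply: le_trans (hJ (N m)).
  under [leRHS]eq_bigl do rewrite leqNgt.
  apply: ler_sum => j _.
  have := CauchySchwarz (bss (tau_bounded j)) (bss (Eb m)).
  by rewrite E1 mulr1.
have := le_lt_trans (rm m) hm2; move: hm1 => /ltr_normlW.
set s1 := \sum_(j < J) _; set s2 := \sum_(j < N m) rho _ _ _ ^+ 2.
set s3 := \sum_(j < N m) inner (tau j) (E m) ^+ 2.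
by set s4 := \sum_(j < N m) a m j ^+ 2; lra.
Unshelve. all: by end_near. Qed.

(** For a fixed dimension, uniqueness of the discrete solution means that the
   system matrix is invertible. *)
Lemma stability_fixed N :
  (forall a, (forall j, (j < N)%N -> rho a N j = 0) ->
     forall j, (j < N)%N -> a j = 0) ->
  exists c, 0 < c /\ forall a : nat -> R,
  \sum_(j < N) a j ^+ 2 <= c * \sum_(j < N) rho a N j ^+ 2.
Proof.
move=> inj.
pose B : 'M[R]_N := \matrix_(i, j) ((i == j)%:R + inner (tau j) (e i)).
pose row_of (a : nat -> R) : 'rV[R]_N := \row_j a j.
have rhoE a : row_of a *m B = row_of (rho a N).
  apply/rowP => j; rewrite !mxE /rho innerC inner_comb//; last exact/bss/tau_bounded.
  under eq_bigr do rewrite !mxE mulrDr.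
  rewrite big_split/=; congr (_ + _); last by apply: eq_bigr => i _; rewrite innerC.
  rewrite (bigD1 j)//= eqxx mulr1 big1 ?addr0// => i /negbTE ->.
  by rewrite mulr0.
have uB : B \in unitmx.
  rewrite -row_free_unit -kermx_eq0; apply/eqP/row_matrixP => i.
  rewrite row0; set u := row i (kermx B).
  pose a k := if insub k is Some j then u 0 (j : 'I_N) else 0.
  have ua : u = row_of a.
    by apply/rowP => j; rewrite [RHS]mxE /a valK.
  have uB0 : u *m B = 0 by rewrite /u -row_mul mulmx_ker row0.
  have a0 : forall j, (j < N)%N -> a j = 0.
    apply: inj => j jN; have := congr1 (fun w : 'rV_N => w 0 (Ordinal jN)) uB0.
    by rewrite ua rhoE !mxE.
  by rewrite ua; apply/rowP => j; rewrite !mxE a0.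
pose c := \sum_(i < N) \sum_(j < N) (invmx B j i) ^+ 2.
exists (c + 1); split.
  by rewrite ltr_wpDl// sumr_ge0// => i _; rewrite sumr_ge0// => j _; exact: sqr_ge0.
move=> a; have r0 : 0 <= \sum_(j < N) rho a N j ^+ 2.
  by rewrite sumr_ge0// => j _; exact: sqr_ge0.
apply: (@le_trans _ _ (c * \sum_(j < N) rho a N j ^+ 2)); last first.
  by rewrite ler_wpM2r// lerDl.
rewrite /c mulr_suml; apply: ler_sum => i _.
have -> : a i = \sum_(j < N) rho a N j * invmx B j i.
  have := congr1 (fun w : 'rV_N => w 0 i) (mulmxK uB (row_of a)).
  rewrite rhoE !mxE => <-; by apply: eq_bigr => j _; rewrite !mxE.
pose b k := if insub k is Some j then invmx B (j : 'I_N) i else 0.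
have bE (j : 'I_N) : invmx B j i = b j by rewrite /b valK.
under eq_bigr do rewrite bE.
under [X in _ <= X * _]eq_bigr do rewrite bE.
by rewrite mulrC; exact: sum_CauchySchwarz.
Qed.

Variable cI : R.
Hypothesis A_inv : forall n j, (0 < n)%N -> (j < n.*2.+1)%N -> (A j)^-1 <= cI * n%:R.

(** Quasi-optimality: the discrete error solves the truncated system whose
   right-hand side is the data error, amplified by [1 / A j], plus the compact
   part applied to the best approximation error. *)
Theorem galerkin_quasi_optimal : exists c : R, 0 < c /\
  forall (psi f : T -> R) (a : nat -> R) (n : nat),
  square_summable psi -> square_summable f -> (0 < n)%N ->
  (forall j, (j < n.*2.+1)%N ->
    modified_form (comb e a n.*2.+1) (e j) = modified_form psi (e j) + inner f (e j)) ->
  (forall b, (forall j, (j < n.*2.+1)%N -> modified_form (comb e b n.*2.+1) (e j) = 0) ->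
    forall j, (j < n.*2.+1)%N -> b j = 0) ->
  inner (fun x => psi x - comb e a n.*2.+1 x) (fun x => psi x - comb e a n.*2.+1 x) <=
  c * (n%:R ^+ 2 * inner f f +
    inner (fun x => psi x - proj mu e n.*2.+1 psi x)
          (fun x => psi x - proj mu e n.*2.+1 psi x)).
Proof.
have [N0 [c0 [c0_gt0 large]]] := stability_large.
have small (N : nat) : exists c, 0 < c /\
    ((forall a, (forall j, (j < N)%N -> rho a N j = 0) ->
     forall j, (j < N)%N -> a j = 0) -> forall a : nat -> R,
    \sum_(j < N) a j ^+ 2 <= c * \sum_(j < N) rho a N j ^+ 2).
  have [/stability_fixed[c [cp hc]]|nP] := pselect (forall a,
      (forall j, (j < N)%N -> rho a N j = 0) -> forall j, (j < N)%N -> a j = 0).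
    by exists c; split.
  by exists 1; split => // /nP.
have {small}[cs hcs] := choice small.
pose c1 := c0 + \sum_(N < N0) cs N.
have cs0 N : 0 < cs N by have [] := hcs N.
have c1_ge0 : 0 <= c1 by rewrite addr_ge0 ?(ltW c0_gt0)// sumr_ge0// => N _; exact: ltW.
have stable (N : nat) : (forall a, (forall j, (j < N)%N -> rho a N j = 0) ->
     forall j, (j < N)%N -> a j = 0) -> forall a : nat -> R,
    \sum_(j < N) a j ^+ 2 <= c1 * \sum_(j < N) rho a N j ^+ 2.
  move=> inj a; have r0 : 0 <= \sum_(j < N) rho a N j ^+ 2.
    by rewrite sumr_ge0// => j _; exact: sqr_ge0.
  have [N0N|NN0] := leqP N0 N.
    apply: (le_trans (large N a N0N)); rewrite ler_wpM2r// lerDl sumr_ge0// => i _.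
    exact: ltW.
  have [_ /(_ inj a)/le_trans] := hcs N; apply; rewrite ler_wpM2r//.
  rewrite /c1 (bigD1 (Ordinal NN0))//= addrCA lerDl addr_ge0 ?(ltW c0_gt0)//.
  by rewrite sumr_ge0// => i _; exact: ltW.
have [M' hM'] := tau_summable.
have M'0 : 0 <= M' by have := hM' 0%N; rewrite big_ord0.
exists (2 * (1 + c1 * (2 * cI ^+ 2 + 2 * M'))); split.
  rewrite mulr_gt0// ltr_pwDl// mulr_ge0// addr_ge0// mulr_ge0//.
  exact: sqr_ge0.
move=> psi f a n sp sf n0 heq hinj.
set N := n.*2.+1 in heq hinj *.
pose Q (x : T) := psi x - proj mu e N psi x.
have sQ : square_summable Q by exact: residual_square_summable.
have inj : forall b, (forall j, (j < N)%N -> rho b N j = 0) ->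
     forall j, (j < N)%N -> b j = 0.
  by move=> b hb; apply: hinj => j jN; rewrite modified_form_comb_e// hb// mulr0.
pose b j := a j - inner psi (e j).
have combB : (fun x => psi x - comb e a N x) = (fun x => Q x + comb e (fun j => - b j) N x).
  apply/funext => x; rewrite /Q -addrA; congr (_ + _).
  rewrite /proj /comb -!sumrN -big_split/=; apply: eq_bigr => j _.
  by rewrite /b; ring.
have rhob j : (j < N)%N -> rho b N j = (A j)^-1 * inner f (e j) + inner (tau j) Q.
  move=> jN; have A0 := lt0r_neq0 (A_gt0 j).
  apply: (mulfI A0); rewrite -modified_form_comb_e// mulrDr mulVKf//.
  have -> : A j * inner (tau j) Q = modified_form Q (e j).
    by rewrite modified_form_e// inner_residual_e// add0r.
  have -> : comb e b N = fun x => comb e a N x + -1 * comb e (fun j => inner psi (e j)) N x.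
    apply/funext => x; rewrite mulN1r /comb -sumrN -big_split/=.
    by apply: eq_bigr => i _; rewrite mulrBl.
  have -> : Q = fun x => psi x + -1 * comb e (fun j => inner psi (e j)) N x.
    by apply/funext => x; rewrite mulN1r.
  rewrite !modified_formDl; try exact: bss; try exact/bss/bounded_comb; try exact/square_summableZ/bss/bounded_comb; try by [].
  by rewrite heq//; ring.
rewrite combB.
apply: (le_trans (sqr_normD_le sQ (bss (bounded_comb _ _ _)))) => //.
rewrite sqr_norm_comb//; under eq_bigr do rewrite sqrrN.
have hb : \sum_(j < N) b j ^+ 2 <= c1 * \sum_(j < N) rho b N j ^+ 2 by exact: stable.
have hr : \sum_(j < N) rho b N j ^+ 2 <=
    (2 * cI ^+ 2) * (n%:R ^+ 2 * inner f f) + (2 * M') * inner Q Q.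
  apply: (@le_trans _ _ (\sum_(j < N) (2 * ((cI * n%:R) ^+ 2 * inner f (e j) ^+ 2) +
      2 * (inner (tau j) (tau j) * inner Q Q)))).
    apply: ler_sum => j _; rewrite rhob//.
    have h1 : ((A j)^-1 * inner f (e j)) ^+ 2 <= (cI * n%:R) ^+ 2 * inner f (e j) ^+ 2.
      rewrite exprMn ler_wpM2r ?sqr_ge0// lerXn2r ?nnegrE//.
      - by rewrite invr_ge0 ltW.
      - by apply: le_trans (A_inv n0 (ltn_ord j)); rewrite invr_ge0 ltW.
      - exact: A_inv.
    have h2 := CauchySchwarz (bss (tau_bounded j)) sQ.
    move: h1 h2; set X := _^-1 * _; set Y := inner (tau j) Q => h1 h2.
    have := sqr_ge0 (X - Y); nra.
  rewrite big_split/= -!mulr_sumr lerD//.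
    have -> : 2 * cI ^+ 2 * (n%:R ^+ 2 * inner f f) =
      2 * ((cI * n%:R) ^+ 2 * inner f f) by ring.
    by rewrite !ler_wpM2l ?sqr_ge0//; exact: bessel.
  rewrite -mulr_suml mulrA ler_wpM2r ?inner_ge0// ler_wpM2l//; exact: hM'.
have f0 := mulr_ge0 (sqr_ge0 n%:R) (inner_ge0 mu f); have Q0 := inner_ge0 mu Q.
move: f0 Q0 hb hr; rewrite -/Q.
move: (inner Q Q) (n%:R ^+ 2 * inner f f) (\sum_(j < N) rho b N j ^+ 2)
  (\sum_(j < N) b j ^+ 2) => q F r s F0 q0 hs hr.
have hcr : c1 * r <= c1 * (2 * cI ^+ 2 * F + 2 * M' * q) by rewrite ler_wpM2l.
have I0 := sqr_ge0 cI.
have p1 : 0 <= c1 * (2 * M' * F) by rewrite !mulr_ge0.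
have p2 : 0 <= c1 * (2 * cI ^+ 2 * q) by do 3!rewrite mulr_ge0//.
have -> : 2 * (1 + c1 * (2 * cI ^+ 2 + 2 * M')) * (F + q) = 2 * q + 2 * F +
   2 * (c1 * (2 * cI ^+ 2 * F + 2 * M' * q)) + 2 * (c1 * (2 * M' * F)) +
   2 * (c1 * (2 * cI ^+ 2 * q)) by ring.
lra.
Qed.

End Stability.

(** * Density of function algebras in the space of square-integrable functions *)

Lemma total_dominated d (T : measurableType d) (R : realType)
    (mu : {measure set T -> \bar R}) (f_ : nat -> T -> R) (f g : T -> R) :
  (forall n, measurable_fun setT (f_ n)) -> measurable_fun setT f ->
  summable1 mu g -> {ae mu, forall x n, `|f_ n x| <= g x} ->
  {ae mu, forall x, f_ ^~ x @ \oo --> f x} ->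
  total mu (f_ n) @[n --> \oo] --> total mu f.
Proof.
move=> mf_ mf sg fg ff.
have [] := @dominated_convergence _ _ _ mu setT measurableT
   (fun n => EFin \o f_ n) (EFin \o f) (EFin \o g).
- by move=> n; exact/measurable_EFinP.
- exact/measurable_EFinP.
- by apply: filterS ff => x fx _; apply: cvg_EFin; [exact: nearW|exact: fx].
- exact: sg.
- by apply: filterS fg => x fgx n _; rewrite lee_fin.
move=> sf _ lim.
rewrite /total /Rintegral; apply: fine_cvg.
by rewrite fineK ?integrable_fin_num.
Qed.

Section AlgebraDensity.
Context d (T : measurableType d) (R : realType).
Variable mu : {finite_measure set T -> \bar R}.
Variable A : set (T -> R).
Hypothesis A_bounded : forall a, A a -> bounded_mfun a.
Hypothesis A_cst : forall c, A (fun=> c).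
Hypothesis A_add : forall a b, A a -> A b -> A (fun x => a x + b x).
Hypothesis A_mul : forall a b, A a -> A b -> A (fun x => a x * b x).
Implicit Types phi psi : T -> R.
Local Notation inner := (inner mu).
Local Notation square_summable := (square_summable mu).

Definition approximable phi := forall eps, 0 < eps -> exists2 a, A a &
  inner (fun x => phi x - a x) (fun x => phi x - a x) < eps.

Definition bounded_approximable phi := bounded_mfun phi /\ approximable phi.

Let bss h : bounded_mfun h -> square_summable h.
Proof. exact: bounded_mfun_square_summable. Qed.

Let A_ss a : A a -> square_summable a.
Proof. by move=> Aa; exact/bss/A_bounded. Qed.

Lemma approximable_limit phi : square_summable phi ->
  (forall eps, 0 < eps -> exists psi, [/\ square_summable psi, approximable psi &
     inner (fun x => phi x - psi x) (fun x => phi x - psi x) < eps]) ->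
  approximable phi.
Proof.
move=> sphi H eps eps0; have e4 : 0 < eps / 4 by rewrite divr_gt0.
have [psi [spsi apsi h1]] := H _ e4; have [a Aa h2] := apsi _ e4.
exists a => //; have sa := A_ss Aa.
have := sqr_normD_le (square_summableB sphi spsi) (square_summableB spsi sa).
have -> : (fun x => phi x - psi x + (psi x - a x)) = (fun x => phi x - a x).
  by apply/funext => x; rewrite addrA subrK.
lra.
Qed.

Lemma A_bounded_approximable a : A a -> bounded_approximable a.
Proof.
move=> Aa; split; first exact: A_bounded.
move=> eps eps0; exists a => //.
rewrite (_ : (fun x => _) = fun=> 0); last by apply/funext => x; rewrite subrr.
by rewrite inner0l.
Qed.

Lemma bounded_approximableD phi psi : bounded_approximable phi ->
  bounded_approximable psi -> bounded_approximable (fun x => phi x + psi x).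
Proof.
move=> [bp ap] [bq aq]; split; first exact: bounded_mfunD.
move=> eps eps0; have e4 : 0 < eps / 4 by rewrite divr_gt0.
have [a Aa h1] := ap _ e4; have [b Ab h2] := aq _ e4.
exists (fun x => a x + b x); first exact: A_add.
have := sqr_normD_le (square_summableB (bss bp) (A_ss Aa)) (square_summableB (bss bq) (A_ss Ab)).
have -> : (fun x => phi x - a x + (psi x - b x)) =
    (fun x => phi x + psi x - (a x + b x)).
  by apply/funext => x; ring.
lra.
Qed.

Lemma sqr_norm_mul_le phi psi (B : R) : square_summable phi -> bounded_mfun psi ->
  (forall x, `|psi x| <= B) ->
  inner (fun x => psi x * phi x) (fun x => psi x * phi x) <=
  B ^+ 2 * inner phi phi.
Proof.
move=> sp bpsi hB; have [mp sp2] := sp.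
have s1 : summable1 mu (fun x => phi x * phi x) by exact: summable1_mul.
rewrite -[leRHS]/(B ^+ 2 * total mu (fun x => phi x * phi x)) -totalZ//; apply: le_total.
- by apply: summable1_mul; under eq_fun do rewrite mulrC; exact: square_summableMb.
- exact: summable1Z.
- move=> x; rewrite mulrACA ler_wpM2r -?expr2 ?sqr_ge0//.
  rewrite -(real_normK (num_real (psi x))) lerXn2r// nnegrE.
  exact: le_trans (hB x).
Qed.

Lemma bounded_approximableM phi psi : bounded_approximable phi ->
  bounded_approximable psi -> bounded_approximable (fun x => phi x * psi x).
Proof.
move=> [bp ap] [bq aq]; split; first exact: bounded_mfunM.
move=> eps eps0; have [_ [B hB]] := bp.
have B1 : 0 < 4 * (B ^+ 2 + 1) by rewrite mulr_gt0// ltr_wpDl ?sqr_ge0.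
have [b Ab h1] := aq _ (divr_gt0 eps0 B1).
have [_ [C hC]] := A_bounded Ab.
have C1 : 0 < 4 * (C ^+ 2 + 1) by rewrite mulr_gt0// ltr_wpDl ?sqr_ge0.
have [a Aa h2] := ap _ (divr_gt0 eps0 C1).
exists (fun x => a x * b x); first exact: A_mul.
have s1 := square_summableB (bss bq) (A_ss Ab).
have s2 := square_summableB (bss bp) (A_ss Aa).
have h3 := sqr_norm_mul_le s1 bp hB.
have h4 := sqr_norm_mul_le s2 (A_bounded Ab) hC.
have := sqr_normD_le
  (_ : square_summable (fun x => phi x * (psi x - b x)))
  (_ : square_summable (fun x => b x * (phi x - a x))).
have -> : (fun x => phi x * (psi x - b x) + b x * (phi x - a x)) =
    (fun x => phi x * psi x - a x * b x).
  by apply/funext => x; ring.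
move=> /(_ _ _)/le_lt_trans; apply.
- by apply/bss/bounded_mfunM => //; apply: bounded_mfunB => //; exact: A_bounded.
- by apply/bss/bounded_mfunM; [exact: A_bounded|apply: bounded_mfunB => //; exact: A_bounded].
move: h1 h2; rewrite !ltr_pdivlMr// => h1 h2.
have i1 := inner_ge0 mu (fun x => psi x - b x).
have i2 := inner_ge0 mu (fun x => phi x - a x).
have := sqr_ge0 B; have := sqr_ge0 C; nra.
Qed.

(** Dominated convergence closes the class under bounded pointwise limits. *)
Lemma bounded_approximable_cvg (phi_ : nat -> T -> R) phi (B : R) :
  (forall n, bounded_approximable (phi_ n)) -> (forall n x, `|phi_ n x| <= B) ->
  {ae mu, forall x, phi_ ^~ x @ \oo --> phi x} -> bounded_mfun phi ->
  bounded_approximable phi.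
Proof.
move=> hphi hB lim bphi; split => //.
apply: approximable_limit; first exact: bss.
move=> eps eps0; have [mphi [C hC]] := bphi.
have : inner (fun x => phi x - phi_ n x) (fun x => phi x - phi_ n x) @[n --> \oo] --> 0.
  rewrite -[X in _ --> X](total0 mu).
  apply: (@total_dominated _ _ _ mu _ _ (fun=> (C + B) ^+ 2)).
  - move=> n; apply: measurable_funM; apply: measurable_funB => //;
      by have [[? _] _] := hphi n.
  - exact: measurable_cst.
  - exact/bounded_mfun_summable1/bounded_mfun_cst.
  - apply: aeW => x n; rewrite -expr2 ger0_norm ?sqr_ge0//.
    rewrite -(real_normK (num_real _)) lerXn2r// ?nnegrE//.
      by rewrite addr_ge0//; [exact: le_trans (hC x)|exact: le_trans (hB n x)].
    by rewrite (le_trans (ler_normB _ _))// lerD.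
  - apply: filterS lim => x hx; rewrite -[X in _ --> X](mulr0 0) -(subrr (phi x)).
    by apply: cvgM; apply: cvgB => //; exact: cvg_cst.
move=> /cvgr0Pnorm_lt/(_ _ eps0)[n _ hn].
exists (phi_ n); have [bn an] := hphi n; split => //; first exact: bss.
by have := hn n (leqnn n) => /ltr_normlW.
Qed.

Lemma bounded_approximableX phi n : bounded_approximable phi ->
  bounded_approximable (fun x => phi x ^+ n).
Proof.
move=> hphi; elim: n => [|n IHn].
  by under eq_fun do rewrite expr0; exact: A_bounded_approximable.
by under eq_fun do rewrite exprS; exact: bounded_approximableM.
Qed.

Lemma bounded_approximable_onem phi : bounded_approximable phi ->
  bounded_approximable (fun x => 1 - phi x).
Proof.
move=> hphi; apply: bounded_approximableD; first exact: A_bounded_approximable.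
rewrite (_ : (fun x => - phi x) = (fun x => -1 * phi x)); last first.
  by apply/funext => x; rewrite mulN1r.
by apply: bounded_approximableM => //; exact: A_bounded_approximable.
Qed.

Lemma bernoulli (x : R) n : -1 <= x -> 1 + n%:R * x <= (1 + x) ^+ n.
Proof.
move=> x1; elim: n => [|n IHn]; first by rewrite mul0r addr0 expr0.
rewrite exprSr; apply: (@le_trans _ _ ((1 + n%:R * x) * (1 + x))); last first.
  by rewrite ler_wpM2r// -lerBlDl sub0r.
have := mulr_ge0 (ler0n R n) (sqr_ge0 x); rewrite -natr1; nra.
Qed.

(** [(1 - u^(2n))^(n k^(2n))] tends to [1] where [u < 1/k] and to [0] where
   [u >= 1/k], by the Bernoulli inequality. *)
Lemma threshold_cvg (u : R) (k : nat) : 0 <= u <= 1 -> (0 < k)%N ->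
  ((1 - u ^+ n.*2) ^+ (n * k ^ n.*2) : R) @[n --> \oo] --> ((u < k%:R^-1)%R%:R : R).
Proof.
move=> /andP[u0 u1] k0.
have v0 n : 0 <= u ^+ n by exact: exprn_ge0.
have v1 n : u ^+ n <= 1 by exact: exprn_ile1.
have kR : 0 < k%:R :> R by rewrite ltr0n.
have natE n : (n * k ^ n.*2)%:R * u ^+ n.*2 = n%:R * (k%:R * u) ^+ n.*2 :> R.
  by rewrite natrM natrX exprMn mulrA.
have [uk|ku] := ltP u k%:R^-1.
  pose q := k%:R * u.
  have q0 : 0 <= q by rewrite mulr_ge0// ltW.
  have q1 : q < 1 by rewrite /q mulrC -ltr_pdivlMr// mul1r.
  have [c hc] : exists c, forall n, n%:R * q ^+ n <= c.
    have [->|qN0] := eqVneq q 0.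
      exists 1 => -[|n]; first by rewrite mul0r.
      by rewrite expr0n/= mulr0.
    have qp : 0 < q by rewrite lt_def qN0.
    have h0 : 0 < q^-1 - 1 by rewrite subr_gt0 invf_gt1.
    exists (q^-1 - 1)^-1 => n.
    rewrite -[leRHS]mul1r ler_pdivlMr// -mulrA mulrCA mulrA.
    have qn : 0 < q ^+ n by exact: exprn_gt0.
    have -> : q ^+ n * n%:R * (q^-1 - 1) = (n%:R * (q^-1 - 1)) * q ^+ n by ring.
    rewrite -ler_pdivlMr// mul1r -exprVn.
    have := @bernoulli (q^-1 - 1) n.
    rewrite (_ : 1 + (q^-1 - 1) = q^-1) => [bn|]; last by rewrite addrC subrK.
    by apply: (le_trans _ (bn _)); lra.
  have qc : c * q ^+ n @[n --> \oo] --> (0 : R).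
    rewrite -[X in _ --> X](mulr0 c); apply: cvgMr; apply: cvg_expr.
    by rewrite ger0_norm.
  apply/cvgrPdist_lt => eps eps0; move/cvgr0Pnorm_lt : qc => /(_ _ eps0).
  apply: filterS => n /ltr_normlW; apply: le_lt_trans.
  have w0 : 0 <= 1 - u ^+ n.*2 by rewrite subr_ge0.
  have w1 : 1 - u ^+ n.*2 <= 1 by rewrite lerBlDr lerDl.
  rewrite ger0_norm ?subr_ge0 ?exprn_ile1//.
  have := @bernoulli (- u ^+ n.*2) (n * k ^ n.*2).
  rewrite lerNr opprK => /(_ (v1 _)); rewrite mulrN natE -/q => bn.
  have : n%:R * q ^+ n.*2 <= c * q ^+ n.
    by rewrite -addnn exprD mulrA ler_wpM2r// exprn_ge0.
  by have -> : true%:R = 1 :> R by []; move: bn; lra.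
apply/cvgrPdist_lt => eps eps0.
have /cvgr0Pnorm_lt/(_ _ eps0) := @cvg_harmonic R.
apply: filterS => n /ltr_normlW; apply: le_lt_trans.
have w0 : 0 <= 1 - u ^+ n.*2 by rewrite subr_ge0.
rewrite sub0r normrN ger0_norm ?exprn_ge0//.
set m := (_ * _)%N; set x := u ^+ n.*2.
rewrite /harmonic/= -[leRHS]mul1r ler_pdivlMr ?ltr0n//.
apply: (@le_trans _ _ ((1 - x) ^+ m * (1 + x) ^+ m)).
  rewrite ler_wpM2l ?exprn_ge0//.
  apply: (le_trans _ (bernoulli _ _)); last by rewrite (le_trans _ (v0 _)).
  rewrite natE -nat1r lerD2l -[leLHS]mulr1 ler_wpM2l// exprn_ege1//.
  by rewrite mulrC -ler_pdivrMr// mul1r.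
rewrite -exprMn exprn_ile1//.
  by rewrite mulr_ge0// addr_ge0// v0.
by have := v0 n.*2; rewrite -/x; nra.
Qed.

(** These sets form a sigma-algebra. Generating the Borel sets in this way takes
   the place of uniform approximation by the algebra. *)
Definition approximable_set (E : set T) :=
  measurable E /\ bounded_approximable (\1_E : T -> R).

Lemma bounded_mfun_indic (E : set T) : measurable E -> bounded_mfun (\1_E : T -> R).
Proof.
move=> mE; split; first exact: measurable_indic.
by exists 1 => x; rewrite indicE; case: (x \in E); rewrite ?normr1 ?normr0.
Qed.

Lemma approximable_threshold phi (k : nat) : bounded_approximable phi ->
  (forall x, 0 <= phi x <= 1) -> (0 < k)%N ->
  approximable_set [set x | phi x < k%:R^-1].
Proof.
move=> hphi phi01 k0; have [[mphi _] _] := hphi.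
have mE : measurable [set x | phi x < k%:R^-1].
  rewrite -[X in measurable X]setTI.
  exact: measurable_fun_ltr.
split => //; apply: (@bounded_approximable_cvg
  (fun n x => (1 - phi x ^+ n.*2) ^+ (n * k ^ n.*2)) _ 1).
- move=> n; apply: bounded_approximableX; apply: bounded_approximable_onem.
  exact: bounded_approximableX.
- move=> n x; have /andP[p0 p1] := phi01 x.
  have e0 := exprn_ge0 n.*2 p0; have e1 := exprn_ile1 n.*2 p0 p1.
  by rewrite ger0_norm ?exprn_ge0 ?exprn_ile1//; lra.
- apply: aeW => x.
  have -> : (\1_[set y | phi y < k%:R^-1] x : R) = (phi x < k%:R^-1)%R%:R.
    by rewrite indicE; congr (nat_of_bool _)%:R; apply/idP/idP; rewrite inE.
  exact: threshold_cvg.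
- exact: bounded_mfun_indic.
Qed.

Lemma approximable_setC (E : set T) : approximable_set E -> approximable_set (~` E).
Proof.
move=> [mE hE]; split; first exact: measurableC.
rewrite (_ : \1_(~` E) = (fun x => 1 - \1_E x)); first exact: bounded_approximable_onem.
apply/funext => x; rewrite !indicE in_setC; case: (x \in E) => /=.
  by rewrite subrr.
by rewrite subr0.
Qed.

Lemma approximable_bigcap (F : nat -> set T) : (forall n, approximable_set (F n)) ->
  approximable_set (\bigcap_n F n).
Proof.
move=> hF; have mF : measurable (\bigcap_n F n).
  by apply: bigcapT_measurable => n; have [] := hF n.
split => //; apply: (@bounded_approximable_cvg
  (fun n x => \prod_(i < n) \1_(F i) x) _ 1).
- elim => [|n IHn].
    by under eq_fun do rewrite big_ord0; exact: A_bounded_approximable.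
  under eq_fun do rewrite big_ord_recr/=.
  by apply: bounded_approximableM => //; have [] := hF n.
- move=> n x; rewrite normr_prod; elim: n => [|n IHn]; first by rewrite big_ord0.
  rewrite big_ord_recr/= mulr_ile1 ?prodr_ge0//.
  by rewrite indicE; case: (x \in F n); rewrite ?normr1 ?normr0.
- apply: aeW => x; rewrite indicE.
  have [xF|xF] := boolP (x \in \bigcap_n F n).
    rewrite (_ : (fun n => _) = fun=> 1); first exact: cvg_cst.
    apply/funext => n; rewrite big1// => i _; rewrite indicE mem_set//.
    by move/set_mem : xF; apply.
  have [k xk] : exists k, x \notin F k.
    apply: contrapT => H; move/negP : xF; apply; rewrite inE => n _.
    by apply: contrapT => H'; apply: H; exists n; apply/negP; rewrite inE.
  apply: cvg_near_cst; exists k.+1 => // n /= kn.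
  by rewrite (bigD1 (Ordinal kn))//= indicE (negbTE xk) mul0r.
- exact: bounded_mfun_indic.
Qed.

Lemma approximable_sigma_algebra : sigma_algebra setT approximable_set.
Proof.
have h0 : approximable_set set0.
  split => //; rewrite (_ : \1_set0 = fun=> 0); first exact: A_bounded_approximable.
  by apply/funext => x; rewrite indicE in_set0.
split => //.
- by move=> E hE; rewrite setTD; exact: approximable_setC.
- move=> F hF; rewrite -(setCK (\bigcup_k F k)) setC_bigcup.
  by apply: approximable_setC; apply: approximable_bigcap => n; exact: approximable_setC.
Qed.

Lemma approximable_square_summable :
  (forall E, measurable E -> approximable_set E) ->
  forall phi, square_summable phi -> approximable phi.
Proof.
move=> hE.
have hS (I : Type) (s : seq I) (F : I -> T -> R) :
    (forall i, bounded_approximable (F i)) ->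
    bounded_approximable (fun x => \sum_(i <- s) F i x).
  move=> hF; elim: s => [|i s IHs].
    by under eq_fun do rewrite big_nil; exact: A_bounded_approximable.
  by under eq_fun do rewrite big_cons; exact: bounded_approximableD.
have nonneg phi : bounded_mfun phi -> (forall x, 0 <= phi x) -> bounded_approximable phi.
  move=> bphi phi0; have [mphi [B hB]] := bphi.
  have mEphi : measurable_fun setT (EFin \o phi) by exact/measurable_EFinP.
  have phi0' x : setT x -> (0 <= (EFin \o phi) x)%E by rewrite lee_fin.
  pose g n (x : T) : R := nnsfun_approx measurableT mEphi n x.
  apply: (@bounded_approximable_cvg g phi B) => //.
  - move=> n.
    have gE : g n = _ := funext (fimfunEord (nnsfun_approx measurableT mEphi n)).
    rewrite gE; apply: hS => i; apply: bounded_approximableM.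
      exact: A_bounded_approximable.
    by apply: (hE _ _).2; exact: measurable_sfunP.
  - move=> n x; rewrite ger0_norm; last exact: fun_ge0.
    apply: le_trans (hB x); rewrite ger0_norm//.
    have := @le_approx _ _ _ setT (EFin \o phi) n x phi0' I.
    by rewrite -nnsfun_approxE lee_fin.
  - apply: aeW => x.
    by have /fine_cvg := cvg_nnsfun_approx measurableT mEphi phi0' (I : setT x).
have bounded phi : bounded_mfun phi -> bounded_approximable phi.
  move=> bphi; have [mphi [B hB]] := bphi.
  rewrite (_ : phi = fun x => (phi x + B) + - B); last first.
    by apply/funext => x; rewrite addrK.
  apply: bounded_approximableD; last exact: A_bounded_approximable.
  apply: nonneg => [|x]; first by apply: bounded_mfunD => //; exact: bounded_mfun_cst.
  by have := hB x; rewrite ler_norml => /andP[+ _]; rewrite -subr_ge0 opprK.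
move=> phi sphi; have [mphi sphi2] := sphi.
apply: approximable_limit => // eps eps0.
pose E n := [set x | `|phi x| <= n%:R].
have mE n : measurable (E n).
  rewrite -[X in measurable X]setTI; apply: measurable_fun_le => //.
  exact: measurableT_comp.
pose psi n x := phi x * \1_(E n) x.
have bpsi n : bounded_mfun (psi n).
  split; first by apply: measurable_funM => //; exact: measurable_indic.
  exists n%:R => x; rewrite /psi indicE.
  have [/set_mem ?|_] := boolP (x \in E n); first by rewrite mulr1.
  by rewrite mulr0 normr0.
have : inner (fun x => phi x - psi n x) (fun x => phi x - psi n x) @[n --> \oo] --> 0.
  rewrite -[X in _ --> X](total0 mu).
  apply: (@total_dominated _ _ _ mu _ _ (fun x => phi x ^+ 2)) => //.
  - by move=> n; apply: measurable_funM; apply: measurable_funB => //; case: (bpsi n).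
  - apply: aeW => x n; rewrite /psi indicE; case: (x \in E n) => /=.
      by rewrite mulr1 subrr mulr0 normr0 sqr_ge0.
    by rewrite mulr0 subr0 -expr2 ger0_norm ?sqr_ge0.
  - apply: aeW => x; apply: cvg_near_cst.
    exists (Num.truncn `|phi x|).+1 => // n /= hn.
    rewrite /psi indicE mem_set ?mulr1 ?subrr ?mulr0//.
    rewrite /E/= ltW// (lt_le_trans (truncnS_gt _))// ler_nat//.
move=> /cvgr0Pnorm_lt/(_ _ eps0)[n _ hn].
exists (psi n); split; [exact: bss|by have [] := bounded _ (bpsi n)|].
by have := hn n (leqnn n) => /ltr_normlW.
Qed.

Lemma approximable_generated (G : set (set T)) :
  G.-sigma.-measurable = @measurable _ T ->
  (forall E, G E -> approximable_set E) ->
  forall phi, square_summable phi -> approximable phi.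
Proof.
move=> GE hG; apply: approximable_square_summable => E.
rewrite -GE; apply: smallest_sub => //; exact: approximable_sigma_algebra.
Qed.

End AlgebraDensity.

(** On a parameter interval, the functions [u s] separate the points of the
   closed curve: the half-line below [a] agrees, up to a null set, with the set
   of the [t] at which all [u s], with [s] in a countable dense subset of the
   interval from [a] to [l], are bounded below by a common [1 / n]. *)
Lemma dense_separating_algebra (R : realType)
    (mu : {finite_measure set (measurableTypeR R) -> \bar R}) (l : R)
    (A : set (measurableTypeR R -> R)) (u : R -> R -> R) :
  0 < l -> mu (~` `]0, l[) = 0%E ->
  (forall a, A a -> bounded_mfun a) -> (forall c, A (fun=> c)) ->
  (forall a b, A a -> A b -> A (fun x => a x + b x)) ->
  (forall a b, A a -> A b -> A (fun x => a x * b x)) ->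
  (forall s, A (u s)) -> (forall s t, 0 <= u s t <= 1) ->
  (forall t, continuous (u ^~ t)) -> (forall t, u t t = 0) ->
  (forall s t, 0 < t < s -> s <= l -> 0 < u s t) ->
  forall phi, square_summable mu phi -> approximable mu A phi.
Proof.
move=> l0 mul Ab Ac Aa Am uA u01 cu utt upos.
apply: (@approximable_generated _ _ _ mu A Ab Ac Aa Am (@RGenInftyO.G R)).
  by rewrite RGenInftyO.measurableE.
have aeD (P : R -> Prop) : (forall x, `]0, l[%classic x -> P x) -> {ae mu, forall x, P x}.
  move=> h; exists (~` `]0, l[); split => //; first exact: measurableC.
  by move=> x /= hx hx'; apply: hx; exact: h.
have sameD E F : approximable_set mu A E -> measurable F ->
    (forall x, `]0, l[%classic x -> E x <-> F x) -> approximable_set mu A F.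
  move=> [mE hE] mF EF; split => //.
  apply: (@bounded_approximable_cvg _ _ _ mu A Ab (fun=> \1_E) _ 1) => //.
  - by move=> _ x; rewrite indicE; case: (x \in E); rewrite ?normr1 ?normr0.
  - apply: aeD => x /EF xEF; rewrite !indicE.
    rewrite (_ : (x \in E) = (x \in F)); first exact: cvg_cst.
    by apply/idP/idP => /set_mem/xEF/mem_set.
  - exact: bounded_mfun_indic.
have hT : approximable_set mu A setT.
  rewrite -setC0; apply: approximable_setC => //.
  by have [] := approximable_sigma_algebra mu Ab Ac Aa Am.
move=> _ [a ->].
have [a0|a0] := leP a 0.
  have [h0 _ _] := approximable_sigma_algebra mu Ab Ac Aa Am.
  apply: (sameD set0) => // x; rewrite /= !in_itv/= => /andP[x0 _]; split => // xa.
  by have := lt_trans x0 (lt_le_trans xa a0); rewrite ltxx.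
have [la|al] := leP l a.
  apply: (sameD setT) => // x; rewrite /= !in_itv/= => /andP[x0 xl]; split => // _.
  exact: lt_le_trans xl la.
pose s i : R := Num.max a (Num.min l (ratr (odflt 0%Q (unpickle i)))).
have sK i : a <= s i <= l.
  by rewrite /s le_max lexx/= ge_max (ltW al)/= ge_min lexx.
pose E n i := [set t | u (s i) t < n.+1%:R^-1].
have hEn n i : approximable_set mu A (E n i).
  apply: approximable_threshold => //; exact: A_bounded_approximable.
pose S n := \bigcap_i ~` E n i.
have hS n : approximable_set mu A (S n).
  by apply: approximable_bigcap => // i; exact: approximable_setC.
have hU : approximable_set mu A (~` \bigcap_n ~` S n).
  apply: approximable_setC => //; apply: approximable_bigcap => // n.
  exact: approximable_setC.
apply: sameD hU _ _ => // t; rewrite /= !in_itv/= => /andP[t0 tl]; split; last first.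
  move=> ta H.
  have [m mI hm] := EVT_min (ltW al) (continuous_subspaceT (cu t)).
  move: mI; rewrite in_itv/= => /andP[am ml].
  have um : 0 < u m t by apply: upos => //; rewrite t0/= (lt_le_trans ta).
  have [n hn] : exists n : nat, n.+1%:R^-1 < u m t.
    exists (Num.truncn (u m t)^-1); rewrite invf_plt ?posrE ?ltr0n//.
    exact: truncnS_gt.
  apply: (H n) => // i _ /=; apply/negP; rewrite -leNgt ltW//.
  by apply: lt_le_trans hn _; apply: hm; rewrite in_itv/= sK.
move=> H; rewrite ltNge; apply/negP => ta.
apply: H => n _ /= hSn.
have := cu t t; move=> /cvgrPdist_lt/(_ n.+1%:R^-1).
rewrite invr_gt0 ltr0n => /(_ isT)[d /= d0 hd].
have dd : t - d < t + d by rewrite ltrBlDr -addrA ltrDl addr_gt0.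
have [r] := rat_in_itvoo dd; rewrite in_itv/= => /andP[r1 r2].
pose i := pickle r.
apply: (hSn i) => //=; rewrite /E/=.
have := hd (s i); rewrite utt sub0r normrN /ball_/= => /(_ _)/ltr_normlW; apply.
rewrite /s /i pickleK/=.
have : `|t - ratr r| < d by rewrite ltr_norml; apply/andP; split; lra.
apply: le_lt_trans; rewrite /Num.max /Num.min.
case: (ltP l (ratr r)) => h2; case: ltP => h1; case: (ger0P (t - ratr r)) => h3;
  by try (case: ger0P => h4); lra.
Qed.

(** * The energy of the logarithmic kernel *)

Section LogSeries.
Context (R : realType).

Definition log_partial (M : nat) (c : R) : R := \sum_(i < M) i.+1%:R^-1 * c ^+ i.+1.

Lemma is_derive_log_remainder (M : nat) (x : R) : x < 1 ->
  is_derive x 1 (fun c => - ln (1 - c) - log_partial M c) (x ^+ M / (1 - x)).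
Proof.
move=> x1; have x1' : 0 < 1 - x by rewrite subr_gt0.
elim: M => [|M IHM].
  rewrite (_ : (fun c => _) = (fun c => - ln (1 - c))); last first.
    by apply/funext => c; rewrite /log_partial big_ord0 subr0.
  have h := is_derive1_ln x1'.
  have h2 : is_derive x (1 : R) (fun c : R => 1 - c) (-1).
    by apply: is_derive_eq; rewrite add0r mul1r.
  have h3 := @is_derive1_comp _ (@ln R) (fun c => 1 - c) x _ _ h h2.
  apply: is_derive_eq; rewrite expr0.
  by rewrite mulrN1 opprK mul1r.
rewrite (_ : (fun c => _) = (fun c => (- ln (1 - c) - log_partial M c)
    - M.+1%:R^-1 * c ^+ M.+1)); last first.
  by apply/funext => c; rewrite /log_partial big_ord_recr/= opprD addrA.
have hX : is_derive x 1 (fun c : R => M.+1%:R^-1 * c ^+ M.+1) (x ^+ M).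
  rewrite (_ : (fun c => _) = M.+1%:R^-1 \*: (@idfun R ^+ M.+1)); last first.
    by apply/funext => c; rewrite exprfctE.
  apply: is_derive_eq; rewrite /GRing.scale/= mulr1 mulrA mulVf ?pnatr_eq0//.
  by rewrite mul1r.
apply: is_derive_eq; rewrite exprS.
by field; rewrite gt_eqF.
Qed.

(** The derivative of the remainder lies between [0] and [c ^+ M / (1 - c)] on the
   interval from [0] to [c]. *)
Lemma log_partial_bounds (M : nat) (c : R) : 0 <= c < 1 ->
  0 <= - ln (1 - c) - log_partial M c <= c ^+ M / (1 - c).
Proof.
move=> /andP[c0 c1]; have c1' : 0 < 1 - c by rewrite subr_gt0.
pose phi (x : R) := - ln (1 - x) - log_partial M x.
have phi0 : phi 0 = 0.
  rewrite /phi subr0 ln1 oppr0 sub0r /log_partial big1 ?oppr0// => i _.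
  by rewrite expr0n mulr0.
rewrite -/(phi c).
have [->|cN0] := eqVneq c 0.
  by rewrite phi0 lexx/= subr0 divr1 exprn_ge0.
have cp : 0 < c by rewrite lt_def cN0.
have dphi (x : R) : x < 1 -> is_derive x 1 phi (x ^+ M / (1 - x)).
  exact: is_derive_log_remainder.
have [||x] := @MVT _ phi (fun x => x ^+ M / (1 - x)) 0 c cp.
- by move=> x; rewrite in_itv/= => /andP[_ xc]; apply: dphi; exact: lt_trans xc c1.
- apply: derivable_within_continuous => x; rewrite in_itv/= => /andP[_ xc].
  by have [] := dphi x (le_lt_trans xc c1).
rewrite in_itv/= => /andP[x0 xc]; rewrite phi0 !subr0 => ->.
have x1 : 0 < 1 - x by rewrite subr_gt0 (lt_trans xc).
apply/andP; split.
  by rewrite mulr_ge0 ?divr_ge0 ?exprn_ge0 ?ltW.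
rewrite -[leRHS]mulr1 ler_pM ?divr_ge0 ?exprn_ge0 ?(ltW x0) ?(ltW x1)// ?(ltW c1)//.
rewrite ler_pM ?exprn_ge0 ?invr_ge0 ?(ltW x0) ?(ltW x1)//.
  by rewrite lerXn2r ?nnegrE ?ltW.
by rewrite lef_pV2 ?posrE// lerD2l lerN2 ltW.
Qed.

Lemma log_partial_cvg (c : R) : 0 <= c < 1 ->
  log_partial M c @[M --> \oo] --> - ln (1 - c).
Proof.
move=> c01; have /andP[c0 c1] := c01.
have c1' : 0 < 1 - c by rewrite subr_gt0.
have lim : c ^+ M / (1 - c) @[M --> \oo] --> (0 : R).
  rewrite -[X in _ --> X](mul0r (1 - c)^-1); apply: cvgMl; apply: cvg_expr.
  by rewrite ger0_norm.
apply/cvgrPdist_lt => eps eps0; move/cvgr0Pnorm_lt : lim => /(_ _ eps0).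
apply: filterS => M /ltr_normlW; apply: le_lt_trans.
by have /andP[h1 h2] := log_partial_bounds M c01; rewrite ger0_norm.
Qed.

End LogSeries.

Section Energy.
Context d (T : measurableType d) (R : realType).
Variable mu : {finite_measure set T -> \bar R}.
Local Notation mu2 := (mu \x mu)%E.
Variable zeta : 'I_4 -> T -> R.
Hypothesis zeta_bounded : forall i, bounded_mfun (zeta i).
Implicit Types (f : T -> R) (w : seq 'I_4).

(** The values of [zeta] are meant to be points of a sphere, and [1 - corr] is
   half the squared distance of two of them. *)
Definition corr (z : T * T) : R := \sum_i zeta i z.1 * zeta i z.2.
(** Monomials in the [zeta i]: [corr ^+ m] is the sum over the words of length
   [m] of the products of their values at the two points. *)
Definition word w (x : T) : R := \prod_(i <- w) zeta i x.

Hypothesis corr01 : forall z, 0 <= corr z <= 1.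

Let bss h : bounded_mfun h -> square_summable mu h.
Proof. exact: bounded_mfun_square_summable. Qed.

Lemma bounded_word w : bounded_mfun (word w).
Proof.
rewrite /word; elim: w => [|i w IHw].
  by under eq_fun do rewrite big_nil; exact: bounded_mfun_cst.
by under eq_fun do rewrite big_cons; exact: bounded_mfunM.
Qed.

Lemma bounded_schur (K : T * T -> R) (B : R) : measurable_fun setT K -> (forall z, `|K z| <= B) ->
  schur mu (B * fine (mu setT)) K.
Proof.
move=> mK KB; have fmu : mu setT \is a fin_num by exact: fin_num_measure.
have h (g : T -> R) : measurable_fun setT g -> (forall y, `|g y| <= B) ->
    (\int[mu]_y `|g y|%:E <= (B * fine (mu setT))%:E)%E.
  move=> mg gB; rewrite EFinM fineK// -integral_cst//.
  apply: ge0_le_integral => //.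
  - by apply/measurable_EFinP; exact: measurableT_comp.
  - by move=> y _; rewrite lee_fin.
by split => // x; apply: h => //; exact: measurableT_comp.
Qed.

Lemma measurable_corr : measurable_fun setT corr.
Proof.
apply: measurable_sum => i; have [mz _] := zeta_bounded i.
by apply: measurable_funM; [exact: measurable_fst_comp|exact: measurable_snd_comp].
Qed.

Lemma schur_corrX m : schur mu (1 * fine (mu setT)) (fun z => corr z ^+ m).
Proof.
apply: bounded_schur; first by apply: measurable_funX; exact: measurable_corr.
move=> z; have /andP[c0 c1] := corr01 z.
by rewrite ger0_norm ?exprn_ge0// exprn_ile1.
Qed.

Lemma form_fst q f : bounded_mfun q -> bounded_mfun f ->
  form mu (fun z => q z.1) f f = total mu f * total mu (fun x => q x * f x).
Proof.
move=> bq bf; have [mq [B qB]] := bq.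
have sq : schur mu (B * fine (mu setT)) (fun z : T * T => q z.1).
  by apply: bounded_schur => //; exact: measurable_fst_comp.
rewrite (form_apply sq (bss bf) (bss bf)).
have -> : apply_at mu (fun z => q z.1) f = (fun x => total mu f * q x).
  apply/funext => x; rewrite /apply_at/= totalZ; first by rewrite mulrC.
  exact: bounded_mfun_summable1.
rewrite /inner -totalZ; last exact/bounded_mfun_summable1/bounded_mfunM.
by congr total; apply/funext => x; rewrite mulrA.
Qed.

Lemma form_snd q f : bounded_mfun q -> bounded_mfun f ->
  form mu (fun z => q z.2) f f = total mu f * total mu (fun x => q x * f x).
Proof.
move=> bq bf; have [mq [B qB]] := bq.
have sq : schur mu (B * fine (mu setT)) (fun z : T * T => q z.2).
  by apply: bounded_schur => //; exact: measurable_snd_comp.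
rewrite (form_apply sq (bss bf) (bss bf)).
have -> : apply_at mu (fun z => q z.2) f = (fun x => total mu (fun y => q y * f y)) by [].
by rewrite /inner (totalZ _ (bounded_mfun_summable1 mu bf)) mulrC.
Qed.

Lemma form_corrS m f : bounded_mfun f ->
  form mu (fun z => corr z ^+ m.+1) f f =
  \sum_i form mu (fun z => corr z ^+ m) (fun x => zeta i x * f x) (fun x => zeta i x * f x).
Proof.
move=> bf; rewrite /form -total_sum; last first.
  move=> i; have sz := bss (bounded_mfunM (zeta_bounded i) bf).
  exact: (schur_summable1 (schur_corrX m) sz sz).
congr total; apply/funext => z; rewrite exprSr {2}/corr mulr_sumr mulr_suml.
by apply: eq_bigr => i _; ring.
Qed.

Lemma form_corr0 f : bounded_mfun f ->
  form mu (fun z => corr z ^+ 0) f f = total mu f ^+ 2.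
Proof.
move=> bf; under [X in form _ X]eq_fun do rewrite expr0.
rewrite (@form_fst (fun=> 1))//; last exact: bounded_mfun_cst.
by rewrite expr2; congr (_ * total _ _); apply/funext => x; rewrite mul1r.
Qed.

Lemma form_corr_ge0 m f : bounded_mfun f -> 0 <= form mu (fun z => corr z ^+ m) f f.
Proof.
elim: m f => [|m IHm] f bf; first by rewrite form_corr0// sqr_ge0.
by rewrite form_corrS// sumr_ge0// => i _; apply: IHm; exact: bounded_mfunM.
Qed.

(** The words other than [w] contribute squares of moments as well. *)
Lemma form_corr_ge_word w f : bounded_mfun f ->
  total mu (fun x => word w x * f x) ^+ 2 <= form mu (fun z => corr z ^+ size w) f f.
Proof.
elim: w f => [|i w IHw] f bf.
  rewrite form_corr0// (_ : (fun x => _) = f)//.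
  by apply/funext => x; rewrite /word big_nil mul1r.
rewrite form_corrS// (bigD1 i)//= -[leLHS]addr0 lerD//.
  rewrite (_ : (fun x => _) = (fun x => word w x * (zeta i x * f x))).
    by apply: IHw; exact: bounded_mfunM.
  by apply/funext => x; rewrite /word big_cons; ring.
by rewrite sumr_ge0// => j _; apply: form_corr_ge0; exact: bounded_mfunM.
Qed.

Variables (V : T * T -> R) (C : R).
Hypothesis V_schur : schur mu C V.
Variables (q : T -> R) (kappa : R).
Hypothesis q_bounded : bounded_mfun q.
Hypothesis kappa_gt0 : 0 < kappa.
Hypothesis V_log : {ae mu2, forall z, corr z < 1 /\
  V z = kappa * (- ln (1 - corr z) - q z.1 - q z.2)}.

(** Expanding [- ln (1 - c)] in powers of the correlation [c] displays the
   energy as a sum of nonnegative terms; the summands depending on one variable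
   only do not see densities of mean zero. *)
Lemma energy_ge m f : bounded_mfun f -> total mu f = 0 ->
  form mu (fun z => corr z ^+ m.+1) f f <= m.+1%:R / kappa * form mu V f f.
Proof.
move=> bf tf.
have sf := bss bf.
pose F (z : T * T) := f z.2 * f z.1.
have [mf [B fB]] := bf.
have mF : measurable_fun setT F.
  by apply: measurable_funM; [exact: measurable_snd_comp|exact: measurable_fst_comp].
have [mq [Bq qB]] := q_bounded.
pose W z := kappa^-1 * V z + q z.1 + q z.2.
have sq1 : schur mu (Bq * fine (mu setT)) (fun z : T * T => q z.1).
  by apply: bounded_schur => //; exact: measurable_fst_comp.
have sq2 : schur mu (Bq * fine (mu setT)) (fun z : T * T => q z.2).
  by apply: bounded_schur => //; exact: measurable_snd_comp.
have sV := schur_summable1 V_schur sf sf.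
have s1 := schur_summable1 sq1 sf sf.
have s2 := schur_summable1 sq2 sf sf.
have sW : summable1 mu2 (fun z => W z * F z).
  have := summable1D (summable1D (summable1Z kappa^-1 sV) s1) s2.
  congr summable1; apply/funext => z; rewrite /W /F; ring.
have formW : total mu2 (fun z => W z * F z) = kappa^-1 * form mu V f f.
  have := form_fst q_bounded bf; have := form_snd q_bounded bf; rewrite tf !mul0r => h2 h1.
  rewrite (_ : (fun z => _) = (fun z => (kappa^-1 * (V z * F z) + q z.1 * F z) + q z.2 * F z)).
    rewrite totalD; [|exact: summable1D (summable1Z _ sV) s1|exact: s2].
    rewrite totalD; [|exact: summable1Z _ sV|exact: s1].
    by rewrite totalZ// -/(form mu V f f) [X in _ + X + _]h1 [X in _ + X]h2 !addr0.
  by apply/funext => z; rewrite /W; ring.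
have mW : measurable_fun setT W.
  have [mV _ _] := V_schur; apply: measurable_funD; last exact: measurable_snd_comp.
  apply: measurable_funD; last exact: measurable_fst_comp.
  exact: measurable_funM.
have mP M : measurable_fun setT (fun z => log_partial M (corr z)).
  apply: measurable_sum => i; apply: measurable_funM => //.
  by apply: measurable_funX; exact: measurable_corr.
have lim : total mu2 (fun z => log_partial M (corr z) * F z) @[M --> \oo] -->
    total mu2 (fun z => W z * F z).
  apply: (@total_dominated _ _ _ _ _ _ (fun z => `|W z * F z|)).
  - by move=> M; exact: measurable_funM.
  - exact: measurable_funM.
  - exact: integrable_norm sW.
  - apply: filterS V_log => z [c1 Vz] M; rewrite !normrM ler_wpM2r//.
    have -> : W z = - ln (1 - corr z).
      by rewrite /W Vz; field; exact: lt0r_neq0.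
    have /andP[c0 _] := corr01 z.
    have := log_partial_bounds M (_ : 0 <= corr z < 1); rewrite c0 c1 => /(_ isT)/andP[h _].
    rewrite ger0_norm; last first.
      by apply: sumr_ge0 => i _; rewrite mulr_ge0 ?exprn_ge0.
    by rewrite (le_trans _ (ler_norm _))// -subr_ge0.
  - apply: filterS V_log => z [c1 Vz]; apply: cvgMl.
    have -> : W z = - ln (1 - corr z).
      by rewrite /W Vz; field; exact: lt0r_neq0.
    by apply: log_partial_cvg; have /andP[-> _] := corr01 z.
have sC i : summable1 mu2 (fun z => corr z ^+ i * F z).
  exact: (schur_summable1 (schur_corrX i) sf sf).
have PE M : total mu2 (fun z => log_partial M (corr z) * F z) =
    \sum_(i < M) i.+1%:R^-1 * form mu (fun z => corr z ^+ i.+1) f f.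
  rewrite (_ : (fun z => _) = (fun z => \sum_(i < M) i.+1%:R^-1 * (corr z ^+ i.+1 * F z))).
    rewrite total_sum; last by move=> i; exact: summable1Z.
    by apply: eq_bigr => i _; rewrite totalZ.
  by apply/funext => z; rewrite mulr_suml; apply: eq_bigr => i _; rewrite -mulrA.
have : m.+1%:R^-1 * form mu (fun z => corr z ^+ m.+1) f f <= kappa^-1 * form mu V f f.
  rewrite -formW -(cvg_lim _ lim)//; apply: limr_ge.
    by apply/cvg_ex; eexists; exact: lim.
  exists m.+1 => // M /= mM.
  rewrite PE (bigD1 (Ordinal mM))//= lerDl sumr_ge0// => i _.
  by rewrite mulr_ge0//; exact: form_corr_ge0.
by rewrite -mulrA ler_pdivrMl.
Qed.

Definition word_algebra : set (T -> R) :=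
  [set a | exists s : seq (R * seq 'I_4), a = fun x => \sum_(cw <- s) cw.1 * word cw.2 x].

Lemma word_algebra_bounded a : word_algebra a -> bounded_mfun a.
Proof.
move=> [s ->]; apply: bounded_mfun_sum => cw; apply: bounded_mfunZ.
exact: bounded_word.
Qed.

Lemma word_algebra_cst c : word_algebra (fun=> c).
Proof.
exists [:: (c, [::])]; apply/funext => x.
by rewrite big_seq1/= /word big_nil mulr1.
Qed.

Lemma word_algebraD a b : word_algebra a -> word_algebra b ->
  word_algebra (fun x => a x + b x).
Proof.
by move=> [s ->] [t ->]; exists (s ++ t); apply/funext => x; rewrite big_cat.
Qed.

Lemma word_algebraM a b : word_algebra a -> word_algebra b ->
  word_algebra (fun x => a x * b x).
Proof.
move=> [s ->] [t ->].
exists [seq (p.1.1 * p.2.1, p.1.2 ++ p.2.2) | p <- [seq (p1, p2) | p1 <- s, p2 <- t]].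
apply/funext => x; rewrite big_map big_allpairs/= mulr_suml.
apply: eq_bigr => p1 _; rewrite mulr_sumr; apply: eq_bigr => p2 _ /=.
by rewrite /word big_cat/=; ring.
Qed.

Lemma word_algebra_zeta c i : word_algebra (fun x => c * zeta i x).
Proof.
exists [:: (c, [:: i])]; apply/funext => x.
by rewrite big_seq1/= /word big_seq1.
Qed.

Hypothesis dense : forall phi, square_summable mu phi -> approximable mu word_algebra phi.

(** Vanishing energy kills all moments of positive length, hence, by density,
   every weak limit. *)
Lemma energy_weak (f : nat -> T -> R) :
  (forall m, bounded_mfun (f m)) -> (forall m, total mu (f m) = 0) ->
  (exists B, forall m, inner mu (f m) (f m) <= B) ->
  form mu V (f m) (f m) @[m --> \oo] --> 0 ->
  forall phi, square_summable mu phi -> inner mu (f m) phi @[m --> \oo] --> 0.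
Proof.
move=> bf tf [B fB] lim phi sphi.
have B0 : 0 <= B by exact: le_trans (inner_ge0 mu (f 0%N)) (fB 0%N).
have hw w : total mu (fun x => word w x * f m x) @[m --> \oo] --> 0.
  case: w => [|i w].
    rewrite (_ : (fun m => _) = fun=> 0); first exact: cvg_cst.
    apply/funext => m; rewrite -[RHS](tf m); congr total.
    by apply/funext => x; rewrite /word big_nil mul1r.
  apply/cvgr0Pnorm_lt => eps eps0.
  have lim' : (size w).+1%:R / kappa * form mu V (f m) (f m) @[m --> \oo] --> 0.
    by rewrite -[X in _ --> X](mulr0 ((size w).+1%:R / kappa)); apply: cvgMr.
  move/cvgr0Pnorm_lt : lim' => /(_ _ (exprn_gt0 2 eps0)); apply: filterS => m /ltr_normlW h.
  rewrite -(ltr_pXn2r (_ : 0 < 2)%N) ?nnegrE ?(ltW eps0)// real_normK ?num_real//.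
  apply: le_lt_trans h; apply: (le_trans (form_corr_ge_word (i :: w) (bf m))).
  exact: energy_ge.
have ha a : word_algebra a -> inner mu (f m) a @[m --> \oo] --> 0.
  move=> [s ->]; elim: s => [|cw s IHs].
    rewrite (_ : (fun m => _) = fun=> 0); first exact: cvg_cst.
    apply/funext => m; rewrite /inner -[RHS](total0 mu); congr total.
    by apply/funext => x; rewrite big_nil mulr0.
  rewrite (_ : (fun m => _) = (fun m => cw.1 * total mu (fun x => word cw.2 x * f m x) +
     inner mu (f m) (fun x => \sum_(cw <- s) cw.1 * word cw.2 x))).
    rewrite -[X in _ --> X](addr0 0); apply: cvgD => //.
    by rewrite -[X in _ --> X](mulr0 cw.1); apply: cvgMr.
  apply/funext => m; have bw := bounded_word cw.2.
  rewrite -totalZ -?totalD.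
  - by congr total; apply/funext => x; rewrite big_cons; ring.
  - exact/summable1Z/bounded_mfun_summable1/bounded_mfunM.
  - apply/bounded_mfun_summable1/bounded_mfunM => //.
    by apply: word_algebra_bounded; exists s.
  - exact/bounded_mfun_summable1/bounded_mfunM.
apply/cvgr0Pnorm_lt => eps eps0.
have B1 : 0 < 4 * (B + 1) by rewrite mulr_gt0// ltr_wpDl.
have [a Aa hphi] := dense sphi (divr_gt0 (exprn_gt0 2 eps0) B1).
have e2 : 0 < eps / 2 by rewrite divr_gt0.
move/cvgr0Pnorm_lt : (ha a Aa) => /(_ _ e2); apply: filterS => m hm.
have sa := bss (word_algebra_bounded Aa).
have -> : inner mu (f m) phi = inner mu (f m) a + inner mu (f m) (fun x => phi x - a x).
  by rewrite innerBr ?subrKC//; exact: bss.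
rewrite (le_lt_trans (ler_normD _ _))// [ltRHS](splitr eps) ltr_leD//.
rewrite -(ler_pXn2r (_ : 0 < 2)%N) ?nnegrE ?(ltW e2)// real_normK ?num_real//.
apply: (le_trans (CauchySchwarz (bss (bf m)) (square_summableB sphi sa))).
apply: (@le_trans _ _ ((B + 1) * (eps ^+ 2 / (4 * (B + 1))))).
  apply: ler_pM; rewrite ?inner_ge0 ?(ltW hphi)//.
  by rewrite (le_trans (fB m))// lerDl.
rewrite le_eqVlt; apply/orP; left; apply/eqP; field.
by rewrite gt_eqF// ltr_wpDl.
Qed.

End Energy.

(** * Integration over a period *)

Section PeriodMeasure.
Context {R : realType}.
Local Notation leb := (@lebesgue_measure R).
Local Notation l := (2 * pi : R).

Lemma period_gt0 : 0 < l. Proof. by rewrite mulr_gt0// pi_gt0. Qed.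

Lemma measurable_period : measurable (period : set (measurableTypeR R)).
Proof. exact: measurable_itv. Qed.

Lemma period_finite : (leb (period : set (measurableTypeR R)) < +oo)%E.
Proof. by rewrite lebesgue_measure_itv/=; case: ifP => _; rewrite ?ltry// -EFinB ltry. Qed.

Definition period_measure : {finite_measure set (measurableTypeR R) -> \bar R} :=
  mfrestr measurable_period period_finite.
Local Notation mu := period_measure.

Lemma ge0_integral_period (f : R -> \bar R) :
  measurable_fun setT (f : measurableTypeR R -> \bar R) -> (forall t, (0 <= f t)%E) ->
  (\int[mu]_t f t = \int[leb]_(t in period) f t)%E.
Proof.
move=> mf f0.
have -> : (\int[leb]_(t in period) f t = \int[mu]_(t in period) f t)%E.
  by apply: eq_measure_integral => A mA AD; change (leb A = leb (A `&` period)); rewrite setIidl.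
rewrite (@ge0_negligible_integral _ _ _ mu setT (~` period)) ?setTD ?setCK//.
- by apply: measurableC; exact: measurable_period.
- by change (leb ((~` period) `&` period) = 0%E); rewrite setICl measure0.
Qed.

Lemma integral_period (f : R -> \bar R) :
  measurable_fun setT (f : measurableTypeR R -> \bar R) ->
  (\int[mu]_t f t = \int[leb]_(t in period) f t)%E.
Proof.
move=> mf; rewrite integralE [RHS]integralE !ge0_integral_period//.
- exact: measurable_funeneg.
- exact: measurable_funepos.
Qed.

Lemma integral_shift (D : set R) (f : R -> \bar R) (a : R) :
  measurable (D : set (measurableTypeR R)) ->
  measurable_fun setT (f : measurableTypeR R -> \bar R) -> (forall t, (0 <= f t)%E) ->
  (\int[leb]_(t in D) f t = \int[leb]_(t in [set t : R | D (t + a)%R]) f (t + a)%R)%E.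
Proof.
move=> mD mf f0; pose phi (t : measurableTypeR R) : measurableTypeR R := t + a.
have mphi : measurable_fun setT phi by exact: measurable_funD.
rewrite -[RHS](@ge0_integral_pushforward _ _ _ _ _ phi mphi leb D f)//; last exact: measurable_funTS.
apply: eq_measure_integral => A mA _.
apply: (@lebesgue_measure_unique R (pushforward leb phi)) => //= _ [[x y] _ <-].
rewrite /pushforward (_ : phi @^-1` _ = `]x - a, y - a]%classic).
  by rewrite !lebesgue_measure_itv/= !lte_fin ltrD2r; case: ifP => // _; rewrite -!EFinB; congr EFin; ring.
by apply/seteqP; split => t; rewrite /phi/= !in_itv/= ltrBlDr lerBrDr.
Qed.

Definition periodic2pi (S : Type) (f : R -> S) := forall t, f (t + l) = f t.

(** The part of the period that the translation moves beyond its end is put back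
   at its beginning. *)
Lemma ge0_integral_period_shift (f : R -> \bar R) (a : R) :
  measurable_fun setT (f : measurableTypeR R -> \bar R) -> (forall t, (0 <= f t)%E) ->
  periodic2pi f -> (\int[mu]_t f (t + a)%R = \int[mu]_t f t)%E.
Proof.
move=> mf f0 pf.
have pfn (n : nat) t : f (t + n%:R * l) = f t.
  elim: n => [|n IHn]; first by rewrite mul0r addr0.
  by rewrite -natr1 mulrDl mul1r addrA pf IHn.
have pfz (z : int) t : f (t + z%:~R * l) = f t.
  case: z => n; first exact: pfn.
  by rewrite NegzE mulrNz mulNr -(pfn n.+1 (t - _)) subrK.
have main b : 0 <= b < l -> (\int[mu]_t f (t + b)%R = \int[mu]_t f t)%E.
  move=> /andP[b0 bl].
  have mfb : measurable_fun setT (fun t : measurableTypeR R => f (t + b)).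
    by apply: measurableT_comp => //; exact: measurable_funD.
  rewrite !ge0_integral_period// /period.
  rewrite -(@integral_itv_bndoo R 0 l _ false false); last exact: measurable_funTS.
  rewrite -[RHS](@integral_itv_bndoo R 0 l _ false false); last exact: measurable_funTS.
  transitivity (\int[leb]_(t in `]b, (l + b)%R]) f t)%E.
    rewrite (_ : `]0, l]%classic = [set t : R | `]b, (l + b)%R]%classic (t + b)%R]).
      by rewrite -(integral_shift b).
    by apply/seteqP; split => t; rewrite /= !in_itv/= ltrDr lerD2r.
  have -> : `]b, l + b]%classic = `]b, l] `|` `]l, l + b] :> set R.
    rewrite -itv_bndbnd_setU// bnd_simp ?(ltW bl)//.
    by rewrite lerDl.
  rewrite ge0_integral_setU//=; last 2 first.
  - exact: measurable_funTS.
  - rewrite disj_set2E; apply/eqP; rewrite -subset0 => t [] /=.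
    by rewrite !in_itv/= => /andP[_ h1] /andP[h2 _]; move: (lt_le_trans h2 h1); rewrite ltxx.
  rewrite [X in (_ + X)%E](integral_shift l)//.
  have -> : [set t | `]l, l + b]%classic (t + l)] = `]0, b]%classic.
    by apply/seteqP; split => t; rewrite /= !in_itv/= ltrDr (addrC l b) lerD2r.
  under [X in (_ + X)%E]eq_integral do rewrite pf.
  rewrite addeC -ge0_integral_setU//=.
  - by rewrite -itv_bndbnd_setU// bnd_simp// ltW.
  - exact: measurable_funTS.
  - rewrite disj_set2E; apply/eqP; rewrite -subset0 => t [] /=.
    by rewrite !in_itv/= => /andP[_ h1] /andP[h2 _]; move: (lt_le_trans h2 h1); rewrite ltxx.
pose z := Num.floor (a / l).
have l0 := period_gt0.
have hz : 0 <= a - z%:~R * l < l.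
  rewrite subr_ge0 -ler_pdivlMr// floor_le/= ltrBlDl.
  rewrite -[X in _ + X]mul1r -mulrDl -ltr_pdivrMr// -[X in _ + X]/(1%:~R) -intrD.
  exact: floorD1_gt.
rewrite -(main _ hz).
by apply: eq_integral => t _; rewrite addrA -[in RHS](pfz z) subrK.
Qed.

Lemma integral_period_shift (f : R -> \bar R) (a : R) :
  measurable_fun setT (f : measurableTypeR R -> \bar R) -> periodic2pi f ->
  (\int[mu]_t f (t + a)%R = \int[mu]_t f t)%E.
Proof.
move=> mf pf; rewrite integralE [RHS]integralE.
have -> : ((fun t : R => f (t + a)%R)^\+)%E = (fun t : R => (f^\+)%E (t + a)%R).
  by apply/funext => t; rewrite !funeposE.
have -> : ((fun t : R => f (t + a)%R)^\-)%E = (fun t : R => (f^\-)%E (t + a)%R).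
  by apply/funext => t; rewrite !funenegE.
rewrite !ge0_integral_period_shift//.
- exact: measurable_funeneg.
- by move=> t; rewrite !funenegE pf.
- exact: measurable_funepos.
- by move=> t; rewrite !funeposE pf.
Qed.

Lemma total_shift (f : R -> R) (a : R) :
  measurable_fun setT (f : measurableTypeR R -> R) -> periodic2pi f ->
  total mu (fun t => f (t + a)) = total mu f.
Proof.
move=> mf pf; rewrite /total /Rintegral.
rewrite (@integral_period_shift (EFin \o f))//; first exact/measurable_EFinP.
by move=> t; rewrite /= pf.
Qed.

Lemma total_reflect (f : R -> R) :
  measurable_fun setT (f : measurableTypeR R -> R) -> periodic2pi f ->
  total mu (fun t => f (- t)) = total mu f.
Proof.
move=> mf pf; rewrite /total /Rintegral.
have ge0 (g : R -> \bar R) : measurable_fun setT (g : measurableTypeR R -> \bar R) ->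
    (forall t, (0 <= g t)%E) -> periodic2pi g ->
    (\int[mu]_t g (- t)%R = \int[mu]_t g t)%E.
  move=> mg g0 pg.
  have mgN : measurable_fun setT (fun t : measurableTypeR R => g (- t)).
    exact: measurableT_comp.
  rewrite !ge0_integral_period//.
  pose phi (t : measurableTypeR R) : measurableTypeR R := - t.
  have mphi : measurable_fun setT phi by exact: (@measurableT_comp _ _ _ _ _ _ (-%R : R -> R) _ id).
  transitivity (\int[leb]_(t in `](- l)%R, 0%R[) g t)%E.
    rewrite (_ : period = phi @^-1` `]- l, 0[); last first.
      by rewrite opp_preimage_itvbndbnd oppr0 opprK.
    rewrite -[LHS](@ge0_integral_pushforward _ _ _ _ _ phi mphi leb `]- l, 0[ g)//; last first.
      exact: measurable_funTS.
    by apply: eq_measure_integral => A mA _; exact: lebesgue_measureN.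
  apply/esym; apply: (eq_trans (integral_shift l measurable_period mg g0)).
  rewrite [X in integral _ X _](_ : _ = `](- l)%R, 0%R[%classic).
    by apply: eq_integral => t _; rewrite pg.
  by apply/seteqP; split => t; rewrite /period/= !in_itv/= -ltrBlDr sub0r gtrDr.
congr fine; rewrite integralE [RHS]integralE.
have -> : ((fun t : R => (f (- t))%:E)^\+)%E = (fun t : R => ((EFin \o f)^\+)%E (- t)%R).
  by apply/funext => t; rewrite !funeposE.
have -> : ((fun t : R => (f (- t))%:E)^\-)%E = (fun t : R => ((EFin \o f)^\-)%E (- t)%R).
  by apply/funext => t; rewrite !funenegE.
rewrite !ge0//.
- by apply: measurable_funeneg; exact/measurable_EFinP.
- by move=> t; rewrite !funenegE/= pf.
- by apply: measurable_funepos; exact/measurable_EFinP.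
- by move=> t; rewrite !funeposE/= pf.
Qed.

End PeriodMeasure.

(** * Integrals of derivatives over a period, up to integrable singularities *)

Section ImproperFTC.
Context {R : realType}.
Local Notation leb := (@lebesgue_measure R).
Local Notation l := (2 * pi : R).
Local Notation mu := (@period_measure R).

(** Inside the interval the indefinite integral and [F] have the same increments,
   and both are continuous up to the end points. *)
Lemma FTC_open (f F : R -> R) (a b : R) : a < b ->
  leb.-integrable `[a, b] (EFin \o f) ->
  {within `[a, b], continuous F} ->
  (forall x, a < x < b -> is_derive x 1 F (f x)) ->
  (forall x, a < x < b -> {for x, continuous f}) ->
  \int[leb]_(x in `[a, b]) f x = F b - F a.
Proof.
move=> ab intf cF dF cf.
pose G x := \int[leb]_(t in `[a, x]) f t.
have cG : {within `[a, b], continuous G}.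
  exact: (parameterized_integral_continuous (ltW ab) intf).
have FG x y : a < x -> x < y -> y < b -> G y - G x = F y - F x.
  move=> ax xy yb.
  have sub : `[x, y] `<=` `]a, b[.
    move=> t /=; rewrite !in_itv/= => /andP[xt ty].
    by rewrite (lt_le_trans ax xt) (le_lt_trans ty yb).
  have h : (\int[leb]_(t in `[x, y]) (f t)%:E = (F y)%:E - (F x)%:E)%E.
    apply: continuous_FTC2 => //.
    - apply: continuous_in_subspaceT => t /set_mem /sub; rewrite /= in_itv/=.
      exact: cf.
    - have d t : t \in `[x, y] -> derivable F t 1.
        move=> txy; have := sub t txy; rewrite /= in_itv/= => /dF.
        by case.
      split.
      + by move=> t /subset_itv_oo_cc txy; apply: d.
      + apply: cvg_at_right_filter; apply: differentiable_continuous.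
        by apply/derivable1_diffP/d; rewrite in_itv/= lexx ltW.
      + apply: cvg_at_left_filter; apply: differentiable_continuous.
        by apply/derivable1_diffP/d; rewrite in_itv/= lexx ltW.
    - move=> t /subset_itv_oo_cc txy; have := sub t txy; rewrite /= in_itv/= => /dF.
      by move=> ?; rewrite derive1E derive_val.
  have Gy : leb.-integrable `[a, y] (EFin \o f).
    by apply: integrableS intf => //; apply: subset_itvl; rewrite bnd_simp ltW.
  rewrite /G Rintegral_itvB//; rewrite ?bnd_simp ?(ltW ax) ?(ltW xy)//.
  rewrite Rintegral_itv_obnd_cbnd; last first.
    by apply: integrableS Gy => //; apply: subset_itv; rewrite bnd_simp// ltW.
  by rewrite /Rintegral h.
have [/= G1 G2 G3] := (continuous_within_itvP G ab).1 cG.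
have [/= F1 F2 F3] := (continuous_within_itvP F ab).1 cF.
pose c := (a + b) / 2.
have ac : a < c by rewrite midf_lt.
have cb : c < b by rewrite midf_lt.
have Gc x : a < x < b -> G x - F x = G c - F c.
  move=> /andP[ax xb]; have [xc|cx|->//] := ltgtP x c.
    by have := FG x c ax xc cb; lra.
  by have := FG c x ac cx xb; lra.
have ea : G a - F a = G c - F c.
  apply: (@cvg_unique _ _ (G x - F x @[x --> a^'+])) => //.
    exact: cvgB.
  apply: cvg_near_cst; near=> x; apply: Gc; apply/andP; split.
    by near: x; exact: nbhs_right_gt.
  by near: x; exact: nbhs_right_lt.
have eb : G b - F b = G c - F c.
  apply: (@cvg_unique _ _ (G x - F x @[x --> b^'-])) => //.
    exact: cvgB.
  apply: cvg_near_cst; near=> x; apply: Gc; apply/andP; split.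
    by near: x; exact: nbhs_left_gt.
  by near: x; exact: nbhs_left_lt.
have Ga : G a = 0 by rewrite /G set_itv1 Rintegral_set1.
by move: ea eb; rewrite Ga -/(G b); lra.
Unshelve. all: by end_near. Qed.

Lemma total_derive (f F : R -> R) : summable1 mu f ->
  (forall x, {for x, continuous F}) ->
  (forall x, 0 < x < l -> is_derive x 1 F (f x)) ->
  (forall x, 0 < x < l -> {for x, continuous f}) ->
  total mu f = F l - F 0.
Proof.
move=> sf cF dF cf.
have mf := summable1_measurable sf.
have mEf : measurable_fun setT (EFin \o f : measurableTypeR R -> \bar R).
  exact/measurable_EFinP.
have intf : leb.-integrable `[0, l] (EFin \o f).
  apply/integrableP; split; first exact: measurable_funTS.
  rewrite (@integral_itv_bndoo R 0 l (fun x => `|(EFin \o f) x|)%E true false); last first.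
    by apply: measurable_funTS; exact: measurableT_comp.
  have /integrableP[_] := sf.
  rewrite ge0_integral_period//; exact: measurableT_comp.
rewrite -(FTC_open (period_gt0 (R := R)) intf) => //.
- rewrite /total /Rintegral integral_period//.
  congr fine; apply/esym; apply: (@integral_itv_bndoo R 0 l (EFin \o f) true false).
  exact: measurable_funTS.
- exact: continuous_subspaceT.
Qed.

(** Monotone convergence along the intervals from [l / n] to [l - l / n]. *)
Lemma ge0_bounded_primitive (g G : R -> R) (B : R) :
  measurable_fun setT (g : measurableTypeR R -> R) -> (forall x, 0 <= g x) ->
  (forall x, 0 < x < l -> is_derive x 1 G (g x)) ->
  (forall x, 0 < x < l -> {for x, continuous g}) -> 
  (forall x, 0 < x < l -> `|G x| <= B) ->
  summable1 mu g.
Proof.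
move=> mg g0 dG cg GB.
have l0 := period_gt0 (R := R).
apply/integrableP; split; first exact/measurable_EFinP.
have -> : (\int[mu]_x `|(EFin \o g) x|)%E = (\int[mu]_x (EFin \o g) x)%E.
  by apply: eq_integral => x _; rewrite /= ger0_norm.
rewrite ge0_integral_period//; last exact/measurable_EFinP.
pose I n := `[l / n.+3%:R, l - l / n.+3%:R]%classic : set R.
have In n : 0 < l / n.+3%:R < l / 2.
  by rewrite divr_gt0 ?ltr0n//= ltr_pM2l// ltf_pV2 ?posrE// ltr_nat.
apply: (@le_lt_trans _ _ (B + B)%:E); last exact: ltry.
have IU : period = \bigcup_n I n.
  apply/seteqP; split => x; rewrite /period/= in_itv/=.
    move=> /andP[x0 xl].
    pose n := Num.truncn (Num.max (l / x) (l / (l - x))).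
    exists n => //; rewrite /I/= in_itv/=.
    have hn : Num.max (l / x) (l / (l - x)) < n.+3%:R.
      by apply: (lt_trans (truncnS_gt _)); rewrite ltr_nat !ltnS leqnSn.
    move: hn; rewrite gt_max => /andP[h1 h2].
    have lx : 0 < l - x by rewrite subr_gt0.
    rewrite ltr_pdivrMr// in h1; rewrite ltr_pdivrMr// in h2.
    rewrite lerBrDr -lerBrDl !ler_pdivrMr ?ltr0n//.
    by rewrite !(mulrC _ n.+3%:R) (ltW h1) (ltW h2).
  move=> [n _]; rewrite /I/= in_itv/= => /andP[h1 h2].
  have /andP[h3 _] := In n; rewrite (lt_le_trans h3)//=.
  by rewrite (le_lt_trans h2)// ltrBlDr ltrDl.
rewrite IU.
have mI n : measurable (I n : set (measurableTypeR R)) by exact: measurable_itv.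
have ndI : nondecreasing_seq I.
  move=> n m nm; rewrite subsetEset => x; rewrite /I/= !in_itv/= => /andP[h1 h2].
  have h : l / m.+3%:R <= l / n.+3%:R.
    by rewrite ler_pM2l// lef_pV2 ?posrE ?ltr0n// ler_nat.
  by rewrite (le_trans h h1)/= (le_trans h2)// lerB.
have mg' n : measurable_fun (I n : set (measurableTypeR R)) (EFin \o g).
  by apply: measurable_funTS; exact/measurable_EFinP.
have g0' n x : I n x -> (0 <= (EFin \o g) x)%E by rewrite lee_fin.
have lim := ge0_nondecreasing_set_cvg_integral (mu := leb) ndI mI mg' g0'.
rewrite -(cvg_lim _ lim)//; apply: lime_le; first by apply/cvg_ex; eexists; exact: lim.
apply: nearW => n.
have /andP[h3 h4] := In n.
have ab : l / n.+3%:R < l - l / n.+3%:R by move: (l / n.+3%:R) h4 => y; lra.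
have sub x : l / n.+3%:R <= x <= l - l / n.+3%:R -> 0 < x < l.
  by move=> /andP[h1 h2]; rewrite (lt_le_trans h3 h1)/= (le_lt_trans h2)// ltrBlDr ltrDl.
have intg : leb.-integrable (I n) (EFin \o g).
  apply: continuous_compact_integrable; first exact: segment_compact.
  apply: continuous_in_subspaceT => x /set_mem; rewrite /I/= in_itv/= => /sub.
  exact: cg.
have := FTC_open ab intg _ _ _; rewrite /Rintegral => /(_ G) h.
rewrite -[X in (X <= _)%E]fineK; last exact: integrable_fin_num.
rewrite lee_fin; have -> : fine (\int[leb]_(x in I n) (EFin \o g) x) = G (l - l / n.+3%:R) - G (l / n.+3%:R).
  apply: h.
  - apply: derivable_within_continuous => x; rewrite in_itv/= => /sub /dG.
    by case.
  - by move=> x /andP[h1 h2]; apply: dG; apply: sub; rewrite !ltW.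
  - by move=> x /andP[h1 h2]; apply: cg; apply: sub; rewrite !ltW.
have := GB (l - l / n.+3%:R); have := GB (l / n.+3%:R).
have in1 : 0 < l / n.+3%:R < l by apply: sub; rewrite lexx ltW.
have in2 : 0 < l - l / n.+3%:R < l by apply: sub; rewrite lexx ltW.
rewrite in1 in2 => /(_ isT) + /(_ isT).
by rewrite !ler_norml => /andP[? ?] /andP[? ?]; lra.
Qed.

End ImproperFTC.

(** * The trigonometric system *)

Section Trigonometric.
Context {R : realType}.
Local Notation l := (2 * pi : R).
Local Notation mu := (@period_measure R).
Implicit Types (j k n : nat) (t : R).

Lemma cos_period (z : int) t : cos (t + z%:~R * l) = cos t.
Proof.
have h n u : cos (u + n%:R * l) = cos u.
  by have := periodicn (@cosD2pi R) n u; rewrite -mulrnA mulnC mulrnA => <-; congr cos; ring.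
case: z => n; first exact: h.
by rewrite NegzE mulrNz mulNr -(h n.+1 (t - _)) subrK.
Qed.

Lemma sin_period (z : int) t : sin (t + z%:~R * l) = sin t.
Proof.
have h n u : sin (u + n%:R * l) = sin u.
  by have := periodicn (@sinD2pi R) n u; rewrite -mulrnA mulnC mulrnA => <-; congr sin; ring.
case: z => n; first exact: h.
by rewrite NegzE mulrNz mulNr -(h n.+1 (t - _)) subrK.
Qed.

Lemma periodic_cos (z : int) : periodic2pi (fun t => cos (z%:~R * t)).
Proof. by move=> t; rewrite mulrDr cos_period. Qed.

Lemma periodic_sin (z : int) : periodic2pi (fun t => sin (z%:~R * t)).
Proof. by move=> t; rewrite mulrDr sin_period. Qed.

Lemma continuous_measurable (f : R -> R) : continuous f ->
  measurable_fun setT (f : measurableTypeR R -> measurableTypeR R).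
Proof. exact: continuous_measurable_fun. Qed.

Lemma continuous_cosM (x : R) : continuous (fun t : R => cos (x * t)).
Proof.
move=> t; apply: (@continuous_comp _ _ _ (fun t => x * t)); last exact: continuous_cos.
exact: mulrl_continuous.
Qed.

Lemma continuous_sinM (x : R) : continuous (fun t : R => sin (x * t)).
Proof.
move=> t; apply: (@continuous_comp _ _ _ (fun t => x * t)); last exact: continuous_sin.
exact: mulrl_continuous.
Qed.

Lemma bounded_cosM (x : R) : bounded_mfun (fun t : measurableTypeR R => cos (x * t)).
Proof.
split; first exact: continuous_measurable (@continuous_cosM x).
by exists 1 => t; exact: cos_max.
Qed.

Lemma bounded_sinM (x : R) : bounded_mfun (fun t : measurableTypeR R => sin (x * t)).
Proof.
split; first exact: continuous_measurable (@continuous_sinM x).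
by exists 1 => t; exact: sin_max.
Qed.

(** Translating by half a wave length changes the sign. *)
Lemma total_cosM (z : int) : z != 0 -> total mu (fun t => cos (z%:~R * t)) = 0.
Proof.
move=> z0; have zR : z%:~R != 0 :> R by rewrite intr_eq0.
have [mc _] := bounded_cosM z%:~R.
have := total_shift (pi / z%:~R) mc (periodic_cos z).
have -> : (fun t : R => cos (z%:~R * (t + pi / z%:~R))) = (fun t => - cos (z%:~R * t)).
  by apply/funext => t; rewrite mulrDr mulrC -[_ * (_ / _)]mulrC divfK// cosDpi mulrC.
rewrite totalN; last exact/bounded_mfun_summable1/bounded_cosM.
by lra.
Qed.

Lemma total_sinM (z : int) : total mu (fun t => sin (z%:~R * t)) = 0.
Proof.
have [->|z0] := eqVneq z 0.
  by rewrite (_ : (fun t => _) = fun=> 0) ?total0//; apply/funext => t; rewrite mul0r sin0.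
have zR : z%:~R != 0 :> R by rewrite intr_eq0.
have [mc _] := bounded_sinM z%:~R.
have := total_shift (pi / z%:~R) mc (periodic_sin z).
have -> : (fun t : R => sin (z%:~R * (t + pi / z%:~R))) = (fun t => - sin (z%:~R * t)).
  by apply/funext => t; rewrite mulrDr mulrC -[_ * (_ / _)]mulrC divfK// sinDpi mulrC.
rewrite totalN; last exact/bounded_mfun_summable1/bounded_sinM.
by lra.
Qed.

Lemma total_cst (c : R) : total mu (fun=> c) = c * l.
Proof.
rewrite /total (Rintegral_cst mu)//.
congr (_ * _); rewrite /period_measure/= /mfrestr /mrestr setTI /period.
by rewrite lebesgue_measure_itv/= lte_fin period_gt0 -EFinB subr0.
Qed.

(** Odd indices are cosines and even ones sines; the frequency is [uphalf j]. *)
Definition wave j t : R :=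
  if odd j || (j == 0)%N then cos ((uphalf j)%:R * t) else sin ((uphalf j)%:R * t).

Definition wave_norm j : R := Num.sqrt (if (j == 0)%N then l else pi).

Definition trig j t : R := (wave_norm j)^-1 * wave j t.

Lemma wave_norm_gt0 j : 0 < wave_norm j.
Proof. by rewrite sqrtr_gt0; case: ifP => _; [exact: period_gt0|exact: pi_gt0]. Qed.

Lemma bounded_wave j : bounded_mfun (wave j : measurableTypeR R -> R).
Proof.
by rewrite /wave; case: (odd j || _); [exact: bounded_cosM|exact: bounded_sinM].
Qed.

Lemma bounded_trig j : bounded_mfun (trig j : measurableTypeR R -> R).
Proof. exact/bounded_mfunZ/bounded_wave. Qed.

Lemma trig_le j t : `|trig j t| <= 1.
Proof.
rewrite normrM gtr0_norm ?invr_gt0 ?wave_norm_gt0// mulrC ler_pdivrMr ?wave_norm_gt0//.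
rewrite mul1r; apply: (@le_trans _ _ 1).
  by rewrite /wave; case: ifP => _; [exact: cos_max|exact: sin_max].
rewrite -[leLHS]sqrtr1 ler_sqrt; last by case: ifP => _; apply: ltW; [exact: period_gt0|exact: pi_gt0].
by have := pi_ge2 R; case: ifP => _; lra.
Qed.

Lemma periodic_trig j : periodic2pi (trig j).
Proof.
move=> t; rewrite /trig /wave; case: ifP => _.
  by rewrite (periodic_cos (uphalf j)).
by rewrite (periodic_sin (uphalf j)).
Qed.

Let C (z : int) : R := if z == 0 then l else 0.

Let totC (z : int) : total mu (fun t => cos (z%:~R * t)) = C z.
Proof.
rewrite /C; case: eqP => [->|/eqP]; last exact: total_cosM.
rewrite (_ : (fun t => _) = fun=> 1) ?total_cst ?mul1r//.
by apply/funext => t; rewrite mul0r cos0.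
Qed.

Let sc (x c : R) : summable1 mu (fun t => c * cos (x * t)).
Proof. exact/bounded_mfun_summable1/bounded_mfunZ/bounded_cosM. Qed.

Let ss (x c : R) : summable1 mu (fun t => c * sin (x * t)).
Proof. exact/bounded_mfun_summable1/bounded_mfunZ/bounded_sinM. Qed.

Lemma inner_cos_cos (a b : int) :
  inner mu (fun t => cos (a%:~R * t)) (fun t => cos (b%:~R * t)) = (C (a - b) + C (a + b)) / 2.
Proof.
have := totC (a - b); have := totC (a + b) => <- <-.
rewrite mulrC mulrDr -!totalZ -?totalD; try exact: sc;
  try exact/bounded_mfun_summable1/bounded_cosM.
congr total; apply/funext => t.
by rewrite intrB intrD mulrBl mulrDl cosB cosD; field.
Qed.

Lemma inner_sin_sin (a b : int) :
  inner mu (fun t => sin (a%:~R * t)) (fun t => sin (b%:~R * t)) = (C (a - b) - C (a + b)) / 2.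
Proof.
have := totC (a - b); have := totC (a + b) => <- <-.
rewrite mulrC mulrBr -!totalZ -?totalB; try exact: sc;
  try exact/bounded_mfun_summable1/bounded_cosM.
congr total; apply/funext => t.
by rewrite intrB intrD mulrBl mulrDl cosB cosD; field.
Qed.

Lemma inner_cos_sin (a b : int) :
  inner mu (fun t => cos (a%:~R * t)) (fun t => sin (b%:~R * t)) = 0.
Proof.
have := total_sinM (a + b); have := total_sinM (a - b) => h1 h2.
have : 2^-1 * total mu (fun t => sin ((a + b)%:~R * t)) - 2^-1 * total mu (fun t => sin ((a - b)%:~R * t)) = 0.
  by rewrite h1 h2 !mulr0 subrr.
rewrite -!totalZ -?totalB; try exact: ss;
  try exact/bounded_mfun_summable1/bounded_sinM.
move=> <-; congr total; apply/funext => t.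
by rewrite intrB intrD mulrBl mulrDl sinB sinD; field.
Qed.

Lemma trig_orthonormal i j : inner mu (trig i) (trig j) = (i == j)%:R.
Proof.
have sw k : square_summable mu (wave k).
  exact/bounded_mfun_square_summable/bounded_wave.
rewrite innerZl// ?innerZr//; last exact/bounded_mfun_square_summable/bounded_trig.
have nE k : (wave_norm k)^-1 * (wave_norm k)^-1 = (if (k == 0)%N then l else pi)^-1.
  rewrite -invfM -expr2 sqr_sqrtr//; case: ifP => _; apply: ltW;
  [exact: period_gt0|exact: pi_gt0].
have pi0 : pi != 0 :> R by exact: lt0r_neq0 (pi_gt0 R).
have [<-|ij] := eqVneq i j.
  rewrite mulrA nE /wave; case: i => [|i].
    have -> := inner_cos_cos 0 0; have -> : C (0 - 0) + C (0 + 0) = l + l by [].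
    change (l^-1 * ((l + l) / 2) = 1).
    by rewrite -mulr2n -[l *+ 2]mulr_natr mulfK ?pnatr_eq0// mulVf// gt_eqF ?period_gt0.
  rewrite orbF; case oi: (odd i.+1).
    rewrite (inner_cos_cos (uphalf i.+1) (uphalf i.+1)) /C subrr eqxx.
    rewrite -PoszD eqz_nat addn_eq0 andbb /=.
    by rewrite addr0 [2 * _]mulrC mulfK ?pnatr_eq0// mulVf.
  rewrite (inner_sin_sin (uphalf i.+1) (uphalf i.+1)) /C subrr eqxx.
  rewrite -PoszD eqz_nat addn_eq0 andbb /=.
  by rewrite subr0 [2 * _]mulrC mulfK ?pnatr_eq0// mulVf.
suff -> : inner mu (wave i) (wave j) = 0 by rewrite !mulr0.
rewrite /wave; case oi: (odd i || (i == 0)%N); case oj: (odd j || (j == 0)%N).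
- have uij : uphalf i != uphalf j.
    apply: contraNN ij => /eqP uij; apply/eqP.
    move: oi oj uij (uphalfK i) (uphalfK j).
    by case: (i) => [|i'] /=; case: (j) => [|j'] /=; rewrite ?orbF ?orbT; lia.
  rewrite (inner_cos_cos (uphalf i) (uphalf j)) /C subr_eq0 eqz_nat (negbTE uij).
  rewrite -PoszD eqz_nat addn_eq0 ifF ?addr0 ?mul0r//.
  by apply/negbTE; apply: contraNN uij => /andP[/eqP -> /eqP ->].
- exact: (inner_cos_sin (uphalf i) (uphalf j)).
- by rewrite innerC; exact: (inner_cos_sin (uphalf j) (uphalf i)).
- have uij : uphalf i != uphalf j.
    apply: contraNN ij => /eqP uij; apply/eqP.
    move: oi oj uij (uphalfK i) (uphalfK j).
    by case: (i) => [|i'] /=; case: (j) => [|j'] /=; rewrite ?orbF ?orbT; lia.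
  rewrite (inner_sin_sin (uphalf i) (uphalf j)) /C subr_eq0 eqz_nat (negbTE uij).
  rewrite -PoszD eqz_nat addn_eq0 ifF ?subr0 ?mul0r//.
  by apply/negbTE; apply: contraNN uij => /andP[/eqP -> /eqP ->].
Qed.

Lemma total_trig j : (0 < j)%N -> total mu (trig j) = 0.
Proof.
move=> j0; rewrite /trig totalZ; last exact/bounded_mfun_summable1/bounded_wave.
rewrite /wave; case h: (odd j || (j == 0)%N); last by rewrite (total_sinM (uphalf j)) mulr0.
rewrite (total_cosM (z := uphalf j)) ?mulr0// eqz_nat.
by case: j j0 {h}.
Qed.

Definition trig_span (a : R -> R) := exists N c, a = comb trig c N.

Lemma trig_spanD a b : trig_span a -> trig_span b -> trig_span (fun t => a t + b t).
Proof.
move=> [N [c ->]] [M [d ->]].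
exists (N + M)%N, (fun j => (if (j < N)%N then c j else 0) + (if (j < M)%N then d j else 0)).
apply/funext => t; rewrite /comb.
under [in RHS]eq_bigr do rewrite mulrDl.
rewrite big_split/=; congr (_ + _).
  rewrite (big_ord_widen (N + M) (fun j => c j * trig j t) (leq_addr M N)) big_mkcond/=.
  by apply: eq_bigr => j _; case: ifP => _; rewrite ?mul0r.
rewrite (big_ord_widen (N + M) (fun j => d j * trig j t) (leq_addl N M)) big_mkcond/=.
by apply: eq_bigr => j _; case: ifP => _; rewrite ?mul0r.
Qed.

Lemma trig_spanZ (x : R) a : trig_span a -> trig_span (fun t => x * a t).
Proof.
move=> [N [c ->]]; exists N, (fun j => x * c j); apply/funext => t.
by rewrite /comb mulr_sumr; apply: eq_bigr => j _; rewrite mulrA.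
Qed.

Lemma trig_span_wave j : trig_span (wave j).
Proof.
exists j.+1, (fun i => if i == j then wave_norm j else 0); apply/funext => t.
rewrite /comb big_ord_recr/= eqxx big1 ?add0r => [|i _].
  by rewrite /trig mulrA divff ?mul1r// gt_eqF ?wave_norm_gt0.
by rewrite ifF ?mul0r//; apply/negbTE; rewrite neq_ltn ltn_ord.
Qed.

Lemma trig_span_cos k : trig_span (fun t => cos (k%:R * t)).
Proof.
case: k => [|k].
  by rewrite (_ : (fun t => _) = wave 0)//; exact: trig_span_wave.
rewrite (_ : (fun t => _) = wave k.*2.+1); first exact: trig_span_wave.
by apply/funext => t; rewrite /wave/= odd_double/= doubleK.
Qed.

Lemma trig_span_sin k : trig_span (fun t => sin (k%:R * t)).
Proof.
case: k => [|k].
  rewrite (_ : (fun t => _) = fun t => 0 * wave 0 t).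
    exact/trig_spanZ/trig_span_wave.
  by apply/funext => t; rewrite !mul0r sin0.
rewrite (_ : (fun t => _) = wave k.+1.*2); first exact: trig_span_wave.
by apply/funext => t; rewrite /wave odd_double/= uphalf_double.
Qed.

Lemma trig_span_sum (I : Type) (s : seq I) (F : I -> R -> R) :
  (forall i, trig_span (F i)) -> trig_span (fun t => \sum_(i <- s) F i t).
Proof.
move=> hF; elim: s => [|i s IHs].
  by exists 0%N, (fun=> 0); apply/funext => t; rewrite big_nil /comb big_ord0.
by under eq_fun do rewrite big_cons; exact: trig_spanD.
Qed.

Lemma trig_span_cosM a : trig_span a -> trig_span (fun t => cos t * a t).
Proof.
move=> [N [c ->]].
rewrite (_ : (fun t => _) = (fun t => \sum_(j < N) (c j * (wave_norm j)^-1) * (cos t * wave j t))); last first.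
  apply/funext => t; rewrite /comb mulr_sumr; apply: eq_bigr => j _.
  by rewrite /trig; ring.
apply: trig_span_sum => j; apply: trig_spanZ.
rewrite /wave; move: (uphalf j) => [|k]; case: (odd j || _).
- rewrite (_ : (fun t => _) = fun t => cos (1%:R * t)); first exact: trig_span_cos.
  by apply/funext => t; rewrite mul0r cos0 mulr1 mul1r.
- rewrite (_ : (fun t => _) = fun t => sin (0%:R * t)); first exact: trig_span_sin.
  by apply/funext => t; rewrite mul0r sin0 mulr0.
- rewrite (_ : (fun t => _) = fun t => 2^-1 * cos (k.+2%:R * t) + 2^-1 * cos (k%:R * t)).
    by apply: trig_spanD; apply: trig_spanZ; exact: trig_span_cos.
  apply/funext => t; have -> : k.+2%:R * t = k.+1%:R * t + t by rewrite -natr1 mulrDl mul1r.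
  have -> : k%:R * t = k.+1%:R * t - t by rewrite -natr1 mulrDl mul1r addrK.
  by rewrite cosD cosB; field.
- rewrite (_ : (fun t => _) = fun t => 2^-1 * sin (k.+2%:R * t) + 2^-1 * sin (k%:R * t)).
    by apply: trig_spanD; apply: trig_spanZ; exact: trig_span_sin.
  apply/funext => t; have -> : k.+2%:R * t = k.+1%:R * t + t by rewrite -natr1 mulrDl mul1r.
  have -> : k%:R * t = k.+1%:R * t - t by rewrite -natr1 mulrDl mul1r addrK.
  by rewrite sinD sinB; field.
Qed.

Lemma trig_span_sinM a : trig_span a -> trig_span (fun t => sin t * a t).
Proof.
move=> [N [c ->]].
rewrite (_ : (fun t => _) = (fun t => \sum_(j < N) (c j * (wave_norm j)^-1) * (sin t * wave j t))); last first.
  apply/funext => t; rewrite /comb mulr_sumr; apply: eq_bigr => j _.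
  by rewrite /trig; ring.
apply: trig_span_sum => j; apply: trig_spanZ.
rewrite /wave; move: (uphalf j) => [|k]; case: (odd j || _).
- rewrite (_ : (fun t => _) = fun t => sin (1%:R * t)); first exact: trig_span_sin.
  by apply/funext => t; rewrite mul0r cos0 mulr1 mul1r.
- rewrite (_ : (fun t => _) = fun t => sin (0%:R * t)); first exact: trig_span_sin.
  by apply/funext => t; rewrite mul0r sin0 mulr0.
- rewrite (_ : (fun t => _) = fun t => 2^-1 * sin (k.+2%:R * t) + (- 2^-1) * sin (k%:R * t)).
    by apply: trig_spanD; apply: trig_spanZ; exact: trig_span_sin.
  apply/funext => t; have -> : k.+2%:R * t = k.+1%:R * t + t by rewrite -natr1 mulrDl mul1r.
  have -> : k%:R * t = k.+1%:R * t - t by rewrite -natr1 mulrDl mul1r addrK.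
  by rewrite sinD sinB; field.
- rewrite (_ : (fun t => _) = fun t => (- 2^-1) * cos (k.+2%:R * t) + 2^-1 * cos (k%:R * t)).
    by apply: trig_spanD; apply: trig_spanZ; exact: trig_span_cos.
  apply/funext => t; have -> : k.+2%:R * t = k.+1%:R * t + t by rewrite -natr1 mulrDl mul1r.
  have -> : k%:R * t = k.+1%:R * t - t by rewrite -natr1 mulrDl mul1r addrK.
  by rewrite cosD cosB; field.
Qed.

End Trigonometric.

(** * The logarithmic kernel of the circle *)

Section CircleKernel.
Context {R : realType}.
Local Notation l := (2 * pi : R).
Local Notation mu := (@period_measure R).
Implicit Types (j k n : nat) (t u s : R).

Definition chord u : R := 1 - cos u.
Definition log_chord u : R := ln (chord u).

Lemma chord_ge0 u : 0 <= chord u. Proof. by rewrite subr_ge0 cos_le1. Qed.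

Lemma chord_le2 u : chord u <= 2.
Proof. by rewrite /chord; have := cos_geN1 u; lra. Qed.

Lemma continuous_chord : continuous chord.
Proof. by move=> u; apply: cvgB; [exact: cvg_cst|exact: continuous_cos]. Qed.

Lemma chordE u : chord u = 2 * sin (u / 2) ^+ 2.
Proof.
rewrite /chord (_ : cos u = cos ((u / 2) *+ 2)); first by rewrite cos_mulr2n cos2sin2; ring.
by congr cos; rewrite -mulr_natr mulfVK.
Qed.

Lemma chord_gt0 u : 0 < u < l -> 0 < chord u.
Proof.
move=> /andP[u0 ul]; rewrite chordE mulr_gt0// exprn_gt0// sin_gt0_pi//.
by rewrite divr_gt0//= ltr_pdivrMr// mulrC.
Qed.

Lemma chord_periodic : periodic2pi chord.
Proof. by move=> u; rewrite /chord; have := cos_period 1 u; rewrite mul1r => ->. Qed.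

Lemma log_chord_periodic : periodic2pi log_chord.
Proof. by move=> u; rewrite /log_chord chord_periodic. Qed.

Lemma log_chordN u : log_chord (- u) = log_chord u.
Proof. by rewrite /log_chord /chord cosN. Qed.

Lemma measurable_log_chord : measurable_fun setT (log_chord : measurableTypeR R -> R).
Proof.
apply: (@measurableT_comp _ _ _ _ _ _ (@ln R : measurableTypeR R -> measurableTypeR R)).
  exact: measurable_ln.
exact: continuous_measurable continuous_chord.
Qed.

Lemma sqrt_mul_ln (y : R) : 0 < y <= 1 ->
  Num.sqrt y * `|ln y| <= 4 * Num.sqrt (Num.sqrt y).
Proof.
move=> /andP[y0 y1]; pose s := Num.sqrt (Num.sqrt y).
have s0 : 0 < s by rewrite !sqrtr_gt0.
have s2 : Num.sqrt y = s ^+ 2 by rewrite sqr_sqrtr ?sqrtr_ge0.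
have yE : y = s ^+ 4 by rewrite (exprM s 2 2) -s2 sqr_sqrtr ?ltW.
have s1 : s <= 1.
  by rewrite -[leRHS]sqrtr1 ler_sqrt// -[leRHS]sqrtr1 ler_sqrt.
have -> : ln y = ln s *+ 4 by rewrite yE lnXn.
rewrite -/s s2 -[ln s *+ 4]mulr_natr normrM ler0_norm ?ln_le0// normr_nat.
have h : - ln s <= s^-1 by rewrite -lnV ?posrE// ltW// ln_sublinear ?invr_gt0.
have -> : s ^+ 2 * (- ln s * 4) = 4 * s * (s * - ln s) by ring.
rewrite ler_piMr ?mulr_ge0 ?(ltW s0)//.
by apply: (@le_trans _ _ (s * s^-1)); [rewrite ler_pM2l|rewrite divff ?gt_eqF].
Qed.

(** Since [sin u ^+ 2 <= 2 * chord u], the sine absorbs the logarithm and leaves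
   the power [1/4] of the chord. *)
Lemma sin_log_chord u : `|sin u * log_chord u| <= 8 * Num.sqrt (Num.sqrt (chord u)).
Proof.
have [y0|y0] := eqVneq (chord u) 0.
  have c1 : cos u = 1 by move: y0; rewrite /chord; lra.
  have -> : sin u = 0 by apply/eqP; rewrite -sqrf_eq0 sin2cos2 c1; apply/eqP; ring.
  by rewrite mul0r normr0 y0 !sqrtr0 mulr0.
have {y0} y0 : 0 < chord u by rewrite lt_neqAle eq_sym y0 chord_ge0.
rewrite normrM; have [y1|y1] := leP (chord u) 1.
  have hs : `|sin u| <= 2 * Num.sqrt (chord u).
    rewrite -(ler_pXn2r (_ : 0 < 2)%N) ?nnegrE ?mulr_ge0 ?sqrtr_ge0//.
    rewrite real_normK ?num_real// exprMn sqr_sqrtr ?(ltW y0)// sin2cos2 /chord.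
    by have := cos_le1 u; have := cos_geN1 u; nra.
  have := sqrt_mul_ln (_ : 0 < chord u <= 1); rewrite y0 y1 => /(_ isT) h.
  apply: (@le_trans _ _ (2 * Num.sqrt (chord u) * `|log_chord u|)).
    by rewrite ler_wpM2r.
  by rewrite -mulrA /log_chord; move: h; lra.
apply: (@le_trans _ _ 1).
  apply: mulr_ile1 => //; first exact: sin_max.
  rewrite ger0_norm ?ln_ge0 ?(ltW y1)//.
  have := @le_ln1Dx R (chord u - 1); rewrite (_ : 1 + (chord u - 1) = chord u); last by ring.
  by have := chord_le2 u; rewrite /log_chord => h1 h2; apply: (le_trans (h2 _)); lra.
have : 1 <= Num.sqrt (Num.sqrt (chord u)).
  by rewrite -[leLHS]sqrtr1 ler_sqrt ?sqrtr_ge0// -[leLHS]sqrtr1 ler_sqrt ltW.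
by lra.
Qed.

Lemma sin_natM_le k u : `|sin (k%:R * u)| <= k%:R * `|sin u|.
Proof.
elim: k => [|k IHk]; first by rewrite !mul0r sin0 normr0.
rewrite -natr1 !mulrDl !mul1r sinD (le_trans (ler_normD _ _))// !normrM lerD//.
  by rewrite (le_trans _ IHk)// ler_piMr// cos_max.
by rewrite ler_piMl// cos_max.
Qed.

Lemma continuous_log_chord u : 0 < chord u -> {for u, continuous log_chord}.
Proof.
move=> y0; apply: continuous_comp; first exact: continuous_chord.
exact: continuous_ln.
Qed.

(** The logarithmic singularity is absorbed by the zero of the sine. *)
Lemma continuous_sin_log_chord k : continuous (fun u => sin (k%:R * u) * log_chord u).
Proof.
move=> u; have [y0|y0] := ltP 0 (chord u).
  by apply: continuousM; [exact: continuous_sinM|exact: continuous_log_chord].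
have {}y0 : chord u = 0 by apply/eqP; rewrite eq_le y0 chord_ge0.
have bound v : `|sin (k%:R * v) * log_chord v| <= k%:R * (8 * Num.sqrt (Num.sqrt (chord v))).
  rewrite normrM (le_trans (ler_wpM2r _ (sin_natM_le k v)))// -mulrA ler_wpM2l//.
  by rewrite -normrM sin_log_chord.
have f0 : sin (k%:R * u) * log_chord u = 0.
  by apply/eqP; rewrite -normr_le0 (le_trans (bound u))// y0 !sqrtr0 !mulr0.
have lim : k%:R * (8 * Num.sqrt (Num.sqrt (chord v))) @[v --> u] --> (0 : R).
  have -> : 0 = k%:R * (8 * Num.sqrt (Num.sqrt (chord u))) by rewrite y0 !sqrtr0 !mulr0.
  apply: cvgMr; apply: cvgMr; apply: continuous_comp; last exact: sqrt_continuous.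
  by apply: continuous_comp; [exact: continuous_chord|exact: sqrt_continuous].
rewrite /continuous_at f0; apply/cvgr0Pnorm_lt => eps eps0.
move/cvgr0Pnorm_lt : lim => /(_ _ eps0); apply: filterS => v /ltr_normlW.
exact: le_lt_trans.
Qed.

Let is_derive_log u : 0 < chord u -> is_derive u 1 log_chord ((chord u)^-1 * sin u).
Proof.
move=> y0.
have d1 : is_derive u 1 chord (sin u).
  have := is_deriveB (is_derive_cst (1 : R) u 1) (is_derive_cos u).
  by rewrite sub0r opprK.
exact: (@is_derive1_comp _ (@ln R) chord u _ _ (is_derive1_ln y0) d1).
Qed.

(** The function [- cos u ln (1 - cos u)] is nonnegative and has a bounded
   primitive. It dominates the logarithm where [|cos u| >= 1/2], and elsewhere the
   logarithm is bounded. *)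
Lemma log_chord_summable : summable1 mu log_chord.
Proof.
pose g u := - (cos u * log_chord u).
have g0 u : 0 <= g u.
  rewrite /g /log_chord -mulrN; have [c0|c0] := leP 0 (cos u).
    by rewrite mulr_ge0// oppr_ge0 ln_le0// /chord; lra.
  by rewrite mulrN -mulNr mulr_ge0 ?ln_ge0// /chord; lra.
have mc : measurable_fun setT (@cos R : measurableTypeR R -> measurableTypeR R).
  exact: continuous_measurable (@continuous_cos R).
have mlc := measurable_log_chord.
have mg : measurable_fun setT (g : measurableTypeR R -> R).
  exact/measurableT_comp/measurable_funM.
have sg : summable1 mu g.
  apply: (@ge0_bounded_primitive R g
    (fun u => u + sin u - sin u * log_chord u) (l + 1 + 8 * 2)) => //.
  - move=> u ul; have y0 := chord_gt0 ul; have dl := is_derive_log y0.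
    have d1 := is_deriveB (is_deriveD (is_derive_id u 1) (is_derive_sin u)) (is_deriveM (is_derive_sin u) dl).
    apply: (is_derive_eq d1); rewrite /g.
    change (1 + cos u - (sin u * ((chord u)^-1 * sin u) + log_chord u * cos u) = - (cos u * log_chord u)).
    have -> : sin u * ((chord u)^-1 * sin u) = 1 + cos u.
      have -> : sin u * ((chord u)^-1 * sin u) = (sin u ^+ 2) / chord u by ring.
      by rewrite sin2cos2 -{1}(expr1n _ 2) subr_sqr mulrAC divff ?mul1r// gt_eqF.
    by ring.
  - move=> u /chord_gt0 y0; apply: continuousN; apply: continuousM.
      exact: continuous_cos.
    exact: continuous_log_chord.
  - move=> u /andP[u0 ul]; rewrite (le_trans (ler_normB _ _))// lerD//.
      rewrite (le_trans (ler_normD _ _))// lerD ?sin_max// ger0_norm ltW//.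
    rewrite (le_trans (sin_log_chord u))// ler_wpM2l//.
    have e : (2 : R) = Num.sqrt (2 ^+ 2) by rewrite sqrtr_sqr ger0_norm.
    rewrite e ler_sqrt ?exprn_ge0// (_ : 2 ^+ 2 = Num.sqrt ((2 ^+ 2) ^+ 2)).
      by rewrite ler_sqrt ?exprn_ge0// (le_trans (chord_le2 u))// -!natrX ler_nat.
    by rewrite sqrtr_sqr ger0_norm// exprn_ge0.
have s1 : summable1 mu (fun u => 1 + 2 * g u).
  apply: summable1D; last exact: summable1Z.
  exact/bounded_mfun_summable1/bounded_mfun_cst.
apply: (le_summable1 _ s1) => // u.
have gE : g u = `|cos u| * `|log_chord u| by rewrite -normrM -[RHS]normrN ger0_norm ?g0.
have [c2|c2] := leP 2^-1 `|cos u|.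
  by rewrite gE; have := normr_ge0 (log_chord u); nra.
have /ltr_normlP[h1 h2] := c2.
have y1 : 2^-1 <= chord u by rewrite /chord; lra.
have y2 : chord u <= 3 / 2 by rewrite /chord; lra.
have y0 : 0 < chord u by lra.
have : `|log_chord u| <= 1; last by have := g0 u; lra.
have lnle (y : R) : 0 < y -> ln y <= y - 1.
  move=> h; have := @le_ln1Dx R (y - 1).
  by rewrite (_ : 1 + (y - 1) = y); [apply; lra|ring].
rewrite ler_norml; apply/andP; split; last by apply: (le_trans (lnle _ y0)); lra.
have := lnle (chord u)^-1; rewrite invr_gt0 lnV ?posrE// => /(_ y0).
have : (chord u)^-1 <= 2 by rewrite -[leRHS]invrK lef_pV2 ?posrE// invr_gt0.
by rewrite /log_chord; lra.
Qed.

(** The polynomial that the quotient of [sin (k u) sin u] by [1 - cos u]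
   reduces to. *)
Fixpoint conjugate_dirichlet k u : R :=
  if k is k'.+1 then conjugate_dirichlet k' u + cos (k'%:R * u) + cos (k%:R * u) else 0.

Lemma conjugate_dirichletE k u :
  conjugate_dirichlet k u * chord u = sin (k%:R * u) * sin u.
Proof.
elim: k => [|k IHk]; first by rewrite /= !mul0r sin0 mul0r.
rewrite [conjugate_dirichlet _ _]/= !mulrDl IHk -natr1 !mulrDl mul1r sinD cosD /chord.
rewrite [RHS](_ : _ = sin (k%:R * u) * cos u * sin u + cos (k%:R * u) * sin u ^+ 2); last by ring.
by rewrite sin2cos2; ring.
Qed.

Lemma bounded_conjugate_dirichlet k :
  bounded_mfun (conjugate_dirichlet k : measurableTypeR R -> R).
Proof.
elim: k => [|k IHk]; first exact: bounded_mfun_cst.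
by apply: bounded_mfunD; [apply: bounded_mfunD => //|]; exact: bounded_cosM.
Qed.

Lemma continuous_conjugate_dirichlet k : continuous (conjugate_dirichlet k).
Proof.
elim: k => [|k IHk] u; first exact: cvg_cst.
by apply: cvgD; [apply: cvgD; [exact: IHk|]|]; exact: continuous_cosM.
Qed.

Lemma total_conjugate_dirichlet k : (0 < k)%N -> total mu (conjugate_dirichlet k) = l.
Proof.
elim: k => // k IHk _.
have sc (x : R) : summable1 mu (fun u => cos (x * u)).
  exact/bounded_mfun_summable1/bounded_cosM.
have sd := bounded_mfun_summable1 mu (bounded_conjugate_dirichlet k).
have -> : total mu (conjugate_dirichlet k.+1) = total mu (conjugate_dirichlet k) +
   total mu (fun u => cos (k%:R * u)) + total mu (fun u => cos (k.+1%:R * u)).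
  by rewrite -!totalD//; exact: summable1D.
rewrite (total_cosM (z := k.+1))// addr0.
case: k IHk {sd} => [_|k ->//]; last by rewrite (total_cosM (z := k.+1))// addr0.
rewrite (_ : conjugate_dirichlet 0 = fun=> 0) ?total0 ?add0r//.
rewrite (_ : (fun u => _) = fun=> 1) ?total_cst ?mul1r//.
by apply/funext => u; rewrite mul0r cos0.
Qed.

Let cos_log_summable (x : R) : summable1 mu (fun u => cos (x * u) * log_chord u).
Proof.
apply: (le_summable1 _ (summable1_norm log_chord_summable)).
  apply: measurable_funM; last exact: measurable_log_chord.
  by case: (bounded_cosM x).
by move=> u; rewrite normrM ler_piMl// cos_max.
Qed.

Let sin_log_summable (x : R) : summable1 mu (fun u => sin (x * u) * log_chord u).
Proof.
apply: (le_summable1 _ (summable1_norm log_chord_summable)).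
  apply: measurable_funM; last exact: measurable_log_chord.
  by case: (bounded_sinM x).
by move=> u; rewrite normrM ler_piMl// sin_max.
Qed.

(** Integration by parts, with the primitive [sin (k u) ln (1 - cos u)]. *)
Lemma total_cos_log_chord k : (0 < k)%N ->
  total mu (fun u => cos (k%:R * u) * log_chord u) = - (l / k%:R).
Proof.
move=> k0; have kR : k%:R != 0 :> R by rewrite pnatr_eq0 -lt0n.
have sd := bounded_mfun_summable1 mu (bounded_conjugate_dirichlet k).
have h : total mu (fun u => k%:R * (cos (k%:R * u) * log_chord u) + conjugate_dirichlet k u) = 0.
  have sf : summable1 mu (fun u => k%:R * (cos (k%:R * u) * log_chord u) + conjugate_dirichlet k u).
    by apply: summable1D => //; exact: summable1Z.
  pose F u := sin (k%:R * u) * log_chord u.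
  transitivity (F l - F 0); last first.
    rewrite /F; have sE x : sin (k%:R * x) * log_chord x = sin ((k : int)%:~R * x) * log_chord x by [].
    have := periodic_sin k (0 : R); rewrite add0r => sl.
    by rewrite !sE sl mulr0 sin0 !mul0r subrr.
  apply: total_derive => //.
  - exact: continuous_sin_log_chord.
  - move=> u ul; have y0 := chord_gt0 ul; have dl := is_derive_log y0.
    have ds : is_derive u 1 (fun u => sin (k%:R * u)) (k%:R * cos (k%:R * u)).
      have dk : is_derive u 1 (fun u : R => k%:R * u) k%:R.
        have := is_deriveZ k%:R (is_derive_id u (1 : R)).
        by rewrite [_ *: _]mulr1.
      have := @is_derive1_comp _ (@sin R) (fun u => k%:R * u) u _ _ (is_derive_sin _) dk.
      by rewrite mulrC.
    apply: (is_derive_eq (is_deriveM ds dl)).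
    change (sin (k%:R * u) * ((chord u)^-1 * sin u) + log_chord u * (k%:R * cos (k%:R * u)) =
      k%:R * (cos (k%:R * u) * log_chord u) + conjugate_dirichlet k u).
    have -> : sin (k%:R * u) * ((chord u)^-1 * sin u) = conjugate_dirichlet k u.
      by rewrite mulrCA -conjugate_dirichletE mulrCA mulVf ?mulr1// gt_eqF.
    by ring.
  - move=> u /chord_gt0 y0; apply: continuousD; last exact: continuous_conjugate_dirichlet.
    apply: cvgMr; apply: continuousM; first exact: continuous_cosM.
    exact: continuous_log_chord.
move: h; rewrite totalD//; last exact: summable1Z.
rewrite totalZ// total_conjugate_dirichlet// => h.
by apply: (mulfI kR); rewrite mulrN mulrCA divff// mulr1; lra.
Qed.

Lemma total_sin_log_chord k : total mu (fun u => sin (k%:R * u) * log_chord u) = 0.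
Proof.
have m : measurable_fun setT (fun u : measurableTypeR R => sin (k%:R * u) * log_chord u).
  exact: summable1_measurable (sin_log_summable _).
have p : periodic2pi (fun u => sin (k%:R * u) * log_chord u).
  by move=> u; rewrite log_chord_periodic; congr (_ * _); exact: (periodic_sin k u).
have := total_reflect m p.
rewrite (_ : (fun t => sin (k%:R * - t) * _) = fun u => - (sin (k%:R * u) * log_chord u)).
  by rewrite totalN//; lra.
by apply/funext => u; rewrite log_chordN mulrN sinN mulNr.
Qed.

(** The logarithmic kernel of the unit circle, on which the points with parameters
   [t] and [s] have the squared distance [2 * chord (t - s)]. *)
Definition circle_kernel (z : measurableTypeR R * measurableTypeR R) : R :=
  - (4 * pi)^-1 * (ln 2 + log_chord (z.1 - z.2)).

Lemma measurable_circle_kernel : measurable_fun setT circle_kernel.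
Proof.
apply: measurable_funM => //; apply: measurable_funD => //.
apply: (@measurableT_comp _ _ _ _ _ _ (log_chord : measurableTypeR R -> measurableTypeR R)).
  exact: measurable_log_chord.
exact: measurable_funB.
Qed.

Lemma circle_kernel_schur : exists C, schur mu C circle_kernel.
Proof.
pose f u := - (4 * pi)^-1 * (ln 2 + log_chord u).
have sf : summable1 mu f.
  apply: summable1Z; apply: summable1D; last exact: log_chord_summable.
  exact/bounded_mfun_summable1/bounded_mfun_cst.
have pf : periodic2pi f by move=> u; rewrite /f log_chord_periodic.
have mf := summable1_measurable sf.
have fin : (\int[mu]_u `|f u|%:E < +oo)%E by case/integrableP : sf.
have ge0 : (0 <= \int[mu]_u `|f u|%:E)%E by apply: integral_ge0 => u _; rewrite lee_fin.
have shift (x : R) : (\int[mu]_u `|f (u + x)|%:E = \int[mu]_u `|f u|%:E)%E.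
  apply: (@ge0_integral_period_shift R (fun u => `|f u|%:E) x).
  - by apply/measurable_EFinP; exact: measurableT_comp.
  - by move=> u; rewrite lee_fin.
  - by move=> u; rewrite pf.
exists (fine (\int[mu]_u `|f u|%:E)); split.
- exact: measurable_circle_kernel.
- move=> x; rewrite fineK ?ge0_fin_numE// -(shift (- x)) le_eqVlt; apply/orP; left; apply/eqP.
  apply: eq_integral => y _; rewrite /circle_kernel/f/= -log_chordN.
  by rewrite opprB.
- move=> y; rewrite fineK ?ge0_fin_numE// -(shift (- y)).
  by [].
Qed.

(** The eigenvalues of the kernel of the circle, except for [j = 0]: the constants
   are mapped to zero, and [1] stands in to make division possible. *)
Definition symbol j : R := if j is 0 then 1 else (2 * (uphalf j)%:R)^-1.

(** Convolution operators are diagonal in the trigonometric system. *)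
Lemma adjoint_circle_kernel j s : (0 < j)%N ->
  adjoint_at mu circle_kernel (trig j) s = symbol j * trig j s.
Proof.
move=> j0; pose k := uphalf j.
have k0 : (0 < k)%N by rewrite /k; case: (j) j0.
have kR : k%:R != 0 :> R by rewrite pnatr_eq0 -lt0n.
have pi0 : pi != 0 :> R by rewrite gt_eqF ?pi_gt0.
rewrite /adjoint_at.
have ml : measurable_fun setT (fun t : measurableTypeR R => circle_kernel (t, s) * trig j t).
  have [mt _] := @bounded_trig R j.
  apply: (measurable_funM _ mt).
  exact: (measurableT_comp measurable_circle_kernel (measurable_pair2 s)).
rewrite -(total_shift s ml); last first.
  move=> t; rewrite periodic_trig /circle_kernel/=; congr (_ * (_ + _) * _).
  by rewrite addrAC log_chord_periodic.
have sc : summable1 mu (fun u => cos (k%:R * u)).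
  exact/bounded_mfun_summable1/bounded_cosM.
have ss : summable1 mu (fun u => sin (k%:R * u)).
  exact/bounded_mfun_summable1/bounded_sinM.
have main (al be : R) : total mu (fun u => - (4 * pi)^-1 * (ln 2 + log_chord u) *
     (al * cos (k%:R * u) + be * sin (k%:R * u))) = (2 * k%:R)^-1 * al.
  rewrite (_ : (fun u => _) = (fun u => (- (4 * pi)^-1) * (al * (ln 2 * cos (k%:R * u) + cos (k%:R * u) * log_chord u) +
     be * (ln 2 * sin (k%:R * u) + sin (k%:R * u) * log_chord u)))); last first.
    by apply/funext => u; ring.
  have s1 : summable1 mu (fun u => ln 2 * cos (k%:R * u) + cos (k%:R * u) * log_chord u).
    by apply: summable1D => //; exact: summable1Z.
  have s2 : summable1 mu (fun u => ln 2 * sin (k%:R * u) + sin (k%:R * u) * log_chord u).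
    by apply: summable1D => //; exact: summable1Z.
  rewrite totalZ; last by apply: summable1D; exact: summable1Z.
  rewrite totalD; [|exact: summable1Z|exact: summable1Z].
  rewrite !totalZ// !totalD//; try exact: summable1Z.
  rewrite !totalZ// total_cos_log_chord// total_sin_log_chord.
  rewrite (total_cosM (z := k)); last by rewrite eqz_nat -lt0n.
  rewrite (total_sinM k).
  move: (k%:R : R) (pi : R) (ln 2 : R) kR pi0 => x y z x0 y0.
  by field; rewrite x0 y0.
have symE : symbol j = (2 * k%:R)^-1 by rewrite /symbol /k; case: (j) j0.
rewrite symE /trig /wave -/k (gtn_eqF j0) orbF; case: (odd j).
- rewrite -[RHS](main ((wave_norm j)^-1 * cos (k%:R * s)) (- ((wave_norm j)^-1 * sin (k%:R * s)))).
  congr total; apply/funext => u; rewrite /circle_kernel/= addrK (mulrDr k%:R) cosD.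
  by ring.
- rewrite -[RHS](main ((wave_norm j)^-1 * sin (k%:R * s)) ((wave_norm j)^-1 * cos (k%:R * s))).
  congr total; apply/funext => u; rewrite /circle_kernel/= addrK (mulrDr k%:R) sinD.
  by ring.
Qed.

End CircleKernel.

(** * Analytic periodic functions and divided differences *)

Section Analytic.
Context {R : realType}.
Local Notation l := (2 * pi : R).
Implicit Types (f : R -> R).

(** All [n.+1] terms of the geometric sum are at least [p ^+ n]. *)
Lemma natM_expr_le (p : R) n : 0 <= p < 1 -> n.+1%:R * p ^+ n <= (1 - p)^-1.
Proof.
move=> /andP[p0 p1]; have p1' : 0 < 1 - p by rewrite subr_gt0.
rewrite -[leRHS]mul1r ler_pdivlMr// mulrC.
have h : 1 - p ^+ n.+1 <= 1 by rewrite gerBl exprn_ge0.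
apply: le_trans h; rewrite -[X in _ <= X - _](expr1n _ n.+1) subrXX.
rewrite ler_wpM2l ?(ltW p1')//.
rewrite mulr_natl -[X in _ *+ X]card_ord -sumr_const; apply: ler_sum => i _.
rewrite expr1n mul1r; have il : (i <= n)%N by rewrite -ltnS.
by rewrite ler_wiXn2l// ltW.
Qed.

(** The factor [n] that comes from differentiation is compensated by the square
   root of the ratio [`|z| / `|K|]. *)
Lemma is_cvg_pseries_diffs (a : R^nat) (K z : R) : cvgn (pseries a K) -> `|z| < `|K| ->
  cvgn (pseries (pseries_diffs a) z).
Proof.
move=> ck zK; have K0 : 0 < `|K| by rewrite (le_lt_trans _ zK).
have [M M0 hM] : exists2 M, 0 <= M & forall n, `|a n * K ^+ n| <= M.
  have /cvg_seq_bounded[M [_ hM]] : cvgn (fun n => a n * K ^+ n).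
    by apply/cvg_ex; exists 0; exact: cvg_series_cvg_0 ck.
  exists (`|M| + 1) => [|n]; first by rewrite addr_ge0.
  by apply: hM => //; rewrite (le_lt_trans (ler_norm _))// ltrDl.
pose q := `|z| / `|K|; pose p := Num.sqrt q.
have q0 : 0 <= q by rewrite divr_ge0.
have q1 : q < 1 by rewrite ltr_pdivrMr// mul1r.
have p0 : 0 <= p by exact: sqrtr_ge0.
have p1 : p < 1 by rewrite -[ltRHS]sqrtr1 ltr_sqrt.
have qE : q = p * p by rewrite -expr2 sqr_sqrtr.
apply: normed_cvg.
pose c := M / `|K| * (1 - p)^-1.
apply: (@series_le_cvg _ _ (geometric c p)).
- by move=> n; exact: normr_ge0.
- by move=> n; rewrite /= mulr_ge0 ?exprn_ge0// mulr_ge0 ?divr_ge0// invr_ge0 subr_ge0 ltW.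
- move=> n /=; rewrite /pseries_diffs !normrM normrX normr_nat.
  have zE : `|z| ^+ n = `|K| ^+ n * (p ^+ n * p ^+ n).
    by rewrite -exprMn -qE -exprMn /q mulrC divfK// gt_eqF.
  have -> : n.+1%:R * `|a n.+1| * `|z| ^+ n =
      `|a n.+1 * K ^+ n.+1| / `|K| * (n.+1%:R * p ^+ n) * p ^+ n.
    rewrite zE normrM normrX exprSr.
    by field; rewrite gt_eqF.
  rewrite ler_wpM2r ?exprn_ge0// ler_pM ?divr_ge0 ?mulr_ge0 ?exprn_ge0//.
    by rewrite ler_pM2r ?invr_gt0.
  by apply: natM_expr_le; rewrite p0.
- by apply: is_cvg_geometric_series; rewrite ger0_norm.
Qed.

Lemma analytic_derive f : real_analytic f ->
  (forall t : R, is_derive t 1 f (derive1 f t)) /\ real_analytic (derive1 f).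
Proof.
move=> af.
have main t0 : exists a : R^nat, exists2 e : R, 0 < e & forall t : R, `|t - t0| < e ->
    is_derive t 1 f (limn (pseries (pseries_diffs a) (t - t0))) /\
    cvgn (pseries (pseries_diffs a) (t - t0)).
  have [a /nbhs_ballP[e /= e0 he]] := af t0; exists a.
  have hf t : `|t - t0| < e -> pseries a (t - t0) @ \oo --> f t.
    by move=> h; apply: he; rewrite /ball/= distrC.
  pose K := e / 2; have K0 : 0 < K by rewrite divr_gt0.
  have cK : cvgn (pseries a K).
    have := hf (t0 + K); rewrite addrAC subrr add0r gtr0_norm// => h.
    by apply/cvg_ex; exists (f (t0 + K)); apply: h; rewrite /K; lra.
  have cK2 : cvgn (pseries (pseries_diffs a) (K / 2)).
    by apply: is_cvg_pseries_diffs cK _; rewrite !gtr0_norm ?divr_gt0//; lra.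
  have cK4 : cvgn (pseries (pseries_diffs (pseries_diffs a)) (K / 4)).
    by apply: is_cvg_pseries_diffs cK2 _; rewrite !gtr0_norm ?divr_gt0//; lra.
  have lt0 (x y : R) : 0 < x -> 0 < y -> x < y -> `|x| < `|y|.
    by move=> x0 y0 xy; rewrite !gtr0_norm.
  have cK1 : cvgn (pseries a (K / 4)).
    by apply: is_cvg_pseries_inside cK _; apply: lt0 => //; lra.
  have cK3 : cvgn (pseries (pseries_diffs a) (K / 4)).
    by apply: is_cvg_pseries_inside cK2 _; apply: lt0 => //; lra.
  exists (K / 4); first by rewrite divr_gt0.
  move=> t tK; have tK' : `|t - t0| < `|K / 4| by rewrite [ltRHS]gtr0_norm ?divr_gt0.
  split; last exact: is_cvg_pseries_inside cK3 tK'.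
  have dt : is_derive t 1 (fun t => t - t0) (1 : R).
    by have := is_deriveB (is_derive_id t 1) (is_derive_cst t0 t 1); rewrite subr0.
  have := @is_derive1_comp _ (fun x => limn (pseries a x)) (fun t => t - t0) t _ _
    (pseries_snd_diffs cK1 cK3 cK4 tK') dt.
  rewrite mulr1; apply: near_eq_is_derive.
  have : 0 < K / 4 - `|t - t0| by rewrite subr_gt0.
  move=> d0; apply/nbhs_ballP; exists (K / 4 - `|t - t0|) => //= u.
  rewrite /ball/= => tu; apply: cvg_lim => //; apply: hf.
  have -> : u - t0 = (t - t0) - (t - u) by ring.
  by rewrite (le_lt_trans (ler_normB _ _))//; rewrite /K in tu *; lra.
split=> t.
  have [a [e e0 /(_ t)[]]] := main t; first by rewrite subrr normr0.
  by move=> d _; rewrite derive1E derive_val.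
have [a [e e0 h]] := main t; exists (pseries_diffs a).
apply/nbhs_ballP; exists e => //= u; rewrite /ball/= distrC => /h[d c].
by rewrite derive1E derive_val.
Qed.

Lemma periodic_int (S : Type) (f : R -> S) (z : int) t : periodic2pi f ->
  f (t + z%:~R * l) = f t.
Proof.
move=> pf; have pfn (n : nat) u : f (u + n%:R * l) = f u.
  elim: n => [|n IHn]; first by rewrite mul0r addr0.
  by rewrite -natr1 mulrDl mul1r addrA pf IHn.
case: z => n; first exact: pfn.
by rewrite NegzE mulrNz mulNr -(pfn n.+1 (t - _)) subrK.
Qed.

Lemma period_reduce (t : R) : exists z : int, 0 <= t + z%:~R * l < l.
Proof.
have l0 := period_gt0 (R := R); exists (- Num.floor (t / l)).
rewrite mulrNz mulNr subr_ge0 -ler_pdivlMr// floor_le/= ltrBlDl.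
rewrite -[X in _ + X]mul1r -mulrDl -ltr_pdivrMr// -[X in _ + X]/(1%:~R) -intrD.
exact: floorD1_gt.
Qed.

Lemma periodic_bounded f : continuous f -> periodic2pi f ->
  exists B, 0 <= B /\ forall t, `|f t| <= B.
Proof.
move=> cf pf; have l0 := period_gt0 (R := R).
have cn : {within `[0, l], continuous (fun t => `|f t|)}.
  apply: continuous_subspaceT => t; apply: continuous_comp; first exact: cf.
  exact: norm_continuous.
have [c _ hc] := EVT_max (ltW l0) cn.
exists `|f c|; split=> // t; have [z /andP[z0 z1]] := period_reduce t.
by rewrite -(periodic_int z t pf); apply: hc; rewrite in_itv/= z0 ltW.
Qed.

Lemma continuous_derivable f (f' : R -> R) : (forall t : R, is_derive t 1 f (f' t)) ->
  continuous f.
Proof.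
move=> df t; apply: differentiable_continuous; apply/derivable1_diffP.
by have [] := df t.
Qed.

Lemma derive_periodic f : (forall t : R, is_derive t 1 f (derive1 f t)) -> periodic2pi f ->
  periodic2pi (derive1 f).
Proof.
move=> df pf t.
have dt : is_derive t 1 (fun t => t + l) (1 : R).
  by have := is_deriveD (is_derive_id t 1) (is_derive_cst l t 1); rewrite addr0.
have := @is_derive1_comp _ f (fun t => t + l) t _ _ (df (t + l)) dt; rewrite mulr1.
rewrite (_ : f \o _ = f); last by apply/funext => u; exact: pf.
by move=> d; rewrite [RHS]derive1E derive_val.
Qed.

Lemma mean_value f (f' : R -> R) (a b : R) : (forall t : R, is_derive t 1 f (f' t)) ->
  exists2 c, (a <= c <= b) || (b <= c <= a) & f b - f a = f' c * (b - a).
Proof.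
move=> df; have cf A := continuous_subspaceT (A := A) (continuous_derivable df).
have [ab|ba] := leP a b.
  have [c] := MVT_segment ab (fun t _ => df t) (cf _).
  by rewrite in_itv/= => h e; exists c; rewrite ?h.
have [c] := MVT_segment (ltW ba) (fun t _ => df t) (cf _).
rewrite in_itv/= => h e; exists c; rewrite ?h ?orbT//.
by rewrite -opprB e; ring.
Qed.

Lemma derive_lipschitz f (f' : R -> R) (M : R) : (forall t : R, is_derive t 1 f (f' t)) ->
  (forall t, `|f' t| <= M) -> forall a b, `|f a - f b| <= M * `|a - b|.
Proof.
move=> df hM a b; have [c _ ->] := mean_value b a df.
by rewrite normrM ler_wpM2r.
Qed.

(** By periodicity the second derivative is bounded. *)
Lemma analytic_periodic_lipschitz f : real_analytic f -> periodic2pi f ->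
  exists B, [/\ 0 <= B, forall t : R, is_derive t 1 f (derive1 f t),
    forall t, `|derive1 f t| <= B &
    forall a b, `|derive1 f a - derive1 f b| <= B * `|a - b|].
Proof.
move=> af pf; have [d1 a1] := analytic_derive af.
have [d2 a2] := analytic_derive a1; have [d3 _] := analytic_derive a2.
have p1 := derive_periodic d1 pf; have p2 := derive_periodic d2 p1.
have [B1 [B10 h1]] := periodic_bounded (continuous_derivable d2) p1.
have [B2 [B20 h2]] := periodic_bounded (continuous_derivable d3) p2.
exists (B1 + B2); split=> //; first by rewrite addr_ge0.
  by move=> t; rewrite (le_trans (h1 t))// lerDl.
move=> a b; rewrite (le_trans (derive_lipschitz d2 h2 a b))//.
by rewrite ler_wpM2r// lerDr.
Qed.

End Analytic.

Section DividedDifference.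
Context {R : realType}.
Variables (x x' : R -> R) (B : R).
Hypothesis dx : forall t : R, is_derive t 1 x (x' t).
Hypothesis x'B : forall t, `|x' t| <= B.
Hypothesis x'L : forall a b, `|x' a - x' b| <= B * `|a - b|.

Definition divdiff (t s : R) : R := if t == s then x' s else (x t - x s) / (t - s).

Lemma divdiffE t s : divdiff t s * (t - s) = x t - x s.
Proof.
rewrite /divdiff; case: eqVneq => [->|ts]; first by rewrite !subrr mulr0.
by rewrite divfK// subr_eq0.
Qed.

(* Its increment between [0] and [1] is the divided difference, and its derivative
   is [x'] along the segment from [s] to [s + a], also when this is a point. *)
Let ray (s a th : R) : R := if a == 0 then th * x' s else x (s + th * a) / a.

Let ray_derive (s a th : R) : is_derive th 1 (ray s a) (x' (s + th * a)).
Proof.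
rewrite /ray; case: eqVneq => [->|a0].
  have := is_deriveZ (x' s) (is_derive_id th 1).
  rewrite mulr0 addr0 (_ : (_ \*: _) = (fun u : R => u * x' s)); last first.
    by apply/funext => u; exact: mulrC.
  by rewrite [_ *: _]mulr1.
have da : is_derive th 1 (fun u => s + u * a) a.
  have := is_deriveD (is_derive_cst s th 1) (is_deriveZ a (is_derive_id th 1)).
  rewrite add0r (_ : cst s + _ = (fun u : R => s + u * a)); last first.
    by apply/funext => u; rewrite /GRing.add/=; congr (_ + _); exact: mulrC.
  by rewrite [_ *: _]mulr1.
have := is_deriveZ a^-1 (@is_derive1_comp _ x (fun u => s + u * a) th _ _ (dx (s + th * a)) da).
rewrite (_ : (_ \*: _) = (fun u => x (s + u * a) / a)); last first.
  by apply/funext => u; exact: mulrC.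
by rewrite [_ *: _]mulrCA mulVf ?mulr1.
Qed.

Let divdiff_ray s a : divdiff (s + a) s = ray s a 1 - ray s a 0.
Proof.
rewrite /divdiff /ray -subr_eq0 addrAC subrr add0r.
by case: eqVneq => _; rewrite mul1r mul0r ?subr0 ?addr0// -mulrBl.
Qed.

(** The divided difference is the mean of the derivative over the segment, a
   mean that depends on both end points in a Lipschitz way. *)
Lemma divdiff_lipschitz t s t' s' :
  `|divdiff t s - divdiff t' s'| <= B * (`|t - t'| + `|s - s'|).
Proof.
have -> : divdiff t s = divdiff (s + (t - s)) s by rewrite subrKC.
have -> : divdiff t' s' = divdiff (s' + (t' - s')) s' by rewrite subrKC.
rewrite !divdiff_ray.
have dG th := is_deriveB (ray_derive s (t - s) th) (ray_derive s' (t' - s') th).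
have [c + e] := mean_value 0 1 dG.
have -> : ray s (t - s) 1 - ray s (t - s) 0 - (ray s' (t' - s') 1 - ray s' (t' - s') 0) =
   (ray s (t - s) - ray s' (t' - s')) 1 - (ray s (t - s) - ray s' (t' - s')) 0.
  rewrite -[RHS]/((ray s (t - s) 1 - ray s' (t' - s') 1) - (ray s (t - s) 0 - ray s' (t' - s') 0)).
  by ring.
rewrite e subr0 mulr1 => hc; have {hc} /andP[c0 c1] : 0 <= c <= 1.
  by case/orP : hc => // /andP[? ?]; apply/andP; split; lra.
have B0 : 0 <= B by apply: le_trans (x'B 0).
rewrite (le_trans (x'L _ _))// ler_wpM2l//.
have -> : s + c * (t - s) - (s' + c * (t' - s')) = c * (t - t') + (1 - c) * (s - s').
  by ring.
have c1' : 0 <= 1 - c by rewrite subr_ge0.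
rewrite (le_trans (ler_normD _ _))// !normrM (ger0_norm c0) (ger0_norm c1').
by rewrite lerD// ler_piMl// gerBl.
Qed.

Lemma divdiff_bound t s : `|divdiff t s| <= B.
Proof.
rewrite /divdiff; case: eqVneq => [_|ts]; first exact: x'B.
have ts0 : t - s != 0 by rewrite subr_eq0.
have [c _ ->] := mean_value s t dx.
by rewrite mulfK.
Qed.

End DividedDifference.

(** * Chords of a closed curve *)

Section LoopChord.
Context {R : realType}.
Local Notation l := (2 * pi : R).
Variables (x x' y y' : R -> R) (B : R).
Hypotheses (dx : forall t : R, is_derive t 1 x (x' t)) (dy : forall t : R, is_derive t 1 y (y' t)).
Hypotheses (x'B : forall t, `|x' t| <= B) (y'B : forall t, `|y' t| <= B).
Hypotheses (x'L : forall a b, `|x' a - x' b| <= B * `|a - b|)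
           (y'L : forall a b, `|y' a - y' b| <= B * `|a - b|).

(** The squared chord divided by [(t - s) ^+ 2], with its continuous extension to
   the diagonal. *)
Definition chord_ratio (t s : R) : R := divdiff x x' t s ^+ 2 + divdiff y y' t s ^+ 2.

Lemma chord_ratioE t s :
  (x t - x s) ^+ 2 + (y t - y s) ^+ 2 = (t - s) ^+ 2 * chord_ratio t s.
Proof. by rewrite -(divdiffE x x') -(divdiffE y y') /chord_ratio; ring. Qed.

Lemma chord_ratio_diag t : chord_ratio t t = x' t ^+ 2 + y' t ^+ 2.
Proof. by rewrite /chord_ratio /divdiff eqxx. Qed.

Lemma chord_ratio_lipschitz t s t' s' :
  `|chord_ratio t s - chord_ratio t' s'| <= 4 * B ^+ 2 * (`|t - t'| + `|s - s'|).
Proof.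
have h (z z' : R -> R) (dz : forall t : R, is_derive t 1 z (z' t)) (z'B : forall t, `|z' t| <= B)
    (z'L : forall a b, `|z' a - z' b| <= B * `|a - b|) :
    `|divdiff z z' t s ^+ 2 - divdiff z z' t' s' ^+ 2| <= 2 * B ^+ 2 * (`|t - t'| + `|s - s'|).
  rewrite subr_sqr normrM.
  have -> : 2 * B ^+ 2 * (`|t - t'| + `|s - s'|) = (B * (`|t - t'| + `|s - s'|)) * (B + B) by ring.
  apply: ler_pM => //; first exact: divdiff_lipschitz.
  by rewrite (le_trans (ler_normD _ _))// lerD//; exact: divdiff_bound.
have -> : chord_ratio t s - chord_ratio t' s' =
   (divdiff x x' t s ^+ 2 - divdiff x x' t' s' ^+ 2) + (divdiff y y' t s ^+ 2 - divdiff y y' t' s' ^+ 2).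
  by rewrite /chord_ratio; ring.
rewrite (le_trans (ler_normD _ _))//.
by have := h _ _ dx x'B x'L; have := h _ _ dy y'B y'L; lra.
Qed.

Lemma chord_ratio_le t s : chord_ratio t s <= 2 * B ^+ 2.
Proof.
have B0 : 0 <= B by apply: le_trans (x'B 0).
have h z : `|z| <= B -> z ^+ 2 <= B ^+ 2.
  by move=> zB; rewrite -(real_normK (num_real z)) ler_pXn2r ?nnegrE.
have := h _ (divdiff_bound dx x'B t s); have := h _ (divdiff_bound dy y'B t s).
by rewrite /chord_ratio; lra.
Qed.

Hypotheses (px : periodic2pi x) (py : periodic2pi y)
  (px' : periodic2pi x') (py' : periodic2pi y').
Hypothesis simple : forall t s, 0 < `|t - s| < l -> ~ (x t = x s /\ y t = y s).
Hypothesis regular : forall t, 0 < x' t ^+ 2 + y' t ^+ 2.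

Lemma chord_ratio_gt0 t s : `|t - s| < l -> 0 < chord_ratio t s.
Proof.
move=> ts; have [->|nts] := eqVneq t s; first by rewrite chord_ratio_diag.
have ts0 : 0 < (t - s) ^+ 2 by rewrite exprn_even_gt0// subr_eq0.
rewrite -(pmulr_rgt0 _ ts0) -chord_ratioE lt_neqAle addr_ge0 ?sqr_ge0// andbT.
apply/eqP => e; apply: (@simple t s); first by rewrite normr_gt0 subr_eq0 nts.
move/esym/eqP : e; rewrite paddr_eq0 ?sqr_ge0// !sqrf_eq0 !subr_eq0.
by move=> /andP[/eqP -> /eqP ->].
Qed.

(** The window has to be longer than [pi], so that it contains neighbourhoods
   of all parameter values, and shorter than the period. *)
Definition window : R := 3 / 2 * pi.

(** Compactness, once [s] is brought into one period. *)
Lemma chord_ratio_ge : exists2 m, 0 < m &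
  forall t s, `|t - s| <= window -> m <= chord_ratio t s.
Proof.
have pi0 := pi_gt0 R.
pose f (p : R * R) := chord_ratio (p.1 + p.2) p.1.
pose K : set (R * R) := `[0, l]%classic `*` `[- window, window]%classic.
have cK : compact K by apply: compact_setX; exact: segment_compact.
have K0 : K !=set0.
  by exists (0, 0); split; rewrite /= in_itv/= /window; apply/andP; split; lra.
have cf : continuous f.
  move=> p; apply/cvgrPdist_lt => eps eps0.
  pose c := 4 * B ^+ 2 * 3 + 1.
  have c0 : 0 < c by rewrite /c; have := sqr_ge0 B; lra.
  have ec : 0 < eps / c by rewrite divr_gt0.
  exists (ball p.1 (eps / c), ball p.2 (eps / c)); first by split; exact: nbhsx_ballx.
  move=> q [/= h1 h2]; rewrite /f.
  apply: (le_lt_trans (chord_ratio_lipschitz _ _ _ _)).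
  have h3 : `|p.1 + p.2 - (q.1 + q.2)| <= `|p.1 - q.1| + `|p.2 - q.2|.
    by rewrite opprD addrACA ler_normD.
  have {}h1 : `|p.1 - q.1| < eps / c by [].
  have {}h2 : `|p.2 - q.2| < eps / c by [].
  apply: (@le_lt_trans _ _ (4 * B ^+ 2 * (3 * (eps / c)))).
    apply: ler_wpM2l; first by have := sqr_ge0 B; lra.
    have -> : 3 * (eps / c) = eps / c + eps / c + eps / c by ring.
    by rewrite lerD ?(ltW h1)// (le_trans h3)// lerD// ltW.
  have cE : (4 * B ^+ 2 * 3 + 1) * (eps / c) = eps.
    by rewrite mulrC divfK// gt_eqF.
  by move: (eps / c) ec cE => e; lra.
have [c cKc hc] := compact_EVT_min K0 cK (continuous_subspaceT cf).
exists (f c).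
  apply: chord_ratio_gt0; rewrite addrAC subrr add0r.
  move/set_mem : cKc => [_]; rewrite /= in_itv/= -ler_norml /window => h.
  by apply: (le_lt_trans h); lra.
move=> t s ts; have [z /andP[z0 z1]] := period_reduce s.
have -> : chord_ratio t s = chord_ratio (t + z%:~R * l) (s + z%:~R * l).
  rewrite /chord_ratio /divdiff (inj_eq (addIr _)) !(periodic_int _ _ px) !(periodic_int _ _ py).
  rewrite !(periodic_int _ _ px') !(periodic_int _ _ py').
  by have -> : t + z%:~R * l - (s + z%:~R * l) = t - s by ring.
have -> : chord_ratio (t + z%:~R * l) (s + z%:~R * l) = f (s + z%:~R * l, t - s).
  by rewrite /f /=; congr chord_ratio; ring.
by apply: hc; apply/mem_set; split; rewrite /= in_itv/= ?z0 ?(ltW z1)// -ler_norml.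
Qed.

Lemma log_chord_ratio : exists C, 0 <= C /\
  forall s t t', `|t - s| <= window -> `|t' - s| <= window ->
  `|ln (chord_ratio t s) - ln (chord_ratio t' s)| <= C * `|t - t'| /\
  `|ln (chord_ratio t s)| <= C.
Proof.
have [m m0 hm] := chord_ratio_ge.
have B2 := sqr_ge0 B.
have im : 0 < m^-1 by rewrite invr_gt0.
have a0 : 0 <= 4 * B ^+ 2 / m.
  by apply: mulr_ge0; [apply: mulr_ge0|exact: ltW].
exists (4 * B ^+ 2 / m + 2 * B ^+ 2 + m^-1); split.
  by move: (4 * B ^+ 2 / m) a0 => z z0; lra.
have lnle (z : R) : 0 < z -> ln z <= z - 1.
  move=> h; have := @le_ln1Dx R (z - 1).
  by rewrite (_ : 1 + (z - 1) = z); [apply; lra|ring].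
have lip t t' s : m <= chord_ratio t s -> m <= chord_ratio t' s ->
    ln (chord_ratio t s) - ln (chord_ratio t' s) <= 4 * B ^+ 2 / m * `|t - t'|.
  move=> h h'; have q0 := lt_le_trans m0 h; have q0' := lt_le_trans m0 h'.
  rewrite -ln_div ?posrE// (le_trans (lnle _ _)) ?divr_gt0//.
  have -> : chord_ratio t s / chord_ratio t' s - 1 =
      (chord_ratio t s - chord_ratio t' s) / chord_ratio t' s.
    by rewrite mulrBl divff ?gt_eqF.
  have := chord_ratio_lipschitz t s t' s; rewrite subrr normr0 addr0 => hl.
  apply: (@le_trans _ _ (`|chord_ratio t s - chord_ratio t' s| / m)).
    apply: (@le_trans _ _ (`|chord_ratio t s - chord_ratio t' s| / chord_ratio t' s)).
      by rewrite ler_wpM2r ?ler_norm// invr_ge0 (ltW q0').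
    by rewrite ler_wpM2l// lef_pV2.
  by rewrite mulrAC ler_pM2r.
move=> s t t' /hm h /hm h'; split.
  apply: (@le_trans _ _ (4 * B ^+ 2 / m * `|t - t'|)).
    rewrite ler_norml lerNl opprB lip// andbT.
    by have := lip _ _ _ h' h; rewrite distrC.
  by rewrite ler_wpM2r//; move: (4 * B ^+ 2 / m) => z; lra.
have q0 := lt_le_trans m0 h.
rewrite ler_norml; apply/andP; split.
  rewrite lerNl -lnV ?posrE// (le_trans (lnle _ _)) ?invr_gt0//.
  have : (chord_ratio t s)^-1 <= m^-1 by rewrite lef_pV2.
  by have := im; lra.
rewrite (le_trans (lnle _ _))//.
by have := chord_ratio_le t s; have := im; lra.
Qed.

End LoopChord.

(** * Fourier coefficients of Lipschitz functions *)

Section ShiftBessel.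
Context {R : realType}.
Local Notation l := (2 * pi : R).
Local Notation mu := (@period_measure R).
Implicit Types (j n : nat) (t s : R).

Lemma normr_sin_le (u : R) : `|sin u| <= `|u|.
Proof.
have := derive_lipschitz (@is_derive_sin R) (@cos_max R) u 0.
by rewrite sin0 !subr0 mul1r.
Qed.

Lemma half_le_sin (u : R) : 0 <= u <= 1 -> u / 2 <= sin u.
Proof.
move=> /andP[u0 u1]; have [c + ] := mean_value 0 u (@is_derive_sin R).
rewrite sin0 !subr0 => hc ->; rewrite mulrC ler_wpM2r//.
have /andP[c0 c1] : 0 <= c <= 1.
  by case/orP : hc => /andP[? ?]; apply/andP; split; lra.
have -> : cos c = 1 - chord c by rewrite /chord opprB addrC subrK.
rewrite chordE; have := normr_sin_le (c / 2).
rewrite (@ger0_norm _ (c / 2)) ?divr_ge0// => h.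
have : sin (c / 2) ^+ 2 <= (c / 2) ^+ 2.
  by rewrite -(real_normK (num_real (sin _))) ler_pXn2r ?nnegrE ?divr_ge0.
by nra.
Qed.

(** Exchanges the cosine and the sine of the same frequency. *)
Definition conjugate j : nat := if j is 0 then 0%N else if odd j then j.+1 else j.-1.

Lemma conjugateK : involutive conjugate.
Proof.
case=> [//|j]; rewrite /conjugate; case oj: (odd j.+1) => /=.
  by move: oj => /= ->.
by case: j oj => [//|j] /=; rewrite negbK => ->.
Qed.

Lemma uphalf_conjugate j : uphalf (conjugate j) = uphalf j.
Proof. by case: j => [//|j]; rewrite /conjugate; case oj: (odd j.+1) => /=; move: oj => /=; lia. Qed.

Lemma trig_conjugate j t : (0 < j)%N -> trig (conjugate j) t = (wave_norm j)^-1 *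
  (if odd j then sin ((uphalf j)%:R * t) else cos ((uphalf j)%:R * t)) :> R.
Proof.
move=> j0; rewrite /trig /wave uphalf_conjugate.
have -> : wave_norm (conjugate j) = wave_norm j :> R.
  case: j j0 => [//|j] _; rewrite /wave_norm/=; case oj: (odd j) => //=.
  by case: j oj.
congr (_ * _); case: j j0 => [//|j] _; rewrite /conjugate; case oj: (odd j.+1) => /=.
  by move: oj => /= ->.
by case: j oj => [//|j] /=; rewrite negbK => ->.
Qed.

Lemma sqr_inner_shift (phi : R -> R) (h : R) j :
  bounded_mfun (phi : measurableTypeR R -> R) -> periodic2pi phi ->
  inner mu (fun t => phi (t + h) - phi (t - h)) (trig (conjugate j)) ^+ 2 =
  4 * sin ((uphalf j)%:R * h) ^+ 2 * inner mu phi (trig j) ^+ 2.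
Proof.
move=> bphi pphi; have [mphi [Bp hB]] := bphi.
have bshift (a : R) : bounded_mfun (fun t : measurableTypeR R => phi (t + a)).
  split; last by exists Bp => t; exact: hB.
  by apply: measurableT_comp => //; exact: measurable_funD.
have swap (g : R -> R) (a : R) : bounded_mfun (g : measurableTypeR R -> R) -> periodic2pi g ->
    total mu (fun t => phi (t + a) * g t) = total mu (fun t => phi t * g (t - a)).
  move=> bg pg; have m : measurable_fun setT (fun t : measurableTypeR R => phi t * g (t - a)).
    apply: measurable_funM => //; case: bg => mg _.
    by apply: measurableT_comp => //; exact: measurable_funB.
  rewrite -(total_shift a m); first by congr total; apply/funext => t; rewrite addrK.
  by move=> t; rewrite pphi addrAC pg.
have bt := bounded_trig (R := R) (conjugate j).
have s1 (a : R) : summable1 mu (fun t => phi (t + a) * trig (conjugate j) t).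
  exact/bounded_mfun_summable1/bounded_mfunM.
have s2 (a : R) : summable1 mu (fun t => phi t * trig (conjugate j) (t - a)).
  apply/bounded_mfun_summable1/bounded_mfunM => //; case: bt => m [B hb]; split.
    by apply: measurableT_comp => //; exact: measurable_funB.
  by exists B => t.
have -> : inner mu (fun t => phi (t + h) - phi (t - h)) (trig (conjugate j)) =
    total mu (fun t => phi t * (trig (conjugate j) (t - h) - trig (conjugate j) (t + h))).
  have pt := periodic_trig (R := R) (conjugate j).
  have := swap _ h bt pt; have := swap _ (- h) bt pt; rewrite opprK => e1 e2.
  have -> : total mu (fun t => phi t * (trig (conjugate j) (t - h) - trig (conjugate j) (t + h))) =
     total mu (fun t => phi t * trig (conjugate j) (t - h)) - total mu (fun t => phi t * trig (conjugate j) (t + h)).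
    have := s2 (- h); rewrite opprK => s3; rewrite -totalB//.
    by congr total; apply/funext => t; rewrite mulrBr.
  rewrite -e1 -e2 -totalB//.
  by congr total; apply/funext => t; rewrite mulrBl.
case: (posnP j) => [->|j0].
  rewrite !mul0r sin0 expr0n/= mulr0 mul0r.
  rewrite (_ : (fun t => _) = fun=> 0); first by rewrite total0 expr0n.
  apply/funext => t; rewrite (_ : trig _ (t - h) = trig 0 (t + h)) ?subrr ?mulr0//.
  by rewrite /trig /wave/= !mul0r.
set k : R := (uphalf j)%:R.
have hE (c : R) : (forall t, trig (conjugate j) (t - h) - trig (conjugate j) (t + h) =
    c * trig j t) -> total mu (fun t => phi t *
      (trig (conjugate j) (t - h) - trig (conjugate j) (t + h))) ^+ 2 =
    c ^+ 2 * inner mu phi (trig j) ^+ 2.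
  move=> e; rewrite -exprMn -totalZ; last first.
    by apply/bounded_mfun_summable1/bounded_mfunM => //; exact: bounded_trig.
  by congr (_ ^+ 2); congr total; apply/funext => t; rewrite e mulrCA.
have -> : 4 * sin (k * h) ^+ 2 = (2 * sin (k * h)) ^+ 2 by ring.
case oj: (odd j).
  rewrite -[in RHS]sqrrN; apply: hE => t; rewrite !trig_conjugate// oj /trig /wave oj/=.
  by rewrite [_ * (t - h)]mulrBr [_ * (t + h)]mulrDr sinB sinD /k; ring.
apply: hE => t; rewrite !trig_conjugate// oj /trig /wave oj (gtn_eqF j0)/=.
by rewrite [_ * (t - h)]mulrBr [_ * (t + h)]mulrDr cosB cosD /k; ring.
Qed.

(** Bessel's inequality for a difference quotient, in place of the derivative. *)
Lemma lipschitz_bessel (phi : R -> R) (C : R) (J : nat) :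
  bounded_mfun (phi : measurableTypeR R -> R) -> periodic2pi phi ->
  (forall t h, 0 < h <= 1 -> `|phi (t + h) - phi (t - h)| <= 2 * C * h) ->
  \sum_(j < J) (uphalf j)%:R ^+ 2 * inner mu phi (trig j) ^+ 2 <= 4 * C ^+ 2 * l.
Proof.
move=> bphi pphi lip; have [mphi [Bp hB]] := bphi.
(* The step is so small that [half_le_sin] covers all indices below [J]. *)
pose h : R := J.+1%:R^-1.
have h0 : 0 < h by rewrite invr_gt0.
have h1 : h <= 1 by rewrite invf_le1// ler1n.
pose D (t : measurableTypeR R) := phi (t + h) - phi (t - h).
have bD : bounded_mfun D.
  apply: bounded_mfunB.
    split; last by exists Bp => t; exact: hB.
    by apply: measurableT_comp => //; exact: measurable_funD.
  split; last by exists Bp => t; exact: hB.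
  by apply: measurableT_comp => //; exact: measurable_funB.
have e'b j : bounded_mfun (trig (conjugate j) : measurableTypeR R -> R).
  exact: bounded_trig.
have e'o i j : inner mu (trig (conjugate i)) (trig (conjugate j)) = (i == j)%:R.
  by rewrite trig_orthonormal (inj_eq (inv_inj conjugateK)).
have bes := bessel e'b e'o J (bounded_mfun_square_summable mu bD).
have D2 : inner mu D D <= (2 * C * h) ^+ 2 * l.
  rewrite -total_cst; apply: le_total.
  - exact/bounded_mfun_summable1/bounded_mfunM.
  - exact/bounded_mfun_summable1/bounded_mfun_cst.
  - move=> t; rewrite -expr2 -(real_normK (num_real (D t))).
    have le := lip t h; rewrite h0 h1 in le.
    have {}le := le isT; rewrite ler_pXn2r ?nnegrE//.
    exact: le_trans le.
rewrite -(ler_pM2l (exprn_gt0 2 h0)) mulr_sumr.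
apply: (@le_trans _ _ (inner mu D D)); last by apply: (le_trans D2); rewrite le_eqVlt; apply/orP; left; apply/eqP; ring.
apply: le_trans bes; apply: ler_sum => j _; rewrite sqr_inner_shift//.
have : ((uphalf j)%:R * h) / 2 <= sin ((uphalf j)%:R * h).
  apply: half_le_sin; rewrite mulr_ge0 ?(ltW h0)//= ler_pdivrMr// mul1r ler_nat.
  by have := ltn_ord j; lia.
have k0 : 0 <= (uphalf j)%:R * h by rewrite mulr_ge0 ?(ltW h0).
move=> le; rewrite mulrA ler_wpM2r ?sqr_ge0// -exprMn mulrC.
have -> : 4 * sin ((uphalf j)%:R * h) ^+ 2 = (2 * sin ((uphalf j)%:R * h)) ^+ 2 by ring.
by rewrite ler_pXn2r ?nnegrE//; lra.
Qed.

End ShiftBessel.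

(** * The logarithmic kernel of an analytic curve *)

Section CurveKernel.
Context {R : realType}.
Local Notation l := (2 * pi : R).
Local Notation mu := (@period_measure R).
Local Notation T := (measurableTypeR R).
Variables x y : R -> R.
Local Notation x' := (derive1 x).
Local Notation y' := (derive1 y).
Hypotheses (ax : real_analytic x) (ay : real_analytic y).
Hypotheses (px : periodic2pi x) (py : periodic2pi y).
Hypothesis simple : forall t s, 0 < `|t - s| < l -> ~ (x t = x s /\ y t = y s).
Hypothesis regular : forall t, 0 < x' t ^+ 2 + y' t ^+ 2.

Definition sqdist (t s : R) : R := (x t - x s) ^+ 2 + (y t - y s) ^+ 2.

(** The first case is the continuous extension to the diagonal. *)
Definition remainder (z : T * T) : R := - (4 * pi)^-1 *
  (if chord (z.1 - z.2) == 0 then ln (x' z.2 ^+ 2 + y' z.2 ^+ 2)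
   else ln (sqdist z.1 z.2) - ln (2 * chord (z.1 - z.2))).

Definition curve_kernel (z : T * T) : R := circle_kernel z + remainder z.

Lemma curve_kernelE t s : chord (t - s) != 0 ->
  curve_kernel (t, s) = - (4 * pi)^-1 * ln (sqdist t s).
Proof.
move=> c0; rewrite /curve_kernel /circle_kernel /remainder/= (negbTE c0) /log_chord.
have cp : 0 < chord (t - s) by rewrite lt_neqAle eq_sym c0 chord_ge0.
by rewrite lnM ?posrE//; ring.
Qed.

Let circle_ratio := chord_ratio (@cos R) (fun t => - sin t) (@sin R) (@cos R).

Let window_lt : window < l :> R.
Proof. by rewrite /window; have := pi_gt0 R; lra. Qed.

Let sqdist_circle t s : (cos t - cos s) ^+ 2 + (sin t - sin s) ^+ 2 = 2 * chord (t - s) :> R.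
Proof. by rewrite /chord cosB; have := cos2Dsin2 t; have := cos2Dsin2 s; lra. Qed.

Let chord_abs (u : R) : 0 < `|u| < l -> 0 < chord u.
Proof. by case: (ger0P u) => _ h; [exact: chord_gt0|rewrite /chord -cosN; exact: chord_gt0]. Qed.

Lemma remainder_window t s : `|t - s| <= window ->
  remainder (t, s) = - (4 * pi)^-1 * (ln (chord_ratio x x' y y' t s) - ln (circle_ratio t s)).
Proof.
move=> ts; have {}ts := le_lt_trans ts window_lt.
rewrite /remainder/=; congr (_ * _); case: ifPn => [/eqP c0|c0].
  have <- : t = s.
    apply/eqP; rewrite -subr_eq0 -normr_le0 leNgt; apply/negP => h.
    by have := chord_abs (u := t - s); rewrite h ts c0 ltxx => /(_ isT).
  have cq : circle_ratio t t = 1 by rewrite /circle_ratio chord_ratio_diag sqrrN addrC cos2Dsin2.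
  by rewrite chord_ratio_diag cq ln1 subr0.
have nts : t != s by apply: contraNneq c0 => ->; rewrite subrr /chord cos0 subrr.
have ts0 : 0 < (t - s) ^+ 2 by rewrite exprn_even_gt0// subr_eq0.
have c2 : 0 < 2 * chord (t - s) by rewrite mulr_gt0// lt_neqAle eq_sym c0 chord_ge0.
have Q0 := chord_ratio_gt0 simple regular ts.
have eQ := chord_ratioE x x' y y' t s; rewrite -/(sqdist t s) in eQ.
have eC := chord_ratioE (@cos R) (fun t => - sin t) (@sin R) (@cos R) t s.
rewrite sqdist_circle -/circle_ratio in eC.
have C0 : 0 < circle_ratio t s by rewrite -(pmulr_rgt0 _ ts0) -eC.
have l1 : ln (sqdist t s) = ln ((t - s) ^+ 2) + ln (chord_ratio x x' y y' t s).
  by rewrite eQ lnM ?posrE.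
have l2 : ln (2 * chord (t - s)) = ln ((t - s) ^+ 2) + ln (circle_ratio t s).
  by rewrite eC lnM ?posrE.
by rewrite l1 l2; ring.
Qed.

Let px' : periodic2pi x'. Proof. exact: derive_periodic (analytic_derive ax).1 px. Qed.
Let py' : periodic2pi y'. Proof. exact: derive_periodic (analytic_derive ay).1 py. Qed.

Lemma remainder_periodicl s : periodic2pi (fun t => remainder (t, s)).
Proof.
by move=> t; rewrite /remainder/= addrAC chord_periodic /sqdist px py.
Qed.

(** The singularity [ln ((t - s) ^+ 2)] is common to the curve and to the circle,
   and cancels. *)
Lemma remainder_lipschitz : exists C, 0 <= C /\
  forall s t t', `|t - s| <= window -> `|t' - s| <= window ->
  `|remainder (t, s) - remainder (t', s)| <= C * `|t - t'| /\ `|remainder (t, s)| <= C.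
Proof.
have [B1 [B10 dx x'B x'L]] := analytic_periodic_lipschitz ax px.
have [B2 [B20 dy y'B y'L]] := analytic_periodic_lipschitz ay py.
have le1 (z : R) : z <= B1 -> z <= B1 + B2 by move=> h; rewrite (le_trans h)// lerDl.
have le2 (z : R) : z <= B2 -> z <= B1 + B2 by move=> h; rewrite (le_trans h)// lerDr.
have [C1 [C10 hC1]] := log_chord_ratio dx dy (fun t => le1 _ (x'B t)) (fun t => le2 _ (y'B t))
  (fun a b => le_trans (x'L a b) (ler_wpM2r (normr_ge0 _) (le1 _ (lexx _))))
  (fun a b => le_trans (y'L a b) (ler_wpM2r (normr_ge0 _) (le2 _ (lexx _))))
  px py px' py' simple regular.
have [C2 [C20 hC2]] : exists C, 0 <= C /\
  forall s t t', `|t - s| <= window -> `|t' - s| <= window ->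
  `|ln (circle_ratio t s) - ln (circle_ratio t' s)| <= C * `|t - t'| /\
  `|ln (circle_ratio t s)| <= C.
  have dnsin (t : R) : is_derive t 1 (fun t => - sin t) (- cos t).
    exact: is_deriveN (is_derive_sin t).
  have pcos : periodic2pi (@cos R) by move=> t; rewrite -[l]mul1r (cos_period 1).
  have psin : periodic2pi (@sin R) by move=> t; rewrite -[l]mul1r (sin_period 1).
  apply: (@log_chord_ratio _ _ _ _ _ 1 (@is_derive_cos R) (@is_derive_sin R)).
  - by move=> t; rewrite normrN sin_max.
  - exact: cos_max.
  - by apply: (derive_lipschitz dnsin) => t; rewrite normrN cos_max.
  - by apply: (derive_lipschitz (@is_derive_cos R)) => t; rewrite normrN sin_max.
  - exact: pcos.
  - exact: psin.
  - by move=> t; rewrite psin.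
  - exact: pcos.
  - move=> t s /chord_abs c0 [e1 e2]; have := sqdist_circle t s.
    by rewrite e1 e2 !subrr expr0n/= addr0; lra.
  - by move=> t; rewrite sqrrN addrC cos2Dsin2.
pose c : R := (4 * pi)^-1.
have c0 : 0 <= c by rewrite invr_ge0 mulr_ge0// pi_ge0.
exists (c * (C1 + C2)); split; first by rewrite mulr_ge0// addr_ge0.
move=> s t t' ts t's; have [a1 b1] := hC1 _ _ _ ts t's; have [a2 b2] := hC2 _ _ _ ts t's.
rewrite !remainder_window// -/c; split.
  rewrite -mulrBr normrM normrN (ger0_norm c0) -mulrA ler_wpM2l// mulrDl.
  apply: le_trans (lerD a1 a2); apply: le_trans (ler_normB _ _).
  by rewrite le_eqVlt; apply/orP; left; apply/eqP; congr (`| _ |); ring.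
rewrite normrM normrN (ger0_norm c0) ler_wpM2l//.
exact: le_trans (ler_normB _ _) (lerD b1 b2).
Qed.

Let recenter t s : exists z : int, `|t + z%:~R * l - s| <= pi.
Proof.
have [z /andP[h1 h2]] := period_reduce (t - s + pi); exists z.
by rewrite ler_norml; apply/andP; split; lra.
Qed.

Lemma remainder_shift : exists C, [/\ 0 <= C, forall z, `|remainder z| <= C &
  forall s t h, 0 < h <= 1 -> `|remainder (t + h, s) - remainder (t - h, s)| <= 2 * C * h].
Proof.
have [C [C0 hC]] := remainder_lipschitz; exists C.
have pi0 := pi_ge2 R.
split=> // [[t s]|s t h /andP[h0 h1]].
  have [z hz] := recenter t s; rewrite -(periodic_int z t (remainder_periodicl s)).
  have w : `|t + z%:~R * l - s| <= window by apply: (le_trans hz); rewrite /window; lra.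
  by have [] := hC _ _ _ w w.
have [z hz] := recenter t s.
rewrite -(periodic_int z (t + h) (remainder_periodicl s)).
rewrite -(periodic_int z (t - h) (remainder_periodicl s)).
have w1 : `|t + h + z%:~R * l - s| <= window.
  rewrite (_ : _ - s = (t + z%:~R * l - s) + h); last by ring.
  rewrite (le_trans (ler_normD _ _))// (gtr0_norm h0).
  by rewrite (le_trans (lerD hz h1))// /window; lra.
have w2 : `|t - h + z%:~R * l - s| <= window.
  rewrite (_ : _ - s = (t + z%:~R * l - s) - h); last by ring.
  rewrite (le_trans (ler_normB _ _))// (gtr0_norm h0).
  by rewrite (le_trans (lerD hz h1))// /window; lra.
have [+ _] := hC _ _ _ w1 w2; move/le_trans; apply.
rewrite (_ : _ - _ = 2 * h); last by ring.
by rewrite gtr0_norm ?mulr_gt0// mulrCA mulrA.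
Qed.

Let cx : continuous x. Proof. exact: continuous_derivable (analytic_derive ax).1. Qed.
Let cy : continuous y. Proof. exact: continuous_derivable (analytic_derive ay).1. Qed.
Let cx' : continuous x'.
Proof. by have [_ /analytic_derive[+ _]] := analytic_derive ax; exact: continuous_derivable. Qed.
Let cy' : continuous y'.
Proof. by have [_ /analytic_derive[+ _]] := analytic_derive ay; exact: continuous_derivable. Qed.

Lemma measurable_sqdist : measurable_fun setT (fun z : T * T => sqdist z.1 z.2).
Proof.
have mx := continuous_measurable cx; have my := continuous_measurable cy.
by apply: measurable_funD; apply: measurable_funX; apply: measurable_funB;
  (apply: measurable_fst_comp => // || apply: measurable_snd_comp => //).
Qed.

Lemma measurable_remainder : measurable_fun setT remainder.
Proof.
have mx' := continuous_measurable cx'; have my' := continuous_measurable cy'.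
have mln := @measurable_ln R.
have mc : measurable_fun setT (fun z : T * T => chord (z.1 - z.2)).
  apply: (@measurableT_comp _ _ _ _ _ _ (chord : T -> T)).
    exact: continuous_measurable continuous_chord.
  exact: measurable_funB.
apply: measurable_funM => //; apply: measurable_fun_if => //.
- apply: measurable_fun_eqr => //.
- apply: measurable_funTS; apply: measurableT_comp => //.
  by apply: measurable_funD; apply: measurable_funX; apply: measurable_snd_comp.
- apply: measurable_funTS; apply: measurable_funB; apply: measurableT_comp => //.
    exact: measurable_sqdist.
  exact: measurable_funM.
Qed.

Lemma remainder_schur : exists C, schur mu C remainder.
Proof.
have [C [_ hC _]] := remainder_shift.
by eexists; apply: (bounded_schur mu measurable_remainder hC).
Qed.

Lemma curve_kernel_schur : exists C, schur mu C curve_kernel.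
Proof.
have [C1 h1] := @circle_kernel_schur R; have [C2 h2] := remainder_schur.
by exists (C1 + C2); exact: schurD.
Qed.

Lemma adjoint_curve_kernel j s : (0 < j)%N ->
  adjoint_at mu curve_kernel (trig j) s =
  symbol j * trig j s + adjoint_at mu remainder (trig j) s.
Proof.
move=> j0; rewrite -adjoint_circle_kernel//.
have [C1 h1] := @circle_kernel_schur R; have [C2 h2] := remainder_schur.
have s1 (K : T * T -> R) C : schur mu C K -> summable1 mu (fun t => K (t, s) * trig j t).
  move=> sK; have sn := summable1_norm (schur_section_snd s sK).
  apply: (le_summable1 _ sn).
    apply: measurable_funM; last by have [] := bounded_trig (R := R) j.
    exact: summable1_measurable (schur_section_snd s sK).
  by move=> t; rewrite normrM ler_piMr// trig_le.
rewrite /adjoint_at -totalD; [|exact: s1 h1|exact: s1 h2].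
by congr total; apply/funext => t; rewrite /curve_kernel mulrDl.
Qed.

(** Division by the symbol multiplies the coefficient of frequency [k] of the
   remainder by [2 k], which is compensated by Lipschitz continuity. *)
Lemma curve_kernel_diagonal : exists M, forall J, \sum_(j < J)
  inner mu (fun s => (symbol j)^-1 * adjoint_at mu curve_kernel (trig j) s - trig j s)
           (fun s => (symbol j)^-1 * adjoint_at mu curve_kernel (trig j) s - trig j s) <= M.
Proof.
have [C [C0 hC lip]] := remainder_shift.
have [Cr rs] := remainder_schur.
pose k j s := adjoint_at mu remainder (trig j) s.
have bk j : bounded_mfun (k j : T -> R) := adjoint_bounded rs (bounded_trig j).
pose d j := inner mu (fun s => (symbol j)^-1 * adjoint_at mu curve_kernel (trig j) s - trig j s)
           (fun s => (symbol j)^-1 * adjoint_at mu curve_kernel (trig j) s - trig j s).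
have dE j : (0 < j)%N -> d j = total mu (fun s => 4 * ((uphalf j)%:R ^+ 2 * k j s ^+ 2)).
  move=> j0; rewrite /d /inner; congr total; apply/funext => s.
  have k0 : (uphalf j)%:R != 0 :> R by rewrite pnatr_eq0; case: (j) j0.
  have -> : symbol j = (2 * (uphalf j)%:R)^-1 :> R by case: (j) j0.
  rewrite invrK adjoint_curve_kernel//.
  have -> : symbol j = (2 * (uphalf j)%:R)^-1 :> R by case: (j) j0.
  rewrite -/(k j s); move: ((uphalf j)%:R : R) k0 => w w0.
  by field.
exists (d 0%N + 4 * (4 * C ^+ 2 * l) * l); move=> J; rewrite -/(d _).
have d0 : 0 <= d 0%N by exact: inner_ge0.
have b0 : 0 <= 4 * (4 * C ^+ 2 * l) * l.
  by rewrite !mulr_ge0// ?sqr_ge0// pi_ge0.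
case: J => [|J]; first by rewrite big_ord0 addr_ge0.
rewrite big_ord_recl lerD2l.
under eq_bigr do rewrite -/(d _) dE//.
have s4 j : summable1 mu (fun s => 4 * ((uphalf j)%:R ^+ 2 * k j s ^+ 2)).
  by apply/bounded_mfun_summable1/bounded_mfunZ/bounded_mfunZ/bounded_mfunM.
rewrite -total_sum//.
rewrite -total_cst; apply: le_total.
- exact: summable1_sum.
- exact/bounded_mfun_summable1/bounded_mfun_cst.
move=> s; rewrite -mulr_sumr ler_wpM2l//.
have brs : bounded_mfun (fun t : T => remainder (t, s)).
  split; last by exists C => t; exact: hC.
  exact: measurableT_comp measurable_remainder (measurable_pair2 s).
have := @lipschitz_bessel R (fun t => remainder (t, s)) C J.+1 brs (remainder_periodicl s) (lip s).
by rewrite big_ord_recl/= expr0n/= mul0r add0r.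
Qed.

End CurveKernel.

(** * Density and completeness *)

Lemma continuous_sqr (R : realType) (f : R -> R) : continuous f ->
  continuous (fun t => f t ^+ 2).
Proof.
move=> cf; rewrite (_ : (fun t => _) = fun t => f t * f t)//.
by move=> t; apply: cvgM; exact: cf.
Qed.

Section CurveFeatures.
Context {R : realType}.
Local Notation l := (2 * pi : R).
Local Notation mu := (@period_measure R).
Local Notation T := (measurableTypeR R).
Variables x y : R -> R.
Hypotheses (cx : continuous x) (cy : continuous y).
Hypothesis simple : forall t s, 0 < `|t - s| < l -> ~ (x t = x s /\ y t = y s).

Definition radius2 (t : R) : R := x t ^+ 2 + y t ^+ 2.

(** Inverse stereographic projection, up to an affine map: the squared distance
   of two points of the curve becomes [1 - corr] up to factors that depend on
   one of the points only. *)
Definition feature (i : 'I_4) (t : R) : R :=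
  (1 + radius2 t)^-1 * [:: 1; Num.sqrt 2 * x t; Num.sqrt 2 * y t; radius2 t]`_i.

Lemma radius2_ge0 t : 0 <= radius2 t.
Proof. by rewrite addr_ge0 ?sqr_ge0. Qed.

Let p_gt0 t : 0 < 1 + radius2 t.
Proof. by rewrite ltr_pwDl// radius2_ge0. Qed.

Lemma corr_featureE (z : T * T) : corr feature z =
  1 - sqdist x y z.1 z.2 / ((1 + radius2 z.1) * (1 + radius2 z.2)).
Proof.
have p1 := lt0r_neq0 (p_gt0 z.1); have p2 := lt0r_neq0 (p_gt0 z.2).
rewrite /corr !big_ord_recl big_ord0 /feature /= addr0.
have s2 : Num.sqrt 2 * Num.sqrt 2 = 2 :> R by rewrite -expr2 sqr_sqrtr.
transitivity ((1 + radius2 z.1)^-1 * (1 + radius2 z.2)^-1 * (1 +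
  (Num.sqrt 2 * Num.sqrt 2) * (x z.1 * x z.2 + y z.1 * y z.2) + radius2 z.1 * radius2 z.2)).
  by ring.
by rewrite s2 /sqdist; move: p1 p2; rewrite /radius2 => p1 p2; field; rewrite p1 p2.
Qed.

Lemma corr_feature01 z : 0 <= corr feature z <= 1.
Proof.
have q0 : 0 < (1 + radius2 z.1) * (1 + radius2 z.2) by rewrite mulr_gt0.
have d0 : 0 <= sqdist x y z.1 z.2 by rewrite addr_ge0 ?sqr_ge0.
rewrite corr_featureE subr_ge0 gerBl divr_ge0 ?(ltW q0)// andbT.
rewrite ler_pdivrMr// mul1r -subr_ge0.
have -> : (1 + radius2 z.1) * (1 + radius2 z.2) - sqdist x y z.1 z.2 =
  (1 + (x z.1 * x z.2 + y z.1 * y z.2)) ^+ 2 + (x z.1 * y z.2 - y z.1 * x z.2) ^+ 2.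
  by rewrite /radius2 /sqdist; ring.
by rewrite addr_ge0 ?sqr_ge0.
Qed.

Lemma continuous_radius2 : continuous radius2.
Proof.
by move=> t; apply: cvgD; apply: continuous_sqr.
Qed.

Lemma continuous_feature i : continuous (feature i).
Proof.
move=> t; rewrite /feature; apply: cvgM.
  apply: cvgV; first exact: lt0r_neq0.
  by apply: cvgD; [exact: cvg_cst|exact: continuous_radius2].
case: i => [[|[|[|[|//]]]]] ? /=.
- exact: cvg_cst.
- by apply: cvgMr; exact: cx.
- by apply: cvgMr; exact: cy.
- exact: continuous_radius2.
Qed.

Lemma bounded_feature i : bounded_mfun (feature i : T -> R).
Proof.
have mf := @continuous_measurable R (feature i) (@continuous_feature i).
split; first exact: mf.
exists (Num.sqrt 2) => t; have p0 := p_gt0 t; have r0 := radius2_ge0 t.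
have s1 : 1 <= Num.sqrt 2 :> R by rewrite -[leLHS]sqrtr1 ler_sqrt// ler1n.
rewrite /feature normrM gtr0_norm ?invr_gt0// mulrC ler_pdivrMr//.
have le1 z : `|z| <= 1 + radius2 t -> `|Num.sqrt 2 * z| <= Num.sqrt 2 * (1 + radius2 t).
  by move=> h; rewrite normrM ger0_norm ?sqrtr_ge0// ler_wpM2l// sqrtr_ge0.
have le2 (z : R) : z ^+ 2 <= radius2 t -> `|z| <= 1 + radius2 t.
  by move=> h; rewrite ler_norml; apply/andP; split; nra.
case: i {mf} => [[|[|[|[|//]]]]] ? /=.
- by rewrite normr1; nra.
- by apply/le1/le2; rewrite lerDl sqr_ge0.
- by apply/le1/le2; rewrite lerDr sqr_ge0.
- by rewrite ger0_norm//; nra.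
Qed.

(** The algebra contains the normalised squared distance to each point of the
   curve, which vanishes at this point only. *)
Lemma feature_dense phi : square_summable mu phi ->
  approximable mu (word_algebra feature) phi.
Proof.
apply: (@dense_separating_algebra R mu l (word_algebra feature)
          (fun s t => 1 - corr feature (s, t))).
- exact: period_gt0.
- change (@lebesgue_measure R ((~` `]0, l[) `&` period) = 0%E).
  by rewrite /period setICl measure0.
- by move=> a; apply: word_algebra_bounded; exact: bounded_feature.
- exact: word_algebra_cst.
- exact: word_algebraD.
- exact: word_algebraM.
- move=> s; under eq_fun do rewrite -mulN1r.
  apply: word_algebraD; first exact: word_algebra_cst.
  rewrite (_ : (fun t => _) = fun t => \sum_(i <- enum 'I_4) (- feature i s) * feature i t); last first.
    by apply/funext => t; rewrite /corr mulr_sumr big_enum/=; apply: eq_bigr => i _; ring.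
  elim: (enum _) => [|i r IHr].
    by under eq_fun do rewrite big_nil; exact: word_algebra_cst.
  under eq_fun do rewrite big_cons.
  by apply: word_algebraD => //; exact: word_algebra_zeta.
- move=> s t; have /andP[h1 h2] := corr_feature01 (s, t).
  by rewrite subr_ge0 h2 gerBl.
- move=> t s; apply: cvgB; first exact: cvg_cst.
  rewrite /corr !big_ord_recl big_ord0 /=.
  under [X in X @ _]eq_fun do rewrite !big_ord_recl big_ord0 /=.
  by repeat (apply: cvgD; first by apply: cvgMl; exact: continuous_feature); exact: cvg_cst.
- by move=> t; rewrite corr_featureE /sqdist !subrr expr0n/= addr0 mul0r subr0 subrr.
- move=> s t /andP[t0 ts] sl; rewrite corr_featureE/= opprB addrC subrK.
  apply: divr_gt0; last exact: mulr_gt0.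
  rewrite lt_neqAle addr_ge0 ?sqr_ge0// andbT; apply/eqP => /esym/eqP.
  rewrite paddr_eq0 ?sqr_ge0// !sqrf_eq0 !subr_eq0 => /andP[/eqP e1 /eqP e2].
  apply: (@simple s t) => //; rewrite gtr0_norm subr_gt0//.
  by rewrite ts/=; lra.
Qed.

End CurveFeatures.

Section Completeness.
Context {R : realType}.
Local Notation l := (2 * pi : R).
Local Notation mu := (@period_measure R).
Local Notation T := (measurableTypeR R).

Lemma circle_simple (t s : R) : 0 < `|t - s| < l -> ~ (cos t = cos s /\ sin t = sin s).
Proof.
move=> h [e1 e2]; have : 0 < chord (t - s).
  by case: (ger0P (t - s)) h => _ h; [exact: chord_gt0|rewrite /chord -cosN; exact: chord_gt0].
by rewrite /chord cosB e1 e2 -!expr2 cos2Dsin2 subrr ltxx.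
Qed.

Lemma trig_span_cst (c : R) : trig_span (fun=> c).
Proof.
rewrite (_ : (fun=> c) = fun t => c * cos (0%:R * t)).
  by apply: trig_spanZ; exact: trig_span_cos.
by apply/funext => t; rewrite mul0r cos0 mulr1.
Qed.

Lemma circle_word_span (a : T -> R) : word_algebra (feature (@cos R) (@sin R)) a -> trig_span a.
Proof.
have r1 t : radius2 (@cos R) (@sin R) t = 1 by rewrite /radius2 cos2Dsin2.
have hw w : trig_span (word (feature (@cos R) (@sin R)) w).
  elim: w => [|i w IHw].
    rewrite (_ : word _ _ = fun=> 1); first exact: trig_span_cst.
    by apply/funext => t; rewrite /word big_nil.
  rewrite (_ : word _ _ = fun t => feature (@cos R) (@sin R) i t * word (feature (@cos R) (@sin R)) w t); last first.
    by apply/funext => t; rewrite /word big_cons.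
  case: i => [[|[|[|[|//]]]]] ?; rewrite /feature/=.
  - by under eq_fun do rewrite r1; exact: trig_spanZ.
  - under eq_fun do rewrite r1 -!mulrA.
    by do 2 apply: trig_spanZ; exact: trig_span_cosM.
  - under eq_fun do rewrite r1 -!mulrA.
    by do 2 apply: trig_spanZ; exact: trig_span_sinM.
  - by under eq_fun do rewrite r1; exact: trig_spanZ.
move=> [s ->]; apply: trig_span_sum => cw; exact: trig_spanZ.
Qed.

(** On the circle the monomials in the features are trigonometric polynomials. *)
Lemma trig_complete h : square_summable mu h -> forall eps, 0 < eps ->
  exists N, inner mu (fun t => h t - proj mu trig N h t) (fun t => h t - proj mu trig N h t) < eps.
Proof.
move=> sh eps eps0.
have [a /circle_word_span[N [c ->]] lt] :=
  feature_dense (@continuous_cos R) (@continuous_sin R) circle_simple sh eps0.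
exists N; apply: le_lt_trans lt.
by apply: residual_le_comb => //; [exact: bounded_trig|exact: trig_orthonormal].
Qed.

End Completeness.

(** * The projection method for the modified kernel *)

Section RealGalerkin.
Context {R : realType}.
Local Notation l := (2 * pi : R).
Local Notation mu := (@period_measure R).
Local Notation T := (measurableTypeR R).
Variables x y : R -> R.
Local Notation x' := (derive1 x).
Local Notation y' := (derive1 y).
Hypotheses (ax : real_analytic x) (ay : real_analytic y).
Hypotheses (px : periodic2pi x) (py : periodic2pi y).
Hypothesis simple : forall t s, 0 < `|t - s| < l -> ~ (x t = x s /\ y t = y s).
Hypothesis regular : forall t, 0 < x' t ^+ 2 + y' t ^+ 2.

Let cx : continuous x. Proof. exact: continuous_derivable (analytic_derive ax).1. Qed.
Let cy : continuous y. Proof. exact: continuous_derivable (analytic_derive ay).1. Qed.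
Let cx' : continuous x'.
Proof. by have [_ /analytic_derive[+ _]] := analytic_derive ax; exact: continuous_derivable. Qed.
Let cy' : continuous y'.
Proof. by have [_ /analytic_derive[+ _]] := analytic_derive ay; exact: continuous_derivable. Qed.

(** The set is a translate of the set of zeros of [chord], which avoids the open
   period. *)
Lemma chord_neq0_ae t : {ae mu, forall s, chord (t - s) != 0}.
Proof.
have mset : measurable ([set s : T | chord (t - s) = 0]).
  rewrite (_ : [set s | _] = (fun s : T => chord (t - s)) @^-1` [set 0])//.
  rewrite -[X in measurable X]setTI.
  have mc : measurable_fun setT (fun s : T => chord (t - s) : T).
    apply: (@measurableT_comp _ _ _ _ _ _ (chord : T -> T)).
      exact: continuous_measurable continuous_chord.
    exact: measurable_funB.
  by apply: mc => //; exact: measurable_set1.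
exists [set s | chord (t - s) = 0]; split=> //; last first.
  by move=> s /= /negP; rewrite negbK => /eqP.
have mset0 : measurable ([set s : T | chord s = 0]).
  rewrite (_ : [set s | _] = (fun s : T => chord s) @^-1` [set 0])//.
  rewrite -[X in measurable X]setTI.
  have mc : measurable_fun setT (chord : T -> T).
    exact: continuous_measurable continuous_chord.
  by apply: mc => //; exact: measurable_set1.
have e0 : mu [set s | chord s = 0] = 0%E.
  change (@lebesgue_measure R ([set s | chord s = 0] `&` period) = 0%E).
  rewrite (_ : _ `&` _ = set0) ?measure0//; apply/seteqP; split => // s [/= c0].
  by rewrite /period/= in_itv/= => /chord_gt0; rewrite c0 ltxx.
have indicE' (A : set T) : measurable A -> mu A = (\int[mu]_s (\1_A s : R)%:E)%E.
  by move=> mA; rewrite integral_indic// setIT.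
rewrite indicE'// -[RHS]e0 indicE'//.
have pi1 : periodic2pi (fun s : R => (\1_[set s | chord s = 0] s : R)%:E).
  by move=> s; rewrite !indicE; congr (_ %:E); congr ((_ : bool)%:R);
     apply/idP/idP; rewrite !inE/= chord_periodic.
rewrite -[RHS](ge0_integral_period_shift (- t) _ _ pi1)//; last first.
  by apply/measurable_EFinP; exact: measurable_indic.
apply: eq_integral => s _; rewrite !indicE; congr (_ %:E); congr ((_ : bool)%:R).
have e : chord (s - t) = chord (t - s) by rewrite /chord -cosN opprB.
by apply/idP/idP; rewrite !inE/= e.
Qed.

Lemma chord_neq0_ae2 : {ae (mu \x mu)%E, forall z, chord (z.1 - z.2) != 0}.
Proof.
have mc : measurable_fun setT (fun z : T * T => chord (z.1 - z.2) : T).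
  apply: (@measurableT_comp _ _ _ _ _ _ (chord : T -> T)).
    exact: continuous_measurable continuous_chord.
  exact: measurable_funB.
pose N := [set z : T * T | chord (z.1 - z.2) = 0].
have mN : measurable N.
  rewrite (_ : N = (fun z : T * T => chord (z.1 - z.2)) @^-1` [set 0])//.
  by rewrite -[X in measurable X]setTI; apply: mc => //; exact: measurable_set1.
exists N; split => //; last by move=> z /= /negP; rewrite negbK => /eqP.
transitivity (\int[mu]_t mu (xsection N t))%E; first by [].
rewrite integral0_eq// => t _.
have [A [mA A0 hA]] := chord_neq0_ae t.
apply/eqP; rewrite -measure_le0 -A0; apply: le_measure; rewrite ?inE//.
  exact: measurable_xsection.
move=> s; rewrite /xsection/= inE => /= c0; apply: hA => /= /eqP; exact.
Qed.

Lemma curve_kernel_log (z : T * T) : chord (z.1 - z.2) != 0 ->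
  corr (feature x y) z < 1 /\ curve_kernel x y z = (4 * pi)^-1 *
   (- ln (1 - corr (feature x y) z) - ln (1 + radius2 x y z.1) - ln (1 + radius2 x y z.2)).
Proof.
move=> c0; have p0 t : 0 < 1 + radius2 x y t by rewrite ltr_pwDl// radius2_ge0.
have [k hk] : exists k : int, `|z.1 + k%:~R * l - z.2| <= pi.
  have [k /andP[h1 h2]] := period_reduce (z.1 - z.2 + pi); exists k.
  by rewrite ler_norml; apply/andP; split; lra.
have q0 := mulr_gt0 (p0 z.1) (p0 z.2).
have d0 : 0 < sqdist x y z.1 z.2.
  rewrite lt_neqAle addr_ge0 ?sqr_ge0// andbT; apply/eqP => /esym/eqP.
  rewrite paddr_eq0 ?sqr_ge0// !sqrf_eq0 !subr_eq0 => /andP[/eqP e1 /eqP e2].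
  apply: (@simple (z.1 + k%:~R * l) z.2); last by rewrite !(periodic_int _ _ px) !(periodic_int _ _ py).
  rewrite (le_lt_trans hk) ?andbT; last by have := pi_gt0 R; lra.
  rewrite normr_gt0; apply: contraNneq c0 => e.
  have <- := periodic_int k (z.1 - z.2) (@chord_periodic R).
  by rewrite addrAC e /chord cos0 subrr.
rewrite corr_featureE; split; first by rewrite gtrBl divr_gt0.
have -> : curve_kernel x y z = - (4 * pi)^-1 * ln (sqdist x y z.1 z.2).
  by case: z c0 {k hk q0 d0} => t s; exact: curve_kernelE.
by rewrite subKr ln_div ?posrE// lnM ?posrE//; ring.
Qed.

Lemma bounded_log_radius : bounded_mfun (fun t : T => ln (1 + radius2 x y t)).
Proof.
have cr : continuous (fun t => 1 + radius2 x y t).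
  by move=> t; apply: cvgD; [exact: cvg_cst|exact: continuous_radius2].
split.
  by apply: measurableT_comp; [exact: measurable_ln|exact: continuous_measurable cr].
have pr : periodic2pi (fun t => 1 + radius2 x y t) by move=> t; rewrite /radius2 px py.
have [B [B0 hB]] := periodic_bounded cr pr.
exists B => t; have r0 := radius2_ge0 x y t.
have p0 : 0 < 1 + radius2 x y t by lra.
rewrite ger0_norm; last by rewrite ln_ge0// lerDl.
by rewrite (le_trans (ltW (ln_sublinear p0)))// (le_trans (ler_norm _)).
Qed.

Definition speed (t : R) : R := Num.sqrt (x' t ^+ 2 + y' t ^+ 2).

Let speed_gt0 t : 0 < speed t. Proof. by rewrite sqrtr_gt0. Qed.

Let continuous_speed : continuous speed.
Proof.
move=> t; apply: continuous_comp; last exact: sqrt_continuous.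
by apply: cvgD; apply: continuous_sqr.
Qed.

Let periodic_speed : periodic2pi speed.
Proof.
move=> t; rewrite /speed (derive_periodic (analytic_derive ax).1 px).
by rewrite (derive_periodic (analytic_derive ay).1 py).
Qed.

Lemma bounded_speed : bounded_mfun (speed : T -> R).
Proof.
split; first exact: continuous_measurable continuous_speed.
by have [B [_ hB]] := periodic_bounded continuous_speed periodic_speed; exists B.
Qed.

Lemma total_speed_gt0 : 0 < total mu speed.
Proof.
have cv : continuous (fun t => (speed t)^-1).
  by move=> t; apply: cvgV; [exact: lt0r_neq0|exact: continuous_speed].
have pv : periodic2pi (fun t => (speed t)^-1) by move=> t; rewrite periodic_speed.
have [B [_ hB]] := periodic_bounded cv pv.
have B0 : 0 < B by apply: lt_le_trans (hB 0); rewrite normr_gt0 invr_neq0// lt0r_neq0.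
apply: (@lt_le_trans _ _ (total mu (fun=> B^-1))).
  by rewrite total_cst mulr_gt0 ?invr_gt0// period_gt0.
apply: le_total.
- exact/bounded_mfun_summable1/bounded_mfun_cst.
- exact/bounded_mfun_summable1/bounded_speed.
- move=> t; rewrite -[leRHS]invrK lef_pV2 ?posrE ?invr_gt0//.
  by apply: le_trans (hB t); exact: ler_norm.
Qed.

(** The hypotheses of the abstract quasi-optimality result hold for the curve. *)
Theorem curve_quasi_optimal : exists c : R, 0 < c /\
  forall (psi f : T -> R) (a : nat -> R) (n : nat),
  square_summable mu psi -> square_summable mu f -> (0 < n)%N ->
  (forall j, (j < n.*2.+1)%N ->
    modified_form mu (curve_kernel x y) speed (comb trig a n.*2.+1) (trig j) =
    modified_form mu (curve_kernel x y) speed psi (trig j) + inner mu f (trig j)) ->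
  (forall b, (forall j, (j < n.*2.+1)%N ->
      modified_form mu (curve_kernel x y) speed (comb trig b n.*2.+1) (trig j) = 0) ->
    forall j, (j < n.*2.+1)%N -> b j = 0) ->
  inner mu (fun t => psi t - comb trig a n.*2.+1 t) (fun t => psi t - comb trig a n.*2.+1 t) <=
  c * (n%:R ^+ 2 * inner mu f f +
    inner mu (fun t => psi t - proj mu trig n.*2.+1 psi t)
          (fun t => psi t - proj mu trig n.*2.+1 psi t)).
Proof.
have [C VC] := curve_kernel_schur ax ay px py simple regular.
have [M hM] := curve_kernel_diagonal ax ay px py simple regular.
have uph j : (0 < j)%N -> symbol j = (2 * (uphalf j)%:R)^-1 :> R by case: j.
have up1 j : (0 < j)%N -> 1 <= (uphalf j)%:R :> R by move=> j0; rewrite ler1n; case: j j0.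
apply: (@galerkin_quasi_optimal _ T R mu trig (@bounded_trig R) (@trig_orthonormal R)
  (@trig_complete R) (curve_kernel x y) C VC speed bounded_speed total_speed_gt0
  symbol 1 _ _ (@total_trig R) M hM _ 2).
- move=> j; case: (posnP j) => [->|j0]; first exact: ltr01.
  by rewrite uph// invr_gt0 mulr_gt0// (lt_le_trans _ (up1 _ j0)).
- move=> j; case: (posnP j) => [->|j0]; first exact: lexx.
  by rewrite uph// invf_le1 ?mulr_gt0 ?(lt_le_trans _ (up1 _ j0))//; have := up1 _ j0; lra.
- have k0 : 0 < (4 * pi)^-1 :> R by rewrite invr_gt0 mulr_gt0// pi_gt0.
  apply: (energy_weak (bounded_feature cx cy) (corr_feature01 x y) VC bounded_log_radius k0).
    case: chord_neq0_ae2 => N [mN N0 hN]; exists N; split=> // z hz; apply: hN => /= c0.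
    by apply: hz; exact: curve_kernel_log.
  exact: feature_dense.
- move=> n j n0 jn; case: (posnP j) => [->|j0].
    by rewrite /symbol invr1 -natrM ler1n muln_gt0.
  rewrite uph// invrK ler_wpM2l// ler_nat.
  by move: jn; rewrite ltnS; lia.
Qed.

End RealGalerkin.

(** * Complex-valued functions on the period *)

Section PeriodIntegral.
Local Open Scope complex_scope.
Context {R : realType}.
Local Notation l := (2 * pi : R).
Local Notation leb := (@lebesgue_measure R).
Local Notation mu := (@period_measure R).
Local Notation T := (measurableTypeR R).
Implicit Types (f g : R -> R[i]) (h : T -> R).

Lemma integral_total (F h : T -> R) : measurable_fun setT h ->
  (forall t, period t -> F t = h t) -> \int[leb]_(t in period) F t = total mu h.
Proof.
move=> mh Fh; rewrite /total /Rintegral integral_period; last exact/measurable_EFinP.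
by congr fine; apply: eq_integral => t /set_mem /Fh ->.
Qed.

Definition re f : T -> R := (fun t => complex.Re (f t)) \_ period.
Definition im f : T -> R := (fun t => complex.Im (f t)) \_ period.

Lemma reE f t : period t -> complex.Re (f t) = re f t.
Proof. by move=> pt; rewrite /re patchE mem_set. Qed.

Lemma imE f t : period t -> complex.Im (f t) = im f t.
Proof. by move=> pt; rewrite /im patchE mem_set. Qed.

Lemma measurable_re f : in_L2 f -> measurable_fun setT (re f).
Proof. by case=> m _ _; apply/(measurable_restrictT _ measurable_period). Qed.

Lemma measurable_im f : in_L2 f -> measurable_fun setT (im f).
Proof. by case=> _ m _; apply/(measurable_restrictT _ measurable_period). Qed.

Let sqr_sum f : in_L2 f -> (\int[mu]_t (re f t ^+ 2 + im f t ^+ 2)%:E < +oo)%E.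
Proof.
move=> hf; have [_ _ fin] := hf.
have mr := measurable_re hf; have mi := measurable_im hf.
have m : measurable_fun setT (fun t : T => (re f t ^+ 2 + im f t ^+ 2)%:E).
  by apply/measurable_EFinP/measurable_funD; apply: measurable_funX.
rewrite ge0_integral_period//; last by move=> t; rewrite lee_fin addr_ge0 ?sqr_ge0.
rewrite (@eq_integral _ _ _ leb _ (fun t => (cmod2 (f t))%:E))// => t /set_mem pt.
by rewrite /cmod2 (reE _ pt) (imE _ pt).
Qed.

Lemma in_L2_summable f : in_L2 f -> summable1 mu (fun t => re f t ^+ 2 + im f t ^+ 2).
Proof.
move=> hf; have mr := measurable_re hf; have mi := measurable_im hf.
apply/integrableP; split.
  by apply/measurable_EFinP/measurable_funD; apply: measurable_funX.
rewrite (@eq_integral _ _ _ mu _ (fun t => (re f t ^+ 2 + im f t ^+ 2)%:E)) ?sqr_sum//.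
by move=> t _ /=; rewrite ger0_norm// addr_ge0 ?sqr_ge0.
Qed.

Lemma square_summable_re f : in_L2 f -> square_summable mu (re f).
Proof.
move=> hf; have mr := measurable_re hf; split=> //.
apply: (le_summable1 _ (in_L2_summable hf)); first exact: measurable_funX.
by move=> t; rewrite ger0_norm ?sqr_ge0// lerDl sqr_ge0.
Qed.

Lemma square_summable_im f : in_L2 f -> square_summable mu (im f).
Proof.
move=> hf; have mi := measurable_im hf; split=> //.
apply: (le_summable1 _ (in_L2_summable hf)); first exact: measurable_funX.
by move=> t; rewrite ger0_norm ?sqr_ge0// lerDr sqr_ge0.
Qed.

Lemma sqr_L2norm f (u w : T -> R) : square_summable mu u -> square_summable mu w ->
  (forall t, period t -> f t = u t +i* w t) ->
  L2norm f ^+ 2 = inner mu u u + inner mu w w.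
Proof.
move=> su sw fE; have [mu_ su2] := su; have [mw sw2] := sw.
have -> : L2norm f = Num.sqrt (inner mu u u + inner mu w w).
  congr Num.sqrt; rewrite -totalD; try by rewrite -/(_ ^+ 2).
  rewrite -(integral_total (F := fun t => cmod2 (f t)))//.
    by apply: measurable_funD; apply: measurable_funM.
  by move=> t /fE ->; rewrite /cmod2 !expr2.
by rewrite sqr_sqrtr// addr_ge0 ?inner_ge0.
Qed.

Lemma L2innerE f g (u w p q : T -> R) :
  measurable_fun setT u -> measurable_fun setT w ->
  (forall t, period t -> f t = u t +i* w t) ->
  (forall t, period t -> g t = p t +i* q t) ->
  summable1 mu (fun t => u t * p t) -> summable1 mu (fun t => w t * q t) ->
  summable1 mu (fun t => w t * p t) -> summable1 mu (fun t => u t * q t) ->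
  L2inner f g = (inner mu u p + inner mu w q) +i* (inner mu w p - inner mu u q).
Proof.
move=> mu_ mw fE gE s1 s2 s3 s4; rewrite /L2inner /cintegral /inner -totalD// -totalB//.
congr (_ +i* _); apply: integral_total.
- exact: summable1_measurable (summable1D s1 s2).
- by move=> t pt; rewrite fE// gE//=; ring.
- exact: summable1_measurable (summable1B s3 s4).
- by move=> t pt; rewrite fE// gE//=; ring.
Qed.

End PeriodIntegral.

(** * The modified Symm operator *)

Section SymmOperator.
Local Open Scope complex_scope.
Context {R : realType}.
Local Notation l := (2 * pi : R).
Local Notation leb := (@lebesgue_measure R).
Local Notation mu := (@period_measure R).
Local Notation T := (measurableTypeR R).
Variable gamma : R -> R * R.
Local Notation x := (fst \o gamma).
Local Notation y := (snd \o gamma).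
Local Notation V := (curve_kernel x y).
Local Notation v := (speed x y).
Local Notation L := (total mu v).
Hypotheses (ax : real_analytic x) (ay : real_analytic y).
Hypotheses (px : periodic2pi x) (py : periodic2pi y).
Hypothesis simple : forall t s, 0 < `|t - s| < l -> ~ (x t = x s /\ y t = y s).
Hypothesis regular : forall t, 0 < derive1 x t ^+ 2 + derive1 y t ^+ 2.

(** This kernel differs from [curve_kernel] on the diagonal, modulo the period,
   only. *)
Definition log_kernel (z : T * T) : R :=
  - (2 * pi)^-1 * ln (enorm (gamma z.1 - gamma z.2)).

Lemma enormE t s : enorm (gamma t - gamma s) = Num.sqrt (sqdist x y t s).
Proof. by []. Qed.

Lemma measurable_log_kernel : measurable_fun setT log_kernel.
Proof.
apply: measurable_funM => //; apply: measurableT_comp; first exact: measurable_ln.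
apply: (@measurableT_comp _ _ _ _ _ _ (@Num.sqrt R : T -> T) _ (fun z : T * T => sqdist x y z.1 z.2)).
  exact: continuous_measurable (@sqrt_continuous R).
exact: measurable_sqdist.
Qed.

Lemma log_kernelE z : chord (z.1 - z.2) != 0 -> log_kernel z = V z.
Proof.
move=> c0; have -> : V z = - (4 * pi)^-1 * ln (sqdist x y z.1 z.2).
  by case: z c0 => t s c0; exact: curve_kernelE.
rewrite /log_kernel enormE.
have d0 : 0 <= sqdist x y z.1 z.2 by rewrite addr_ge0 ?sqr_ge0.
have pi0 : pi != 0 :> R by rewrite gt_eqF ?pi_gt0.
have [e|d1] := eqVneq (sqdist x y z.1 z.2) 0.
  by rewrite e sqrtr0 ln0// !mulr0.
have s0 : 0 < Num.sqrt (sqdist x y z.1 z.2) by rewrite sqrtr_gt0 lt_neqAle eq_sym d1.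
rewrite -[in RHS](sqr_sqrtr d0) lnXn// -mulr_natr.
by move: (pi : R) pi0 (ln _) => w w0 a; field.
Qed.

Lemma log_kernel_schur : exists C, schur mu C log_kernel.
Proof.
have [C [mV V1 V2]] := curve_kernel_schur ax ay px py simple regular.
have mW := measurable_log_kernel.
exists C; split=> // [t|s].
- apply: le_trans (V1 t); rewrite le_eqVlt; apply/orP; left; apply/eqP.
  apply: ae_eq_integral => //.
  + by apply/measurable_EFinP; apply: measurableT_comp => //; exact: measurableT_comp mW _.
  + by apply/measurable_EFinP; apply: measurableT_comp => //; exact: measurableT_comp mV _.
  + by apply: ae_impl (chord_neq0_ae t) => s /= c0 _; rewrite log_kernelE.
- apply: le_trans (V2 s); rewrite le_eqVlt; apply/orP; left; apply/eqP.
  apply: ae_eq_integral => //.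
  + by apply/measurable_EFinP; apply: measurableT_comp => //; exact: measurableT_comp mW _.
  + by apply/measurable_EFinP; apply: measurableT_comp => //; exact: measurableT_comp mV _.
  + apply: ae_impl (chord_neq0_ae s) => t /= c0 _; rewrite log_kernelE//.
    by rewrite /chord -cosN opprB.
Qed.

Lemma form_log_kernel h f : square_summable mu h -> square_summable mu f ->
  form mu log_kernel h f = form mu V h f.
Proof.
move=> sh sf; have [C hC] := log_kernel_schur.
have [C' hC'] := curve_kernel_schur ax ay px py simple regular.
have /integrableP[m1 _] := schur_summable1 hC sh sf.
have /integrableP[m2 _] := schur_summable1 hC' sh sf.
rewrite /form /total /Rintegral; congr fine; apply: ae_eq_integral => //.
by apply: ae_impl (@chord_neq0_ae2 R) => z c0 _ /=; rewrite log_kernelE.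
Qed.

Let sv : square_summable mu v.
Proof. exact/bounded_mfun_square_summable/bounded_speed. Qed.

Let k0 (t : T) : R := L^-1 * (1 - apply_at mu log_kernel v t).

Let bounded_k0 : bounded_mfun k0.
Proof.
have [C hC] := log_kernel_schur.
apply: bounded_mfunZ; apply: bounded_mfunB; first exact: bounded_mfun_cst.
have [mv [B vB]] := bounded_speed ax ay px py.
split; first exact: measurable_apply_at hC sv.
exists (B * C) => t; have st := summable1_norm (schur_section_fst t hC).
have s1 : summable1 mu (fun s => log_kernel (t, s) * v s).
  apply: (le_summable1 _ (summable1Z B st)).
    apply: measurable_funM => //; exact: summable1_measurable (schur_section_fst t hC).
  by move=> s /=; rewrite normrM mulrC ler_wpM2r.
rewrite /apply_at (le_trans (normr_total s1))//.
apply: (@le_trans _ _ (total mu (fun s => B * `|log_kernel (t, s)|))).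
  apply: le_total; [exact: summable1_norm|exact: summable1Z|].
  by move=> s; rewrite normrM mulrC ler_wpM2r.
have B0 : 0 <= B by apply: le_trans (vB 0).
rewrite totalZ// ler_wpM2l//.
have [_ K1 _] := hC.
rewrite -lee_fin /total /Rintegral fineK ?K1//.
exact/integrable_fin_num.
Qed.

Lemma curve_lengthE : curve_length gamma = L.
Proof.
apply: integral_total => //.
by have [] := bounded_speed ax ay px py.
Qed.

(** The modification depends on the first variable only. *)
Lemma symm_kernelE t s : symm_kernel gamma t s = log_kernel (t, s) + k0 t.
Proof.
have [C hC] := log_kernel_schur.
have [mv [B vB]] := bounded_speed ax ay px py.
have st := summable1_norm (schur_section_fst (t : T) hC).
have mW : measurable_fun setT (fun u => log_kernel (t, u)).
  exact: summable1_measurable (schur_section_fst (t : T) hC).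
have s1 : summable1 mu (fun u => log_kernel (t, u) * v u).
  apply: (le_summable1 _ (summable1Z B st)); first exact: measurable_funM.
  by move=> u /=; rewrite normrM mulrC ler_wpM2r.
rewrite /symm_kernel curve_lengthE.
have -> : \int[leb]_(u in period) (ln (enorm (gamma t - gamma u)) * enorm (velocity gamma u)) =
    - (2 * pi) * apply_at mu log_kernel v t.
  rewrite -totalZ//; apply: integral_total; first exact: summable1_measurable (summable1Z _ s1).
  move=> u _; rewrite /log_kernel/= -[enorm (velocity _ _)]/(v u).
  have pi0 : 2 * pi != 0 :> R by rewrite gt_eqF ?period_gt0.
  by rewrite -mulrA !mulNr mulrN opprK mulrA mulfV// mul1r.
rewrite /k0 -addrA; congr (_ + _).
have pi0 : pi != 0 :> R by rewrite gt_eqF ?pi_gt0.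
move: (pi : R) pi0 (L^-1) (apply_at _ _ _ _) => w w0 a b.
by field.
Qed.

Definition symm_kernel2 (z : T * T) : R := symm_kernel gamma z.1 z.2.

Let kernelE : symm_kernel2 = fun z => log_kernel z + k0 z.1.
Proof. by apply/funext => -[t s]; exact: symm_kernelE. Qed.

Let k0_schur : exists C, schur mu C (fun z : T * T => k0 z.1).
Proof.
have [mk [B kB]] := bounded_k0; eexists.
by apply: (@bounded_schur _ _ _ mu _ B) => //; exact: measurable_fst_comp.
Qed.

Lemma symm_kernel_schur : exists C, schur mu C symm_kernel2.
Proof.
have [C1 h1] := log_kernel_schur; have [C2 h2] := k0_schur.
by exists (C1 + C2); rewrite kernelE; exact: schurD.
Qed.

Lemma symm_operatorE Psi (u w : T -> R) t : measurable_fun setT u ->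
  measurable_fun setT w -> (forall s, period s -> Psi s = u s +i* w s) ->
  symm_operator gamma Psi t = apply_at mu symm_kernel2 u t +i* apply_at mu symm_kernel2 w t.
Proof.
move=> mu_ mw PE; have [C [mK _ _]] := symm_kernel_schur.
have mKt : measurable_fun setT (fun s : T => symm_kernel2 (t, s)) by exact: measurableT_comp.
rewrite /symm_operator /cintegral; congr (_ +i* _); apply: integral_total.
- exact: measurable_funM.
- by move=> s /PE ->; rewrite /symm_kernel2/=; ring.
- exact: measurable_funM.
- by move=> s /PE ->; rewrite /symm_kernel2/=; ring.
Qed.

Lemma inner_symm_operator h f : square_summable mu h -> bounded_mfun f ->
  inner mu (apply_at mu symm_kernel2 h) f = modified_form mu V v h f.
Proof.
move=> sh bf; have sf := bounded_mfun_square_summable mu bf.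
have [C hC] := symm_kernel_schur; have [C1 h1] := log_kernel_schur; have [C2 h2] := k0_schur.
rewrite -(form_apply hC)//.
have -> : form mu symm_kernel2 h f = form mu log_kernel h f + form mu (fun z : T * T => k0 z.1) h f.
  rewrite /form -totalD; [|exact: schur_summable1 h1 sh sf|exact: schur_summable1 h2 sh sf].
  by congr total; apply/funext => z; rewrite kernelE mulrDl.
rewrite form_log_kernel// (form_apply h2)// /modified_form -addrA; congr (_ + _).
have sA := apply_at_summable1 h1 sv sf.
have sf1 := square_summable_summable1 sf.
rewrite (_ : inner mu _ f = total mu (fun t => (total mu h / L) * (f t - apply_at mu log_kernel v t * f t))).
  rewrite totalZ; last exact: summable1B.
  by rewrite totalB// -[total mu (fun _ => _ * _)]/(inner mu _ f) -(form_apply h1)// form_log_kernel//; ring.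
rewrite /inner; congr total; apply/funext => t.
rewrite [apply_at mu (fun z => k0 z.1) h t]/apply_at/= totalZ; last exact: square_summable_summable1.
by rewrite /k0; ring.
Qed.

Lemma L2inner_symm_operator Psi psi (u w p q : T -> R) :
  square_summable mu u -> square_summable mu w -> bounded_mfun p -> bounded_mfun q ->
  (forall t, period t -> Psi t = u t +i* w t) ->
  (forall t, period t -> psi t = p t +i* q t) ->
  L2inner (symm_operator gamma Psi) psi =
  (modified_form mu V v u p + modified_form mu V v w q) +i*
  (modified_form mu V v w p - modified_form mu V v u q).
Proof.
move=> su sw bp bq PE pE; have [[mu_ _] [mw _]] := (su, sw).
have [C hC] := symm_kernel_schur.
have sp := bounded_mfun_square_summable mu bp; have sq := bounded_mfun_square_summable mu bq.
rewrite (L2innerE (u := apply_at mu symm_kernel2 u) (w := apply_at mu symm_kernel2 w)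
  (p := p) (q := q)).
- by rewrite !inner_symm_operator.
- exact: measurable_apply_at hC su.
- exact: measurable_apply_at hC sw.
- by move=> t _; exact: symm_operatorE.
- exact: pE.
- exact: apply_at_summable1 hC su sp.
- exact: apply_at_summable1 hC sw sq.
- exact: apply_at_summable1 hC sw sp.
- exact: apply_at_summable1 hC su sq.
Qed.

End SymmOperator.

(** * The trial spaces and the Sobolev tail *)

Section TrialSpace.
Local Open Scope complex_scope.
Context {R : realType}.
Variable n : nat.
Local Notation N := (n.*2.+1).
Implicit Types (f g : R -> R[i]) (a b : R -> R) (k : nat).

Lemma trig_space_term (j : 'I_N) (z : R[i]) :
  trig_space n (fun t : R => z * expi ((j%:R - n%:R) * t)).
Proof.
exists (fun i => if i == j then z else 0); apply/funext => t.
rewrite (bigD1 j)//= eqxx big1 ?addr0// => i /negbTE ->.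
by rewrite mul0r.
Qed.

Lemma trig_spaceD f g : trig_space n f -> trig_space n g ->
  trig_space n (fun t => f t + g t).
Proof.
move=> [a ->] [b ->]; exists (fun j => a j + b j); apply/funext => t.
by rewrite -big_split; apply: eq_bigr => j _; exact/esym/mulrDl.
Qed.

Lemma trig_space_expi k (z : R[i]) : (k <= n)%N ->
  trig_space n (fun t => z * expi (k%:R * t)) /\
  trig_space n (fun t => z * expi (- (k%:R * t))).
Proof.
move=> kn; have h1 : (n + k < N)%N by rewrite ltnS -addnn leq_add2l.
have h2 : (n - k < N)%N by rewrite ltnS -addnn (leq_trans (leq_subr _ _))// leq_addr.
split.
  have := trig_space_term (Ordinal h1) z.
  by rewrite /= natrD; under eq_fun do rewrite (addrAC n%:R) subrr add0r.
have := trig_space_term (Ordinal h2) z.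
by rewrite /= natrB//; under eq_fun do rewrite (addrAC n%:R) subrr add0r mulNr.
Qed.

Lemma trig_space_trig j (z : R[i]) : (j < N)%N -> trig_space n (fun t => z * (trig j t)%:C).
Proof.
move=> jN; pose k := uphalf j.
have kn : (k <= n)%N by rewrite /k; move: jN; rewrite ltnS; lia.
pose w : R[i] := ((wave_norm j)^-1)%:C.
rewrite /trig /wave; case: (odd j || (j == 0)%N).
  have [h1 _] := trig_space_expi (z * w * (2^-1)%:C) kn.
  have [_ h2] := trig_space_expi (z * w * (2^-1)%:C) kn.
  have := trig_spaceD h1 h2; congr trig_space; apply/funext => t.
  rewrite -mulrDr -!mulrA; congr (_ * _); rewrite /w /expi cosN sinN -/k.
  simpc.
  by apply/eqP; rewrite eq_complex/= eqxx andbT; apply/eqP; field; rewrite gt_eqF ?wave_norm_gt0.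
have [h1 _] := trig_space_expi (z * w * (0 -i* (2^-1))) kn.
have [_ h2] := trig_space_expi (z * w * (0 +i* (2^-1))) kn.
have := trig_spaceD h1 h2; congr trig_space; apply/funext => t.
rewrite -!mulrA -!mulrDr; congr (_ * _); rewrite /w /expi cosN sinN -/k.
simpc.
by apply/eqP; rewrite eq_complex/=; apply/andP; split; apply/eqP; field; rewrite gt_eqF ?wave_norm_gt0.
Qed.

Lemma trig_space_comb (c d : nat -> R) :
  trig_space n (fun t => comb trig c N t +i* comb trig d N t).
Proof.
suff : forall M, (M <= N)%N -> trig_space n (fun t => comb trig c M t +i* comb trig d M t).
  exact.
elim=> [_|M IHM MN].
  exists (fun=> 0); apply/funext => t; rewrite /comb !big_ord0 big1// => j _.
  by rewrite mul0r.
have := trig_spaceD (IHM (ltnW MN)) (trig_space_trig (c M +i* d M) MN).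
congr trig_space; apply/funext => t; rewrite /comb !big_ord_recr/=.
by simpc.
Qed.

Definition real_span a := exists c, a = comb trig c N.

Lemma real_spanD a b : real_span a -> real_span b -> real_span (fun t => a t + b t).
Proof.
move=> [c ->] [d ->]; exists (fun j => c j + d j); apply/funext => t.
by rewrite /comb -big_split/=; apply: eq_bigr => j _; rewrite mulrDl.
Qed.

Lemma real_spanZ (x : R) a : real_span a -> real_span (fun t => x * a t).
Proof.
move=> [c ->]; exists (fun j => x * c j); apply/funext => t.
by rewrite /comb mulr_sumr; apply: eq_bigr => j _; rewrite mulrA.
Qed.

Lemma real_span_wave j : (j < N)%N -> real_span (wave j).
Proof.
move=> jN; exists (fun i => if i == j then wave_norm j else 0); apply/funext => t.
rewrite /comb (bigD1 (Ordinal jN))//= eqxx big1 ?addr0 => [|i /negbTE].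
  by rewrite /trig mulrA divff ?mul1r// gt_eqF ?wave_norm_gt0.
by rewrite -val_eqE/= => ->; rewrite mul0r.
Qed.

Lemma real_span_cos_sin k : (k <= n)%N ->
  real_span (fun t => cos (k%:R * t)) /\ real_span (fun t => sin (k%:R * t)).
Proof.
case: k => [|k] kn.
  split.
    by rewrite (_ : (fun t => _) = wave 0)//; exact: real_span_wave.
  rewrite (_ : (fun t => _) = fun t => 0 * wave 0 t).
    by apply/real_spanZ/real_span_wave.
  by apply/funext => t; rewrite !mul0r sin0.
split.
  rewrite (_ : (fun t => _) = wave k.*2.+1); first by apply: real_span_wave; lia.
  by apply/funext => t; rewrite /wave/= odd_double/= doubleK.
rewrite (_ : (fun t => _) = wave k.+1.*2); first by apply: real_span_wave; lia.
by apply/funext => t; rewrite /wave odd_double/= uphalf_double.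
Qed.

Lemma trig_space_split f : trig_space n f ->
  exists c d, f = fun t => comb trig c N t +i* comb trig d N t.
Proof.
suff main : trig_space n f -> exists a b,
    [/\ real_span a, real_span b & f = fun t => a t +i* b t].
  by move=> /main[a [b [[c ->] [d ->] ->]]]; exists c, d.
have zero : real_span (fun=> 0).
  exists (fun=> 0); apply/funext => t.
  by rewrite /comb big1// => j _; rewrite mul0r.
move=> [z ->].
have -> : (fun t => \sum_(j < N) z j * expi ((j%:R - n%:R) * t)) =
   (fun t => \sum_(j <- enum 'I_N) z j * expi ((j%:R - n%:R) * t)).
  by apply/funext => t; rewrite big_enum.
elim: (enum _) => [|j s [a [b [ha hb e]]]].
  by exists (fun=> 0), (fun=> 0); split=> //; under eq_fun do rewrite big_nil.
have e' t : \sum_(j <- s) z j * expi ((j%:R - n%:R) * t) = a t +i* b t.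
  by have /(congr1 (fun h => h t)) := e.
have [hc hs] : real_span (fun t => cos ((j%:R - n%:R) * t)) /\
    real_span (fun t => sin ((j%:R - n%:R) * t)).
  have [nj|jn] := leqP n j.
    have kn : (j - n <= n)%N by have := ltn_ord j; lia.
    by have := real_span_cos_sin kn; rewrite natrB.
  have kn : (n - j <= n)%N by exact: leq_subr.
  have [h1 h2] := real_span_cos_sin kn; split.
    rewrite (_ : (fun t => _) = fun t => cos ((n - j)%:R * t))//.
    by apply/funext => t; rewrite -cosN natrB ?(ltnW jn)//; congr cos; ring.
  rewrite (_ : (fun t => _) = fun t => -1 * sin ((n - j)%:R * t)); first exact: real_spanZ.
  by apply/funext => t; rewrite mulN1r -sinN natrB ?(ltnW jn)//; congr sin; ring.
exists (fun t => (complex.Re (z j) * cos ((j%:R - n%:R) * t) +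
                   - complex.Im (z j) * sin ((j%:R - n%:R) * t)) + a t),
       (fun t => (complex.Re (z j) * sin ((j%:R - n%:R) * t) +
                  complex.Im (z j) * cos ((j%:R - n%:R) * t)) + b t).
split; [by do 2 apply: real_spanD => //; exact: real_spanZ..|].
apply/funext => t; rewrite big_cons e'; case: (z j) => zr zi.
by apply/eqP; rewrite eq_complex/= mulNr !eqxx.
Qed.

End TrialSpace.

Section SobolevTail.
Local Open Scope complex_scope.
Context {R : realType}.
Local Notation l := (2 * pi : R).
Local Notation mu := (@period_measure R).
Local Notation T := (measurableTypeR R).
Implicit Types (f : R -> R[i]) (u w : T -> R) (k m n : nat).

Local Notation cosz k := (fun t : T => cos (k%:~R * t)).
Local Notation sinz k := (fun t : T => sin (k%:~R * t)).

Lemma fourier_coefE f u w (k : int) : square_summable mu u -> square_summable mu w ->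
  (forall t, period t -> f t = u t +i* w t) ->
  fourier_coef f k = (l^-1 * (inner mu u (cosz k) + inner mu w (sinz k)))
    +i* (l^-1 * (inner mu w (cosz k) - inner mu u (sinz k))).
Proof.
move=> su sw fE; have [[mu_ _] [mw _]] := (su, sw).
have bc := bounded_mfun_square_summable mu (bounded_cosM (k%:~R : R)).
have bs := bounded_mfun_square_summable mu (bounded_sinM (k%:~R : R)).
rewrite /fourier_coef.
have -> : cintegral (fun t => f t * expi (- (k%:~R * t))) =
    L2inner f (fun t => cos (k%:~R * t) +i* sin (k%:~R * t)).
  rewrite /L2inner; congr cintegral; apply/funext => t; congr (_ * _).
  by rewrite /expi cosN sinN.
rewrite (L2innerE mu_ mw fE (fun t _ => erefl));
  [|exact: (summable1_mul su bc)|exact: (summable1_mul sw bs)|exact: (summable1_mul sw bc)|exact: (summable1_mul su bs)].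
by apply/eqP; rewrite eq_complex/= !mul0r subr0 addr0 !eqxx.
Qed.

Lemma sqr_inner_cos_sin u k : square_summable mu u ->
  inner mu u (cosz (Posz k.+1)) ^+ 2 + inner mu u (sinz (Posz k.+1)) ^+ 2 =
  pi * (inner mu u (trig k.*2.+1) ^+ 2 + inner mu u (trig k.*2.+2) ^+ 2).
Proof.
move=> su; have pi0 : 0 < pi :> R := pi_gt0 R.
have wn j : (0 < j)%N -> wave_norm j ^+ 2 = pi :> R.
  by move=> j0; rewrite /wave_norm (gtn_eqF j0) sqr_sqrtr ?pi_ge0.
have h j : (0 < j)%N -> pi * inner mu u (trig j) ^+ 2 = inner mu u (wave j) ^+ 2.
  move=> j0; rewrite /trig innerZr//; last exact/bounded_mfun_square_summable/bounded_wave.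
  by rewrite exprMn exprVn wn// mulrA divff ?mul1r// gt_eqF.
rewrite mulrDr !h//; congr (inner mu u _ ^+ 2 + inner mu u _ ^+ 2); apply/funext => t.
  by rewrite /wave/= odd_double/= doubleK.
by rewrite /wave -doubleS odd_double/= uphalf_double.
Qed.

(** Over a pair of opposite frequencies the complex coefficients have the size
   of the four real ones. *)
Lemma cmod2_fourier f u w k : square_summable mu u -> square_summable mu w ->
  (forall t, period t -> f t = u t +i* w t) ->
  inner mu u (trig k.*2.+1) ^+ 2 + inner mu u (trig k.*2.+2) ^+ 2 +
  (inner mu w (trig k.*2.+1) ^+ 2 + inner mu w (trig k.*2.+2) ^+ 2) =
  l * (cmod2 (fourier_coef f (Posz k.+1)) + cmod2 (fourier_coef f (Negz k))).
Proof.
move=> su sw fE; have pi0 : pi != 0 :> R by rewrite gt_eqF ?pi_gt0.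
have cN : cosz (Negz k) = cosz (Posz k.+1).
  by apply/funext => t; rewrite NegzE mulrNz mulNr cosN.
have bs := bounded_mfun_square_summable mu (bounded_sinM ((Posz k.+1)%:~R : R)).
have sN h : square_summable mu h -> inner mu h (sinz (Negz k)) = - inner mu h (sinz (Posz k.+1)).
  move=> sh; rewrite -mulN1r -innerZr//; congr inner; apply/funext => t.
  by rewrite mulN1r NegzE mulrNz mulNr sinN.
rewrite !(fourier_coefE _ su sw fE) cN !sN// /cmod2/=.
apply: (mulfI pi0); rewrite mulrDr -!sqr_inner_cos_sin//.
move: (inner mu u _) (inner mu w _) (inner mu u (sinz _)) (inner mu w (sinz _)) => a b c d.
by move: (pi : R) pi0 => x x0; field.
Qed.

Lemma sum_pairs (F : nat -> R) n m : (n <= m)%N ->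
  \sum_(n.*2.+1 <= j < m.*2.+1) F j = \sum_(n <= i < m) (F i.*2.+1 + F i.*2.+2).
Proof.
move=> nm; elim: m nm => [|m IHm].
  by rewrite leqn0 => /eqP ->; rewrite !big_geq.
rewrite leq_eqVlt => /predU1P[->|nm]; first by rewrite !big_geq.
rewrite doubleS big_nat_recr/=; last lia.
rewrite big_nat_recr/=; last lia.
by rewrite IHm// big_nat_recr//= addrA.
Qed.

Lemma sobolev_tail (r : R) n f u w : 0 <= r -> (0 < n)%N ->
  square_summable mu u -> square_summable mu w ->
  (forall t, period t -> f t = u t +i* w t) -> (sobolev_sum r f < +oo)%E ->
  inner mu (fun t => u t - proj mu trig n.*2.+1 u t) (fun t => u t - proj mu trig n.*2.+1 u t) +
  inner mu (fun t => w t - proj mu trig n.*2.+1 w t) (fun t => w t - proj mu trig n.*2.+1 w t) <=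
  l * (n%:R `^ r)^-1 ^+ 2 * fine (sobolev_sum r f).
Proof.
move=> r0 n0 su sw fE fin.
pose b (k : int) : R := (1 + k%:~R ^+ 2) `^ r * cmod2 (fourier_coef f k).
have b0 (k : int) : 0 <= b k by rewrite mulr_ge0 ?powR_ge0// addr_ge0 ?sqr_ge0.
have sge0 : (0 <= sobolev_sum r f)%E.
  apply: esum_ge0 => k _; rewrite lee_fin.
  exact: b0.
have sfin : sobolev_sum r f \is a fin_num by rewrite ge0_fin_numE.
have nr0 : 0 < n%:R `^ r :> R by rewrite powR_gt0// ltr0n.
pose E (h : T -> R) j := inner mu h (trig j) ^+ 2.
(* finitely many Fourier modes *)
have finite m : \sum_(n <= i < m) (b (Posz i.+1) + b (Negz i)) <= fine (sobolev_sum r f).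
  rewrite -lee_fin fineK//; apply: esum_ge.
  pose s := [seq Posz i.+1 | i <- index_iota n m] ++ [seq Negz i | i <- index_iota n m].
  have us : uniq s.
    rewrite cat_uniq !map_inj_uniq ?iota_uniq//=; last 2 first.
    - by move=> i j [].
    - by move=> i j [].
    by rewrite andbT; apply/hasPn => _ /mapP[i _ ->]; apply/mapP => -[].
  exists [set` s]; first by split=> //; exact: finite_seq.
  rewrite -fsbig_seq// sumEFin lee_fin /s big_cat/= !big_map -big_split/=.
  exact: lexx.
have weight m : \sum_(n <= i < m) ((E u i.*2.+1 + E u i.*2.+2) + (E w i.*2.+1 + E w i.*2.+2)) <=
    l * (n%:R `^ r)^-1 ^+ 2 * fine (sobolev_sum r f).
  apply: (@le_trans _ _ (l * (n%:R `^ r)^-1 ^+ 2 * \sum_(n <= i < m) (b (Posz i.+1) + b (Negz i)))); last first.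
    by rewrite ler_wpM2l// mulr_ge0 ?sqr_ge0// ltW// period_gt0.
  rewrite mulr_sumr; apply: ler_sum_nat => i /andP[ni _].
  rewrite /E (cmod2_fourier _ su sw fE) -[leRHS]mulrA.
  apply: ler_wpM2l; first exact/ltW/period_gt0.
  have wt : (n%:R `^ r) ^+ 2 <= (1 + i.+1%:R ^+ 2) `^ r :> R.
    rewrite expr2 -powRM// ge0_ler_powR ?nnegrE ?mulr_ge0// ?addr_ge0 ?sqr_ge0//.
    rewrite -expr2 -!natrX nat1r ler_nat (leq_trans _ (leqnSn _))//.
    by rewrite leq_exp2r// (leq_trans ni).
  have bE (k : int) : k%:~R ^+ 2 = i.+1%:R ^+ 2 :> R ->
      cmod2 (fourier_coef f k) <= (n%:R `^ r)^-1 ^+ 2 * b k.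
    move=> kE; rewrite /b kE exprVn mulrC ler_pdivlMr ?exprn_gt0// mulrC ler_wpM2r//.
    by rewrite addr_ge0 ?sqr_ge0.
  by rewrite mulrDr lerD// bE// NegzE mulrNz sqrrN.
pose res (h : T -> R) m := inner mu (fun t => h t - proj mu trig m.*2.+1 h t)
   (fun t => h t - proj mu trig m.*2.+1 h t).
have resE h m : square_summable mu h -> (n <= m)%N ->
    res h n = \sum_(n <= i < m) (E h i.*2.+1 + E h i.*2.+2) + res h m.
  move=> sh nm; rewrite /res !(sqr_norm_residual (@bounded_trig R) (@trig_orthonormal R))//.
  rewrite -sum_pairs// -!(big_mkord xpredT (fun j => inner mu h (trig j) ^+ 2)).
  by rewrite [X in _ = _ + (_ - X)](big_cat_nat _ (n := n.*2.+1))//= ?ltnS ?leq_double//; rewrite /E; ring.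
apply/ler_addgt0Pr => eps eps0.
have e2 : 0 < eps / 2 by rewrite divr_gt0.
have [Nu hu] := trig_complete su e2; have [Nw hw] := trig_complete sw e2.
pose m := (n + Nu + Nw)%N.
have nm : (n <= m)%N by rewrite /m -addnA leq_addr.
have ru : res u m < eps / 2.
  apply: le_lt_trans hu; apply: residual_nonincreasing => //; try exact: bounded_trig.
    exact: trig_orthonormal.
  by rewrite /m; lia.
have rw_ : res w m < eps / 2.
  apply: le_lt_trans hw; apply: residual_nonincreasing => //; try exact: bounded_trig.
    exact: trig_orthonormal.
  by rewrite /m; lia.
change (res u n + res w n <= l * (n%:R `^ r)^-1 ^+ 2 * fine (sobolev_sum r f) + eps).
rewrite (resE u m)// (resE w m)//.
have := weight m; rewrite big_split/= => h.
have split_sum (a c X p q e : R) : a + c <= X -> p < e / 2 -> q < e / 2 ->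
    a + p + (c + q) <= X + e by lra.
exact: split_sum h ru rw_.
Qed.

End SobolevTail.

(** * The error estimate *)

Section ErrorEstimate.
Local Open Scope complex_scope.
Context {R : realType}.
Local Notation l := (2 * pi : R).
Local Notation mu := (@period_measure R).
Local Notation T := (measurableTypeR R).
Variable gamma : R -> R * R.
Local Notation x := (fst \o gamma).
Local Notation y := (snd \o gamma).
Local Notation mform := (modified_form mu (curve_kernel x y) (speed x y)).

Lemma periodic_simple : (forall t, gamma (t + l) = gamma t) ->
  {in `[0, l[ &, injective gamma} ->
  forall t s, 0 < `|t - s| < l -> ~ (x t = x s /\ y t = y s).
Proof.
move=> pg inj t s /andP[ts0 tsl] [e1 e2].
have l0 := period_gt0 (R := R).
have [z hz] := period_reduce t; have [z' hz'] := period_reduce s.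
have e : t + z%:~R * l = s + z'%:~R * l.
  apply: inj; rewrite ?in_itv//= !(periodic_int _ _ pg).
  by rewrite (surjective_pairing (gamma t)) (surjective_pairing (gamma s)) -[(gamma t).1]/(x t)
    -[(gamma t).2]/(y t) e1 e2.
have ze : t - s = (z' - z)%:~R * l by rewrite intrB; lra.
move: ts0 tsl; rewrite ze normrM (gtr0_norm l0) => h1.
rewrite -ltr_pdivlMr// divff ?gt_eqF// -intr_norm -[1]/(1%:~R) ltr_int => h2.
have z0 : (z' - z = 0)%R by apply/eqP; rewrite -normr_le0; lia.
by move: h1; rewrite z0 normr0 mul0r ltxx.
Qed.

Hypotheses (ax : real_analytic x) (ay : real_analytic y).
Hypotheses (px : periodic2pi x) (py : periodic2pi y).
Hypothesis simple : forall t s, 0 < `|t - s| < l -> ~ (x t = x s /\ y t = y s).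
Hypothesis regular : forall t, 0 < derive1 x t ^+ 2 + derive1 y t ^+ 2.

Let bt j : bounded_mfun (trig j : T -> R). Proof. exact: bounded_trig. Qed.
Let st j : square_summable mu (trig j). Proof. exact/bounded_mfun_square_summable/bt. Qed.

Let combD (c d : nat -> R) N : comb trig (fun j => c j + d j) N =
  fun t : T => comb trig c N t + comb trig d N t.
Proof.
by apply/funext => t; rewrite /comb -big_split/=; apply: eq_bigr => j _; rewrite mulrDl.
Qed.

Let scomb (c : nat -> R) N : square_summable mu (comb trig c N).
Proof. exact: comb_square_summable. Qed.

Let inner0 (h : T -> R) : inner mu h (fun=> 0) = 0.
Proof. by rewrite innerC inner0l. Qed.

Let mform_comb0 (b : nat -> R) N : (forall j, (j < N)%N -> mform (comb trig b N) (trig j) = 0) ->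
  forall c, mform (comb trig b N) (comb trig c N) = 0.
Proof.
move=> hb c; have [C VC] := curve_kernel_schur ax ay px py simple regular.
have sv : bounded_mfun (speed x y : T -> R) := bounded_speed ax ay px py.
suff : forall M, (M <= N)%N -> mform (comb trig b N) (comb trig c M) = 0 by apply.
elim=> [_|M IHM MN].
  have -> : comb trig c 0 = fun t : T => 0 * trig 0 t.
    by apply/funext => t; rewrite /comb big_ord0 mul0r.
  by rewrite (modified_formZr VC sv)// mul0r.
have -> : comb trig c M.+1 = fun t : T => comb trig c M t + c M * trig M t.
  by apply/funext => t; rewrite /comb big_ord_recr.
rewrite (modified_formDr VC sv)//; last exact: square_summableZ.
by rewrite (modified_formZr VC sv)// hb// mulr0 IHM ?addr0// ltnW.
Qed.

Lemma galerkin_coordinates gdelta n (c d : nat -> R) : in_L2 gdelta ->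
  solves_galerkin gamma gdelta n (fun t => comb trig c n.*2.+1 t +i* comb trig d n.*2.+1 t) ->
  forall j, (j < n.*2.+1)%N ->
    mform (comb trig c n.*2.+1) (trig j) = inner mu (re gdelta) (trig j) /\
    mform (comb trig d n.*2.+1) (trig j) = inner mu (im gdelta) (trig j).
Proof.
move=> hg [_ hs] j jN.
have tj : trig_space n (fun t : R => trig j t +i* 0).
  have := @trig_space_trig R n j 1 jN.
  by rewrite (_ : (fun t => _) = fun t : R => trig j t +i* 0)//; apply/funext => t; rewrite mul1r.
have [sr si] := (square_summable_re hg, square_summable_im hg).
have b0 : bounded_mfun ((fun=> 0) : T -> R) by exact: bounded_mfun_cst.
have s0 := bounded_mfun_square_summable mu b0.
have := hs _ tj.
rewrite (L2inner_symm_operator ax ay px py simple regular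
  (u := comb trig c n.*2.+1) (w := comb trig d n.*2.+1) (p := trig j) (q := fun=> 0)
  (scomb c _) (scomb d _) (bt j) b0)//.
rewrite (L2innerE (u := re gdelta) (w := im gdelta) (p := trig j) (q := fun=> 0)).
- have z h : square_summable mu h -> mform h (fun=> 0) = 0.
    by move=> sh; rewrite -inner_symm_operator// inner0.
  by rewrite !z// !inner0 !addr0 !subr0 => -[-> ->].
- exact: measurable_re.
- exact: measurable_im.
- by move=> t pt; apply/eqP; rewrite eq_complex/= (reE _ pt) (imE _ pt) !eqxx.
- by [].
- exact: (summable1_mul sr (st j)).
- exact: (summable1_mul si s0).
- exact: (summable1_mul si (st j)).
- exact: (summable1_mul sr s0).
Qed.

Lemma solution_coordinates g Psi (j : nat) : in_L2 g -> in_L2 Psi ->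
  eq_ae (symm_operator gamma Psi) g ->
  mform (re Psi) (trig j) = inner mu (re g) (trig j) /\
  mform (im Psi) (trig j) = inner mu (im g) (trig j).
Proof.
move=> hg hP [N [mN N0 hN]].
have [C hC] := symm_kernel_schur ax ay px py simple regular.
have [su sw] := (square_summable_re hP, square_summable_im hP).
have PE t : period t -> Psi t = re Psi t +i* im Psi t.
  by move=> pt; apply/eqP; rewrite eq_complex/= (reE _ pt) (imE _ pt) !eqxx.
have SE t : symm_operator gamma Psi t =
    apply_at mu (symm_kernel2 gamma) (re Psi) t +i* apply_at mu (symm_kernel2 gamma) (im Psi) t.
  by apply: symm_operatorE => //; [exact: measurable_re|exact: measurable_im].
have nul : mu (N `|` ~` period) = 0%E.
  change (@lebesgue_measure R ((N `|` ~` period) `&` period) = 0%E).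
  rewrite setIUl setICl setU0; apply: (subset_measure0 _ mN _ N0) => //.
  by apply: measurableI => //; exact: measurable_period.
have ae (h1 h2 : T -> R) : measurable_fun setT h1 -> measurable_fun setT h2 ->
    (forall t, ~ N t -> period t -> h1 t = h2 t) -> inner mu h1 (trig j) = inner mu h2 (trig j).
  move=> m1 m2 e; have [mt _] := bt j.
  rewrite /inner /total /Rintegral; congr fine; apply: ae_eq_integral => //.
  - by apply/measurable_EFinP; exact: measurable_funM.
  - by apply/measurable_EFinP; exact: measurable_funM.
  - exists (N `|` ~` period); split=> //.
      by apply: measurableU => //; apply: measurableC; exact: measurable_period.
    move=> t /= hP'; apply: contrapT => /not_orP[nN /contrapT pt]; apply: hP' => _.
    by rewrite e.
have eN t : ~ N t -> period t -> symm_operator gamma Psi t = g t.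
  by move=> nN pt; apply: contrapT => h; apply: nN; apply: hN => /= /(_ pt).
split; rewrite -inner_symm_operator//; apply: ae.
- exact: measurable_apply_at hC su.
- exact: measurable_re.
- by move=> t nN pt; have := eN t nN pt; rewrite SE => /(congr1 (@complex.Re R)) /= ->; exact: reE.
- exact: measurable_apply_at hC sw.
- exact: measurable_im.
- by move=> t nN pt; have := eN t nN pt; rewrite SE => /(congr1 (@complex.Im R)) /= ->; exact: imE.
Qed.

(** Adding a real solution of the homogeneous system to the real or to the
   imaginary part gives another Galerkin solution. *)
Lemma galerkin_injective gdelta n (c d b b' : nat -> R) :
  galerkin_solution gamma gdelta n (fun t => comb trig c n.*2.+1 t +i* comb trig d n.*2.+1 t) ->
  (forall j, (j < n.*2.+1)%N -> mform (comb trig b n.*2.+1) (trig j) = 0) ->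
  (forall j, (j < n.*2.+1)%N -> mform (comb trig b' n.*2.+1) (trig j) = 0) ->
  forall j, (j < n.*2.+1)%N -> b j = 0 /\ b' j = 0.
Proof.
set N := n.*2.+1; move=> [[tn hs] uniq] hb hb' j jN.
have [C VC] := curve_kernel_schur ax ay px py simple regular.
have sv : bounded_mfun (speed x y : T -> R) := bounded_speed ax ay px py.
have bcomb (a : nat -> R) : bounded_mfun (comb trig a N : T -> R) by exact: bounded_comb.
pose Phi t := comb trig (fun j => c j + b j) N t +i* comb trig (fun j => d j + b' j) N t.
have sPhi : solves_galerkin gamma gdelta n Phi.
  split; first exact: trig_space_comb.
  move=> psi tpsi; rewrite -(hs psi tpsi); have [p [q ->]] := trig_space_split tpsi.
  rewrite !(L2inner_symm_operator ax ay px py simple regular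
    (p := comb trig p N) (q := comb trig q N) (scomb _ _) (scomb _ _) (bcomb _) (bcomb _) (fun _ _ => erefl))//.
  by rewrite !combD !(modified_formDl VC)// !(mform_comb0 hb) !(mform_comb0 hb') !addr0.
have e := uniq _ sPhi.
have e1 : comb trig (fun j => c j + b j) N = comb trig c N.
  by apply/funext => t; have /(congr1 (fun h => complex.Re (h t))) := e.
have e2 : comb trig (fun j => d j + b' j) N = comb trig d N.
  by apply/funext => t; have /(congr1 (fun h => complex.Im (h t))) := e.
have coef (a a' : nat -> R) : comb trig (fun j => a j + a' j) N = comb trig a N -> a' j = 0.
  move=> /(congr1 (fun h => inner mu h (trig j))).
  rewrite !(inner_comb_e (@bounded_trig R) (@trig_orthonormal R))// => h.
  by apply: (addrI (a j)); rewrite addr0.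
by split; [exact: coef e1|exact: coef e2].
Qed.

(** The kernel is real, so the real and the imaginary part solve separate real
   systems. *)
Lemma galerkin_estimate (r : R) : 0 <= r ->
  exists c : R, 0 < c /\
    forall (g Psi gdelta Psin : R -> R[i]) (delta : R) (n : nat),
      in_L2 g -> in_sobolev r Psi -> eq_ae (symm_operator gamma Psi) g ->
      0 <= delta -> in_L2 gdelta -> L2norm (fun t => gdelta t - g t) <= delta ->
      (1 <= n)%N -> galerkin_solution gamma gdelta n Psin ->
      L2norm (fun t => Psi t - Psin t)
        <= c * (n%:R * delta + (n%:R `^ r)^-1 * sobolev_norm r Psi).
Proof.
move=> r0; have [c [c0 hc]] := curve_quasi_optimal ax ay px py simple regular.
have l0 := period_gt0 (R := R).
pose c' := Num.sqrt (c * (1 + l)).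
have c'0 : 0 < c' by rewrite sqrtr_gt0 mulr_gt0// addr_gt0.
exists c'; split=> // g Psi gdelta Psin delta n hg [hP fin] hSP d0 hgd hd n1 hn.
have [[tn _] _] := hn; have [a [b ePsin]] := trig_space_split tn.
rewrite ePsin in hn *; have [hs _] := hn.
set N := n.*2.+1 in hs hn *.
have zero : forall j, (j < N)%N -> mform (comb trig (fun=> 0) N) (trig j) = 0.
  have [C VC] := curve_kernel_schur ax ay px py simple regular.
  have sv : bounded_mfun (speed x y : T -> R) := bounded_speed ax ay px py.
  move=> j _; have -> : comb trig (fun=> 0) N = fun t : T => 0 * trig 0 t.
    by apply/funext => t; rewrite /comb big1 ?mul0r// => i _; rewrite mul0r.
  by rewrite (modified_formZl VC)// mul0r.
have [su sw] := (square_summable_re hP, square_summable_im hP).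
have [sgr sgi] := (square_summable_re hg, square_summable_im hg).
have [sdr sdi] := (square_summable_re hgd, square_summable_im hgd).
pose fr (t : T) := re gdelta t - re g t; pose fi (t : T) := im gdelta t - im g t.
have sfr : square_summable mu fr by exact: square_summableB.
have sfi : square_summable mu fi by exact: square_summableB.
pose du (t : T) := re Psi t - comb trig a N t; pose dw (t : T) := im Psi t - comb trig b N t.
have hr : inner mu du du <= c * (n%:R ^+ 2 * inner mu fr fr +
    inner mu (fun t => re Psi t - proj mu trig N (re Psi) t)
             (fun t => re Psi t - proj mu trig N (re Psi) t)).
  apply: hc => // [j jN|b0 hb0 j jN].
    have [-> _] := galerkin_coordinates hgd hs jN.
    by have [-> _] := solution_coordinates j hg hP hSP; rewrite innerBl// subrKC.
  by have [] := galerkin_injective hn hb0 zero jN.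
have hi : inner mu dw dw <= c * (n%:R ^+ 2 * inner mu fi fi +
    inner mu (fun t => im Psi t - proj mu trig N (im Psi) t)
             (fun t => im Psi t - proj mu trig N (im Psi) t)).
  apply: hc => // [j jN|b0 hb0 j jN].
    have [_ ->] := galerkin_coordinates hgd hs jN.
    by have [_ ->] := solution_coordinates j hg hP hSP; rewrite innerBl// subrKC.
  by have [] := galerkin_injective hn zero hb0 jN.
have tail := sobolev_tail r0 n1 su sw (f := Psi) _ fin.
have PE t : period t -> Psi t = re Psi t +i* im Psi t.
  by move=> pt; apply/eqP; rewrite eq_complex/= (reE _ pt) (imE _ pt) !eqxx.
have {}tail := tail PE.
have sdu : square_summable mu du by apply: square_summableB => //; exact: scomb.
have sdw : square_summable mu dw by apply: square_summableB => //; exact: scomb.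
have eL := sqr_L2norm sdu sdw (f := fun t => Psi t - (comb trig a N t +i* comb trig b N t)).
have {}eL : L2norm (fun t => Psi t - (comb trig a N t +i* comb trig b N t)) ^+ 2 =
    inner mu du du + inner mu dw dw.
  by apply: eL => t pt; rewrite PE//; apply/eqP; rewrite eq_complex/= !eqxx.
have ed := sqr_L2norm sfr sfi (f := fun t => gdelta t - g t).
have {}ed : L2norm (fun t => gdelta t - g t) ^+ 2 = inner mu fr fr + inner mu fi fi.
  apply: ed => t pt; apply/eqP; rewrite eq_complex/= /fr /fi -!(reE _ pt) -!(imE _ pt).
  by case: (gdelta t) (g t) => [? ?] [? ?] /=; rewrite !eqxx.
have hd2 : inner mu fr fr + inner mu fi fi <= delta ^+ 2.
  by rewrite -ed ler_pXn2r ?nnegrE ?sqrtr_ge0.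
have sge0 : (0 <= sobolev_sum r Psi)%E.
  apply: esum_ge0 => k _; rewrite lee_fin mulr_ge0 ?powR_ge0//.
  by rewrite addr_ge0 ?sqr_ge0.
have S2 : sobolev_norm r Psi ^+ 2 = fine (sobolev_sum r Psi) by rewrite sqr_sqrtr// fine_ge0.
have q0 : 0 <= (n%:R `^ r)^-1 :> R by rewrite invr_ge0 powR_ge0.
have S0 : 0 <= sobolev_norm r Psi by exact: sqrtr_ge0.
rewrite -(ler_pXn2r (_ : 0 < 2)%N) ?nnegrE ?sqrtr_ge0//; last first.
  by rewrite mulr_ge0 ?(ltW c'0)// addr_ge0 ?mulr_ge0.
rewrite eL exprMn sqr_sqrtr; last by rewrite mulr_ge0 ?(ltW c0)// addr_ge0 ?(ltW l0).
move: hr hi tail hd2; rewrite -S2.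
move: (inner mu du du) (inner mu dw dw) (inner mu fr fr) (inner mu fi fi) => A1 A2 F1 F2.
move: (inner mu _ _) (inner mu _ _) => Q1 Q2 hr hi tail hd2.
move: ((n%:R `^ r)^-1 : R) (sobolev_norm r Psi) q0 S0 tail => q S q0 S0 tail.
have n2 : 0 <= (n%:R : R) ^+ 2 by exact: sqr_ge0.
apply: (@le_trans _ _ (c * (n%:R ^+ 2 * (F1 + F2) + (Q2 + Q1)))).
  by move: hr hi; rewrite !mulrDr; lra.
rewrite -[leRHS]mulrA; apply: ler_wpM2l; first exact: ltW.
apply: (@le_trans _ _ (n%:R ^+ 2 * delta ^+ 2 + l * q ^+ 2 * S ^+ 2)).
  by rewrite lerD// ler_wpM2l.
have X0 : 0 <= n%:R * delta by rewrite mulr_ge0.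
have Y0 : 0 <= q * S by rewrite mulr_ge0.
rewrite -mulrA -!exprMn.
move: (n%:R * delta) (q * S) X0 Y0 (l) l0 => X Y X0 Y0 w w0.
have : 0 <= X * Y by rewrite mulr_ge0.
have : 0 <= w * X ^+ 2 by rewrite mulr_ge0 ?sqr_ge0// ltW.
have : 0 <= w * (X * Y) by rewrite mulr_ge0 ?mulr_ge0// ltW.
have := sqr_ge0 Y; nra.
Qed.

End ErrorEstimate.

Theorem mainTheorem5 (R : realType) (Omega : set (R * R)) (gamma : R -> R * R)
    (hOmega : bounded_simply_connected_domain Omega)
    (hgamma : regular_analytic_parametrization Omega gamma)
    (r : R) (hr : 0 <= r) :
  exists c : R, 0 < c /\
    forall (g Psi gdelta Psin : R -> R[i]) (delta : R) (n : nat),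
      in_sobolev (r + 1) g ->
      in_sobolev r Psi ->
      eq_ae (symm_operator gamma Psi) g ->
      0 <= delta ->
      in_L2 gdelta ->
      L2norm (fun t => gdelta t - g t) <= delta ->
      (1 <= n)%N ->
      galerkin_solution gamma gdelta n Psin ->
      L2norm (fun t => Psi t - Psin t)
        <= c * (n%:R * delta + (n%:R `^ r)^-1 * sobolev_norm r Psi).
Proof.
have [[ax ay] pg inj reg _] := hgamma.
have px : periodic2pi (fst \o gamma) by move=> t; rewrite /= pg.
have py : periodic2pi (snd \o gamma) by move=> t; rewrite /= pg.
have simple := periodic_simple pg inj.
have regular t : 0 < derive1 (fst \o gamma) t ^+ 2 + derive1 (snd \o gamma) t ^+ 2.
  by have := reg t; rewrite /enorm sqrtr_gt0.
have [c [c0 hc]] := galerkin_estimate ax ay px py simple regular hr.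
exists c; split=> // g Psi gdelta Psin delta n [hg _].
exact: hc.
Qed.
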